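(* Let $\Omega\subset\mathbb{R}^n$, $n\in\mathbb{N}$, be a bounded domain with smooth boundary and let $T>0$. Let $u^0\in H^1_0(\Omega)$, $f\in L^2(\Omega)$ (independent of time) and $u^c\in H^2(\Omega)$ with $u^c\le 0$ on $\partial\Omega$. Assume moreover that $u^0>u^c$ a.e. in $\Omega$ and that $\Delta u^c+f\le 0$ a.e. in $\Omega$. If $u$ is a solution (in the sense given in the context) of the degenerate parabolic problem $$u_t-H(u-u^c)(\Delta u+f)=0 \ \text{ a.e. in }\Omega,\ \text{for all } t\in(0,T),\qquad u(0)=u^0 \ \text{ in }\Omega,\qquad u=0 \ \text{ on }\partial\Omega,\ \text{for all } t\in(0,T),$$ then $u$ coincides for any time with the unique solution $w$ of the parabolic obstacle problem $$w(t)\in\mathcal{K},\quad \int_\Omega (w_t-\Delta w-f)(\varphi-w)\,dx\ge 0\quad \forall \varphi\in\mathcal{K},\ \forall t\in(0,T),\qquad w(0)=u^0\in\mathcal{K},$$ and hence with the solution of the equivalent complementarity system, holding for all times $t$: $w\ge u^c$ in $\Omega$; $w_t\ge \Delta w+f$ a.e. in $\Omega$; $(w-u^c)(w_t-\Delta w-f)=0$ a.e. in $\Omega$; $w(\cdot,0)=u^0$ in $\Omega$; $w(\cdot,t)=0$ on $\partial\Omega$.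
   Context: $H$ is the Heaviside function with $H(0)=0$: $H(r)=1$ for $r>0$ and $H(r)=0$ for $r\le 0$. A solution of the degenerate parabolic problem is a function $u\in L^2(0,T;H^1_0(\Omega)\cap H^2(\Omega))$ with $u_t\in L^2(0,T;L^2(\Omega))$ which satisfies the problem. $\mathcal{K}=\{\varphi\in H^1_0(\Omega):\ \varphi\ge u^c \text{ in }\Omega\}$. A solution of the parabolic obstacle problem is a function $w\in L^2(0,T;\mathcal{K}\cap H^2(\Omega))$ with $w_t\in L^2(0,T;L^2(\Omega))$ satisfying the stated variational inequality and initial condition. It is well known that, when $\Omega$ is a bounded domain with smooth boundary, $u^0\in H^1_0(\Omega)$ with $u^0\in\mathcal{K}$, $f\in L^2(\Omega)$ (independent of time) and $u^c\in H^2(\Omega)$ with $u^c\le 0$ on $\partial\Omega$, it exists and is unique, and that the parabolic obstacle problem is equivalent to the complementarity system. *)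

(* Defs.v *)
From HB Require Import structures.
From mathcomp Require Import all_boot all_order all_algebra.
From mathcomp Require Import all_classical all_reals all_analysis.

Set Implicit Arguments.
Unset Strict Implicit.
Unset Printing Implicit Defensive.

Import Order.TTheory GRing.Theory Num.Theory.
Import numFieldNormedType.Exports.

Local Open Scope classical_set_scope.
Local Open Scope ring_scope.

(* 'rV[R]_n carries the sigma-algebra generated by the coordinates, i.e. the
   Borel sets. *)
Definition rV_display : measure_display.
Proof. exact: default_measure_display. Qed.

Section measurable_rV.
Context {R : realType} (n : nat).

Let coors : 'I_n -> 'rV[R]_n -> measurableTypeR R := fun i x => x 0 i.

Let rV_set0 : g_sigma_preimage coors set0.
Proof. exact: sigma_algebra0. Qed.

Let rV_setC A : g_sigma_preimage coors A -> g_sigma_preimage coors (~` A).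
Proof. exact: sigma_algebraC. Qed.

Let rV_bigcup (F : _^nat) : (forall i, g_sigma_preimage coors (F i)) ->
  g_sigma_preimage coors (\bigcup_i (F i)).
Proof. exact: sigma_algebra_bigcup. Qed.

HB.instance Definition _ := @isMeasurable.Build rV_display
  'rV[R]_n (g_sigma_preimage coors) rV_set0 rV_setC rV_bigcup.

End measurable_rV.

Section measurable_fun_rV.
Context {R : realType}.

Lemma measurable_coord n (i : 'I_n) :
  measurable_fun [set: 'rV[R]_n] (fun x => x 0 i : measurableTypeR R).
Proof.
move=> _ Y mY; rewrite setTI; apply: sub_sigma_algebra => /=.
rewrite -bigcup_seq/=; exists i => /=; first by rewrite mem_index_enum.
by exists Y => //; rewrite setTI.
Qed.

Lemma measurable_fun_rV d (T : measurableType d) n (f : T -> 'rV[R]_n) :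
  (forall i, measurable_fun setT (fun t => f t 0 i : measurableTypeR R)) ->
  measurable_fun setT f.
Proof.
move=> mf _ Y; rewrite setTI /measurable/= => mY.
suff : image_set_system setT f measurable Y.
  by rewrite /image_set_system/= setTI.
move: Y mY; apply: smallest_sub.
  exact/sigma_algebra_image/sigma_algebra_measurable.
case: n f mf => [|n] f mf; first by rewrite big_ord0.
rewrite -bigcup_mkord_ord; apply: bigcup_sub => i Ii.
move=> A [B mB <-]; rewrite /image_set_system/= !setTI.
by rewrite -[X in measurable X]setTI; exact: mf.
Qed.

Definition vcons n (p : R * 'rV[R]_n) : 'rV[R]_n.+1 :=
  \row_i (if unlift ord0 i is Some j then p.2 0 j else p.1).

Definition vuncons n (x : 'rV[R]_n.+1) : R * 'rV[R]_n :=
  (x 0 ord0, \row_j x 0 (lift ord0 j)).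

Lemma vconsK n : cancel (@vcons n) (@vuncons n).
Proof.
case=> a y; congr pair; first by rewrite mxE unlift_none.
by apply/rowP => j; rewrite !mxE liftK.
Qed.

Lemma vunconsK n : cancel (@vuncons n) (@vcons n).
Proof.
move=> x; apply/rowP => i; rewrite mxE.
by case: unliftP => [j ->|->] //=; rewrite mxE.
Qed.

Lemma measurable_vcons n :
  measurable_fun setT (@vcons n : measurableTypeR R * 'rV[R]_n -> 'rV[R]_n.+1).
Proof.
apply: measurable_fun_rV => i; case: (unliftP ord0 i) => [j|] ->.
  rewrite (_ : (fun t => _) = (fun x : 'rV[R]_n => x 0 j : measurableTypeR R) \o
     @snd (measurableTypeR R) 'rV[R]_n).
    by apply: measurableT_comp => //; exact: measurable_coord.
  by apply/funext => t /=; rewrite mxE liftK.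
rewrite (_ : (fun t => _) = @fst (measurableTypeR R) 'rV[R]_n) //.
by apply/funext => t /=; rewrite mxE unlift_none.
Qed.

Lemma measurable_vuncons n :
  measurable_fun setT
    (@vuncons n : 'rV[R]_n.+1 -> measurableTypeR R * 'rV[R]_n).
Proof.
apply/measurable_fun_pairP; split => /=; first exact: measurable_coord.
apply: measurable_fun_rV => i /=.
rewrite (_ : (fun t => _) =
  (fun x : 'rV[R]_n.+1 => x 0 (lift ord0 i) : measurableTypeR R)).
  exact: measurable_coord.
by apply/funext => t; rewrite mxE.
Qed.

End measurable_fun_rV.

Section lebesgue_step.
Context {R : realType} (n : nat).
Variable mu : {sigma_finite_measure set 'rV[R]_n -> \bar R}.

Definition leb_step : set 'rV[R]_n.+1 -> \bar R :=
  pushforward (lebesgue_measure \x mu)%E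
    (@vcons R n : (measurableTypeR R * 'rV[R]_n)%type -> _).

Let pm :=
  measure_function_pushforward__canonical__measure_function_Measure
    (lebesgue_measure \x mu)%E (@measurable_vcons R n).

HB.instance Definition _ := isMeasure.Build _ _ _ leb_step
  (@measure0 _ _ _ pm) (@measure_ge0 _ _ _ pm)
  (@measure_semi_sigma_additive _ _ _ pm).

Let leb_step_sigma_finite : sigma_finite setT leb_step.
Proof.
have /sigma_finiteP[F [TF ndF Foo]] := sigma_finiteT (@lebesgue_measure R).
have /sigma_finiteP[G [TG ndG Goo]] := sigma_finiteT mu.
exists (fun k => @vuncons R n @^-1` (F k `*` G k)).
  rewrite -preimage_bigcup (_ : \bigcup_k _ = setT) ?preimage_setT//.
  rewrite -setXTT TF TG predeqE => -[x y]; split.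
    by move=> [k _ []/= ? ?]; split; exists k.
  move=> [/= [k _ Fkx] [l _ Gly]]; exists (maxn k l) => //; split.
  - by move: x Fkx; exact/subsetPset/ndF/leq_maxl.
  - by move: y Gly; exact/subsetPset/ndG/leq_maxr.
move=> k; have [mF Fk] := Foo k; have [mG Gk] := Goo k; split.
  rewrite -[X in measurable X]setTI.
  by apply: measurable_vuncons => //; exact: measurableX.
rewrite /leb_step /pushforward -comp_preimage.
rewrite (_ : _ \o _ = id); last by apply/funext => p; exact: vconsK.
by rewrite preimage_id product_measure1E// lte_mul_pinfty// ge0_fin_numE.
Qed.

HB.instance Definition _ :=
  Measure_isSigmaFinite.Build _ _ _ leb_step leb_step_sigma_finite.

End lebesgue_step.

Section lebesgue_rV.
Context {R : realType}.

Fixpoint leb (n : nat) : {sigma_finite_measure set 'rV[R]_n -> \bar R} :=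
  match n with
  | 0%N => dirac (0 : 'rV[R]_0)
  | m.+1 => leb_step (leb m)
  end.

Lemma leb_box n (A : 'I_n -> set R) :
  (forall i, measurable (A i : set (measurableTypeR R))) ->
  leb n [set x | forall i, A i (x 0 i)] =
  (\prod_(i < n) lebesgue_measure (A i))%E.
Proof.
elim: n A => [|n IHn] A mA.
  rewrite big_ord0 /= diracE mem_set//= => i; by case: i.
rewrite big_ord_recl -IHn//= /leb_step /pushforward.
rewrite -product_measure1E//; last first.
  rewrite [X in measurable X](_ : _ = \bigcap_(i in [set: 'I_n])
      ((fun x : 'rV[R]_n => x 0 i : measurableTypeR R) @^-1`
        A (lift ord0 i))).
    apply: fin_bigcap_measurable => // i _; rewrite -[X in measurable X]setTI.
    exact: measurable_coord.
  by apply/seteqP; split => [x xA i _|x xA i]; exact: xA.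
congr (_ _); apply/seteqP; split=> -[a y] /=.
  move=> H; split; first by move: (H ord0); rewrite mxE unlift_none.
  by move=> i; move: (H (lift ord0 i)); rewrite mxE liftK.
move=> [Aa Ay] i; rewrite mxE; case: unliftP => [j ->|->] //=.
Qed.

End lebesgue_rV.

Section smooth.
Context {R : realType} {n : nat}.
Implicit Types (f : 'rV[R]_n -> R) (Omega : set 'rV[R]_n).

Definition partial (i : 'I_n) f : 'rV[R]_n -> R :=
  fun x => 'D_(delta_mx 0 i) f x.

(* C^infinity on R^n: all iterated partial derivatives are differentiable *)
Definition smooth f :=
  forall (s : seq 'I_n) x, differentiable (foldr partial f s) x.

Definition supported_in {X : topologicalType} (O : set X) (phi : X -> R) :=
  exists K : set X,
    [/\ compact K, K `<=` O & forall x, ~ K x -> phi x = 0].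

Definition test_function Omega f := smooth f /\ supported_in Omega f.

Definition boundary Omega := closure Omega `\` interior Omega.

(* Near each of its boundary points, Omega is the region on one side of the
   graph of a smooth function of n - 1 of the coordinates: [x 0 i] is the
   remaining coordinate, on which [gamma] does not depend, and [b] gives the
   orientation of its axis. *)
Definition smooth_boundary Omega :=
  forall x0, boundary Omega x0 ->
  exists (i : 'I_n) (b : bool) (gamma : 'rV[R]_n -> R),
    [/\ smooth gamma,
        forall x t, gamma (x + t *: delta_mx 0 i) = gamma x
      & \forall x \near x0, Omega x <-> gamma x < (-1) ^+ b * x 0 i].

Definition smooth_bounded_domain Omega :=
  [/\ open Omega, connected Omega, Omega !=set0, bounded_set Omega
    & smooth_boundary Omega].

End smooth.

(* Elements of L^2(Omega), H^1(Omega), H^2(Omega) are represented by functions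
   on R^n that are Borel on Omega; only their restriction to Omega, up to a null
   set, matters. *)

Section sobolev.
Context {R : realType} {n : nat}.
Variable Omega : set 'rV[R]_n.
Implicit Types (f g phi : 'rV[R]_n -> R) (Df : 'I_n -> 'rV[R]_n -> R).

Definition L2 f :=
  measurable_fun Omega f /\
  (leb n).-integrable Omega (fun x => (f x ^+ 2)%:E).

Definition L2dist_sq f g : \bar R :=
  (\int[leb n]_(x in Omega) ((f x - g x) ^+ 2)%:E)%E.

Definition weak_partial (i : 'I_n) f g :=
  forall phi, test_function Omega phi ->
  \int[leb n]_(x in Omega) (f x * partial i phi x) =
  - \int[leb n]_(x in Omega) (g x * phi x).

(* f is in H^1(Omega), with weak gradient Df *)
Definition H1_grad f Df :=
  L2 f /\ forall i, L2 (Df i) /\ weak_partial i f (Df i).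

(* f is in H^2(Omega), with weak gradient Df and weak Hessian D2f *)
Definition H2_jet f Df (D2f : 'I_n -> 'I_n -> 'rV[R]_n -> R) :=
  H1_grad f Df /\ forall i, H1_grad (Df i) (D2f i).

Definition laplacian (D2f : 'I_n -> 'I_n -> 'rV[R]_n -> R) : 'rV[R]_n -> R :=
  fun x => \sum_(i < n) D2f i i x.

(* the smooth functions phi k converge in H^1(Omega) to f, of gradient Df *)
Definition cvg_H1 (phi : nat -> 'rV[R]_n -> R) f Df :=
  L2dist_sq (phi k) f @[k --> \oo] --> 0%E /\
  forall i, L2dist_sq (partial i (phi k)) (Df i) @[k --> \oo] --> 0%E.

(* H^1_0(Omega) is the closure of the test functions in H^1(Omega) *)
Definition H10 f :=
  exists Df, H1_grad f Df /\
  exists phi : nat -> 'rV[R]_n -> R,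
    (forall k, test_function Omega (phi k)) /\ cvg_H1 phi f Df.

(* f <= 0 on the boundary, in the sense of H^1(Omega): f is a limit in
   H^1(Omega) of smooth functions that are pointwise <= 0 on the boundary.
   When the boundary is smooth this says that the trace of f is <= 0. *)
Definition nonpos_on_boundary f :=
  exists Df, H1_grad f Df /\
  exists phi : nat -> 'rV[R]_n -> R,
    (forall k, smooth (phi k) /\ forall x, boundary Omega x -> phi k x <= 0) /\
    cvg_H1 phi f Df.

Definition ae_in (P : 'rV[R]_n -> Prop) := {ae leb n, forall x, Omega x -> P x}.

Definition obstacle_set (uc : 'rV[R]_n -> R) : set ('rV[R]_n -> R) :=
  [set phi | H10 phi /\ ae_in (fun x => uc x <= phi x)].

End sobolev.

(* A function of time with values in a function space is represented by
   [v : R -> 'rV[R]_n -> R], the value at time t being [v t]. *)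

Section evolution.
Context {R : realType} {n : nat}.
Variables (T : R) (Omega : set 'rV[R]_n).
Implicit Types (u ut w : R -> 'rV[R]_n -> R) (E : set R).

(* L^2(0,T;L^2(Omega)), whose elements are represented by functions that are
   jointly measurable in time and space *)
Definition time_L2 u :=
  measurable_fun (`]0, T[ `*` Omega)
    (fun p : measurableTypeR R * 'rV[R]_n => u p.1 p.2) /\
  (\int[lebesgue_measure]_(t in `]0%R, T[)
     \int[leb n]_(x in Omega) (u t x ^+ 2)%:E < +oo)%E.

Definition time_test (psi : R -> R) :=
  (forall k t, derivable (derive1n k psi) t 1) /\
  supported_in (`]0, T[ : set R) psi.

(* ut is the weak derivative of u as an L^2(Omega)-valued function of time; the
   L^2(Omega)-valued integrals of the definition are computed pointwise in x *)
Definition weak_time_derivative u ut :=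
  forall psi, time_test psi ->
  ae_in Omega (fun x =>
    \int[lebesgue_measure]_(t in `]0, T[) (u t x * derive1 psi t) =
    - \int[lebesgue_measure]_(t in `]0, T[) (ut t x * psi t)).

(* A function with u, u_t in L^2(0,T;L^2(Omega)) is identified with its unique
   representative that is continuous from [0,T] to L^2(Omega); this gives a
   meaning to u(t) for each t, in particular to u(0). *)
Definition continuous_L2 u :=
  forall t : R, t \in `[0, T] ->
  L2 Omega (u t) /\
  L2dist_sq Omega (u s) (u t) @[s --> within `[0, T] (nbhs t)] --> 0%E.

(* A set E of times at which the problems below are required to hold. With
   E = ]0,T[ "for all t" is taken literally; with an arbitrary E of full
   measure it means "for almost every t". *)
Definition full_times E :=
  (E `<=` `]0, T[) /\ lebesgue_measure.-negligible (`]0, T[ `\` E).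

(* u is in L^2(0,T;H^1_0 /\ H^2), with gradient Du and Hessian D2u, and ut,
   its time derivative, is in L^2(0,T;L^2) *)
Record strong_evolution E u ut (Du : 'I_n -> R -> 'rV[R]_n -> R)
    (D2u : 'I_n -> 'I_n -> R -> 'rV[R]_n -> R) : Prop := {
  evol_L2 : time_L2 u ;
  evol_grad_L2 : forall i, time_L2 (Du i) ;
  evol_hess_L2 : forall i j, time_L2 (D2u i j) ;
  evol_dt_L2 : time_L2 ut ;
  evol_H10 : forall t, E t -> H10 Omega (u t) ;
  evol_H2 : forall t, E t ->
    H2_jet Omega (u t) (fun i => Du i t) (fun i j => D2u i j t) ;
  evol_dt_slice : forall t, E t -> L2 Omega (ut t) ;
  evol_dt : weak_time_derivative u ut ;
  evol_cont : continuous_L2 u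
}.

Definition heaviside (r : R) : R := if 0 < r then 1 else 0.

Variables f uc u0 : 'rV[R]_n -> R.

Definition degenerate_solution E u :=
  exists ut Du D2u,
    [/\ strong_evolution E u ut Du D2u,
        forall t, E t -> ae_in Omega (fun x =>
          ut t x - heaviside (u t x - uc x) *
            (laplacian (fun i j => D2u i j t) x + f x) = 0)
      & ae_in Omega (fun x => u 0 x = u0 x)].

Definition obstacle_solution E w :=
  exists wt Dw D2w,
    [/\ strong_evolution E w wt Dw D2w,
        forall t, E t -> obstacle_set Omega uc (w t),
        forall t phi, E t -> obstacle_set Omega uc phi ->
          0 <= \int[leb n]_(x in Omega)
            ((wt t x - laplacian (fun i j => D2w i j t) x - f x) *
             (phi x - w t x)),
        ae_in Omega (fun x => w 0 x = u0 x)
      & obstacle_set Omega uc u0].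

(* The boundary condition is part of [strong_evolution]. *)
Definition complementarity_solution E w :=
  exists wt Dw D2w,
    [/\ strong_evolution E w wt Dw D2w,
        forall t, E t -> ae_in Omega (fun x => uc x <= w t x),
        forall t, E t -> ae_in Omega (fun x =>
          laplacian (fun i j => D2w i j t) x + f x <= wt t x),
        forall t, E t -> ae_in Omega (fun x => (w t x - uc x) *
          (wt t x - laplacian (fun i j => D2w i j t) x - f x) = 0)
      & ae_in Omega (fun x => w 0 x = u0 x)].

End evolution.

(* Main.v *)
(* For almost every x the curve t |-> u(t,x) is a primitive of u_t(.,x), and
   u_t = 0 where u <= u^c; a primitive that is constant below a barrier and
   starts above it stays above it, so u >= u^c. Where u > u^c the
   equation gives u_t = Delta u + f; where u = u^c it gives u_t = 0, and there
   Delta u = Delta u^c a.e. because the weak derivatives of an H^2 function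
   vanish a.e. on its zero set (Stampacchia), so Delta u + f <= 0 = u_t. This is
   the complementarity system, which implies the variational inequality
   pointwise. Two solutions of the inequality, each tested with the other, have
   a difference z with int z_t z <= int (Delta z) z <= 0, and
   int z(t)^2 = 2 int_0^t int z_t z forces z = 0.

   Both uses of weak derivatives reduce to one dimension: testing against
   smooth bumps shows that on almost every line a weakly differentiable function
   is a primitive of its weak derivative (compare values at Lebesgue points). *)

Require Import Defs.
From mathcomp Require Import all_boot all_order all_algebra.
From mathcomp Require Import all_classical all_reals all_analysis.
From mathcomp Require Import measurable_realfun.
From mathcomp Require Import ring lra.

Set Implicit Arguments.
Unset Strict Implicit.
Unset Printing Implicit Defensive.

Import Order.TTheory GRing.Theory Num.Theory.
Import numFieldNormedType.Exports.

Local Open Scope classical_set_scope.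
Local Open Scope ring_scope.

(** * Smooth functions of one variable *)

Section smooth1.
Context {R : realType}.
Implicit Types f g : R -> R.

(** Most of the work consists in moving exceptional null sets. The weak time derivative gives an
    identity for almost every x once the test function is fixed, so only countably many tests can be
    used at once; plateaus with rational parameters suffice to identify a primitive at its Lebesgue
    points. The equation holds for almost every x once the time is fixed, whereas the barrier
    argument runs along t with x fixed; Tonelli exchanges the two, provided that the exceptional set
    is jointly measurable. A primitive known at almost every time says nothing about a prescribed
    time such as 0; there continuity into L^2 fixes the value.

    No calculus of Banach-valued functions is involved: the formula for int z(t)^2 comes from a
    scalar identity for each x, itself obtained by cutting a square along its diagonal. Two
    solutions may satisfy their problems on different sets E and F of times; the comparison uses the
    times common to both. *)

Fixpoint iter_derivable (k : nat) f : Prop :=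
  if k is k'.+1 then (forall t, derivable f t 1) /\ iter_derivable k' (derive1 f)
  else True.

Lemma iter_derivableW k f : iter_derivable k.+1 f -> iter_derivable k f.
Proof. by elim: k f => [|k IH] f //= [df /IH]. Qed.

(** The recursion of [iter_derivable] passes to the derivative, so that closure under sums, products
    and affine substitution follows by induction on the order, for all functions at once. *)
Definition smooth1 f := forall k, iter_derivable k f.

Lemma smooth1_derivable f t : smooth1 f -> derivable f t 1.
Proof. by move=> /(_ 1%N)/= []. Qed.

Lemma smooth1_derive1 f : smooth1 f -> smooth1 (derive1 f).
Proof. by move=> sf k; have [] := sf k.+1. Qed.

Lemma smooth1_continuous f : smooth1 f -> continuous f.
Proof.
move=> sf t; apply: differentiable_continuous; apply/derivable1_diffP.
exact: smooth1_derivable.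
Qed.

Lemma smooth1_derive1n f k : smooth1 f -> smooth1 (derive1n k f).
Proof. by move=> sf; elim: k => // k IH; exact: smooth1_derive1. Qed.

Lemma iter_derivableD k f g : iter_derivable k f -> iter_derivable k g ->
  iter_derivable k (f \+ g).
Proof.
elim: k f g => [//|k IH] f g [df f'] [dg g']; split=> [t|].
  exact: derivableD.
rewrite (_ : derive1 (f \+ g) = (derive1 f) \+ (derive1 g)); first exact: IH.
by apply/funext => t; rewrite /= !derive1E deriveD.
Qed.

Lemma iter_derivableM k f g : iter_derivable k f -> iter_derivable k g ->
  iter_derivable k (f \* g).
Proof.
elim: k f g => [//|k IH] f g [df f'] [dg g']; split=> [t|].
  exact: derivableM.
rewrite (_ : derive1 (f \* g) = (f \* (derive1 g)) \+ (g \* (derive1 f))).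
  (* Leibniz's rule pairs each undifferentiated factor with a derivative of order [k], so one order
     of the former is given up by [iter_derivableW]. *)
  by apply: iter_derivableD; apply: IH => //; apply: iter_derivableW; split.
by apply/funext => t; rewrite /= !derive1E deriveM.
Qed.

Lemma iter_derivable_cst k (c : R) : iter_derivable k (cst c).
Proof.
elim: k c => [//|k IH] c; split=> [t|]; first exact: derivable_cst.
rewrite (_ : derive1 _ = cst 0) //.
by apply/funext => t; rewrite derive1E derive_cst.
Qed.

Lemma iter_derivable_affine k f a b : iter_derivable k f ->
  iter_derivable k (fun t => f (a * t + b)).
Proof.
have dab (t : R) : is_derive t (1:R) (fun t => a * t + b) a.
  by apply: is_derive_eq; rewrite /GRing.scale /= mulr1 addr0 ?mulr0 ?addr0.
have dfab h (t : R) : derivable h (a * t + b) 1 ->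
    is_derive t (1:R) (fun t => h (a * t + b)) (a *  (derive1 h) (a * t + b)).
  move=> dh; have := @is_derive1_comp R h (fun t => a * t + b) t.
  move=> /(_ ((derive1 h) (a * t + b)) a) H; rewrite mulrC; apply: H.
  by split => //; rewrite derive1E.
elim: k f => [//|k IH] f [df f']; split=> [t|].
  by have /dfab[] := df (a * t + b).
rewrite (_ : derive1 _ = cst a \* (fun t => (derive1 f) (a * t + b))).
  by apply: iter_derivableM; [exact: iter_derivable_cst|exact: IH].
by apply/funext => t /=; rewrite derive1E; have /dfab[] := df (a * t + b).
Qed.

Lemma smooth1D f g : smooth1 f -> smooth1 g -> smooth1 (f \+ g).
Proof. by move=> sf sg k; exact: iter_derivableD. Qed.

Lemma smooth1M f g : smooth1 f -> smooth1 g -> smooth1 (f \* g).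
Proof. by move=> sf sg k; exact: iter_derivableM. Qed.

Lemma smooth1_cst (c : R) : smooth1 (cst c).
Proof. by move=> k; exact: iter_derivable_cst. Qed.

Lemma smooth1N f : smooth1 f -> smooth1 (\- f).
Proof.
move=> sf; rewrite (_ : \- f = cst (-1) \* f); last first.
  by apply/funext => t; rewrite /= mulN1r.
by apply: smooth1M => //; exact: smooth1_cst.
Qed.

Lemma smooth1B f g : smooth1 f -> smooth1 g -> smooth1 (f \- g).
Proof. by move=> sf sg; apply: smooth1D => //; exact: smooth1N. Qed.

Lemma smooth1_affine f a b : smooth1 f -> smooth1 (fun t => f (a * t + b)).
Proof. by move=> sf k; exact: iter_derivable_affine. Qed.

Lemma smooth1_of_derive f : (forall t, derivable f t 1) -> smooth1 (derive1 f) ->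
  smooth1 f.
Proof. by move=> df sf [|k] //; split. Qed.

(* [t^-m e^(-1/t)] on the positive reals; the derivative is
   [flat_exp m.+2 - m flat_exp m.+1], so these functions are all smooth. *)
Definition flat_exp (m : nat) (t : R) : R :=
  if 0 < t then t ^- m * expR (- t^-1) else 0.

Lemma flat_exp_ge0 m t : 0 <= flat_exp m t.
Proof.
rewrite /flat_exp; case: ifPn => // t0.
by rewrite mulr_ge0// ?expR_ge0// invr_ge0 exprn_ge0// ltW.
Qed.

Lemma flat_exp_gt0 m t : 0 < t -> 0 < flat_exp m t.
Proof.
move=> t0; rewrite /flat_exp t0 mulr_gt0 ?expR_gt0//.
by rewrite invr_gt0 exprn_gt0.
Qed.

Lemma flat_exp_le0 m t : t <= 0 -> flat_exp m t = 0.
Proof. by move=> t0; rewrite /flat_exp ltNge t0. Qed.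

(** With s = 1/t the claim reads s^m / m! <= e^s, a single term of the exponential series. *)
Lemma flat_exp_bound m t : flat_exp m t <= m`!%:R.
Proof.
rewrite /flat_exp; case: ifPn => // t0.
rewrite expRN ler_pdivrMr ?expR_gt0// -exprVn.
have: 0 <= t^-1 by rewrite invr_ge0 ltW.
move: (t^-1) => s s0.
case: m => [|m]; first by rewrite expr0 mul1r -expR0 ler_expR.
rewrite mulrC -ler_pdivrMr ?ltr0n ?fact_gt0//.
by apply: le_trans (expR_ge1Dxn m s0); rewrite lerDr.
Qed.

Lemma flat_exp_div m t : 0 < t -> flat_exp m t = flat_exp m.+1 t * t.
Proof.
move=> t0; rewrite /flat_exp t0 exprS invfM.
by rewrite mulrAC [t^-1 * _]mulrC -[X in _ = X * _]mulrA mulVf ?gt_eqF// mulr1.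
Qed.

Lemma is_derive_flat_exp m t :
  is_derive t (1:R) (flat_exp m) (flat_exp m.+2 t - m%:R * flat_exp m.+1 t).
Proof.
have [t0|t0|->] := ltgtP t 0.
- rewrite !flat_exp_le0 ?(ltW t0)// mulr0 subr0.
  apply: (@near_eq_is_derive _ _ _ (cst 0)).
  near=> s; rewrite /= flat_exp_le0// ltW//; near: s.
  exact: lt_nbhsl.
- have near_E : \forall s \near t, s ^- m * expR (- s^-1) = flat_exp m s.
    near=> s; rewrite /flat_exp ifT//; near: s.
    exact: lt_nbhsr.
  have t_neq0 : t != 0 by rewrite gt_eqF.
  have dV : is_derive t (1:R) (fun s : R => s^-1) (- t ^- 2).
    have := @is_deriveV R id t 1 1 t_neq0 (is_derive_id _ _).
    move=> H; apply: (is_derive_eq H).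
    by rewrite /GRing.scale/= mulr1.
  have dE : is_derive t (1:R) (fun s : R => expR (- s^-1))
      (t ^- 2 * expR (- t^-1)).
    have := @is_derive1_comp R expR (fun s => - s^-1) t (expR (- t^-1))
      (t ^- 2) (is_derive_expR _).
    rewrite mulrC; apply.
    by have := is_deriveN dV; rewrite opprK.
  have dX : is_derive t (1:R) (fun s : R => s ^- m) (- m%:R * t ^- m.+1).
    rewrite (_ : (fun s => _) = (fun s : R => s^-1) ^+ m); last first.
      by apply/funext => s; rewrite fctE exprVn.
    case: m {near_E} => [|m].
      rewrite oppr0 mul0r expr0; exact: (@is_derive_cst R R R (1:R) t 1).
    have H := is_deriveX m.+1 dV.
    apply: (is_derive_eq H).
    rewrite /GRing.scale/= exprVn !exprS expr0 mulr1 !invfM.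
    by ring.
  have H := near_eq_is_derive near_E (is_deriveM dX dE).
  apply: (is_derive_eq H).
  rewrite /flat_exp t0 /GRing.scale/=.
  rewrite !exprS expr0 mulr1 !invfM; ring.
- rewrite !flat_exp_le0// mulr0 subr0.
  have H : h^-1 *: ((flat_exp m \o shift 0) (h *: (1:R)) - flat_exp m 0)
      @[h --> (0:R)^'] --> (0:R).
    apply/cvgrPdist_le => /= e e0; near=> h.
    rewrite sub0r normrN /= addr0 (flat_exp_le0 _ (lexx 0)) subr0.
    rewrite /GRing.scale/= mulr1.
    have [h0|h0] := leP h 0; first by rewrite flat_exp_le0// mulr0 normr0 ltW.
    (* The difference quotient at 0 is [flat_exp m.+1 h], which is h times [flat_exp m.+2 h], hence
       at most (m+2)! h. *)
    rewrite flat_exp_div// mulrCA mulVf ?gt_eqF// mulr1.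
    rewrite flat_exp_div// normrM !ger0_norm ?flat_exp_ge0 ?(ltW h0)//.
    rewrite (le_trans (ler_wpM2r (ltW h0) (flat_exp_bound _ _)))//.
    rewrite mulrC -ler_pdivlMr ?ltr0n ?fact_gt0//.
    rewrite -(gtr0_norm h0); near: h; apply: dnbhs0_le.
    by rewrite divr_gt0 ?ltr0n ?fact_gt0.
  split; first by apply/cvg_ex; exists 0.
  exact/cvg_lim.
Unshelve. all: by end_near. Qed.

Lemma smooth1_flat_exp m : smooth1 (flat_exp m).
Proof.
move=> k; elim: k m => [//|k IH] m; split=> [t|].
  by have [] := is_derive_flat_exp m t.
rewrite (_ : derive1 _ = flat_exp m.+2 \+ (cst (- m%:R) \* flat_exp m.+1)).
  apply: iter_derivableD => //; apply: iter_derivableM => //.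
  exact: iter_derivable_cst.
apply/funext => t; rewrite derive1E.
by have [_ ->] := is_derive_flat_exp m t; rewrite /= mulNr.
Qed.

End smooth1.

(** * Integrals of real-valued functions *)

Section real_integrals.
Context d (T : measurableType d) {R : realType}.
Variable mu : {measure set T -> \bar R}.
Implicit Types (D : set T) (f g h : T -> R).

Lemma dominated_cvg_Rintegral D (f_ : nat -> T -> R) f g : measurable D ->
  (forall n, measurable_fun D (f_ n)) -> measurable_fun D f ->
  {ae mu, forall x, D x -> f_ n x @[n --> \oo] --> f x} ->
  mu.-integrable D (EFin \o g) ->
  (forall n x, D x -> `|f_ n x| <= g x) ->
  \int[mu]_(x in D) f_ n x @[n --> \oo] --> \int[mu]_(x in D) f x.
Proof.
move=> mD mf_ mf f_f ig fg.
have cE : {ae mu, forall x, D x ->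
    (f_ n x)%:E @[n --> \oo] --> (EFin \o f) x}.
  by apply: filterS f_f => x H /H Hx; apply: cvg_EFin => //; exact: nearW.
have bE : {ae mu, forall x n, D x -> (`|(f_ n x)%:E| <= (EFin \o g) x)%E}.
  by apply: aeW => x n Dx; rewrite lee_fin fg.
have [ifi _ H] := dominated_convergence mD
  (fun n => (measurable_EFinP _ _).2 (mf_ n)) ((measurable_EFinP _ _).2 mf)
  cE ig bE.
apply: fine_cvg; rewrite /Rintegral fineK; first exact: H.
exact: integrable_fin_num.
Qed.

Lemma integrable_bounded_mulr D f h (M : R) : measurable D ->
  mu.-integrable D (EFin \o f) -> measurable_fun D h ->
  (forall x, D x -> `|h x| <= M) ->
  mu.-integrable D (EFin \o (fun x => f x * h x)).
Proof.
move=> mD If mh hM; have mf : measurable_fun D f.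
  exact/measurable_EFinP/(measurable_int _ If).
apply: (le_integrable mD (g := fun x => (M%:E * (EFin \o f) x)%E)).
- exact/measurable_EFinP/measurable_funM.
- move=> x Dx; rewrite /= lee_fin !normrM mulrC ler_wpM2r//.
  by rewrite (le_trans (hM x Dx))// ler_norm.
- exact: integrableZl.
Qed.

Lemma ae_imply (P Q : T -> Prop) : (forall x, P x -> Q x) ->
  {ae mu, forall x, P x} -> {ae mu, forall x, Q x}.
Proof. by move=> PQ; apply: filterS. Qed.

Lemma ae_imply2 (P Q S : T -> Prop) : (forall x, P x -> Q x -> S x) ->
  {ae mu, forall x, P x} -> {ae mu, forall x, Q x} -> {ae mu, forall x, S x}.
Proof. by move=> PQS; apply: filterS2. Qed.

Lemma integrable_cst D (c : R) : measurable D -> (mu D < +oo)%E ->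
  mu.-integrable D (EFin \o cst c).
Proof.
move=> mD Doo; apply/integrableP; split.
  by apply/measurable_EFinP; exact: measurable_cst.
by rewrite /= integral_cst// lte_mul_pinfty.
Qed.

Lemma RintegralN D f : measurable D -> mu.-integrable D (EFin \o f) ->
  \int[mu]_(x in D) (- f x) = - \int[mu]_(x in D) f x.
Proof.
move=> mD If; rewrite -[RHS]mulN1r -RintegralZl//.
by apply: eq_Rintegral => x _; rewrite mulN1r.
Qed.

Lemma ae_eq_Rintegral D f g : measurable D ->
  measurable_fun D f -> measurable_fun D g ->
  {ae mu, forall x, D x -> f x = g x} ->
  \int[mu]_(x in D) f x = \int[mu]_(x in D) g x.
Proof.
move=> mD mf mg fg; rewrite /Rintegral.
rewrite (ae_eq_integral (fun x => (g x)%:E))//.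
- exact/measurable_EFinP.
- exact/measurable_EFinP.
- by apply: filterS fg => x H /H ->.
Qed.

End real_integrals.

(** * A smooth bump, its primitive, and plateaus *)

Section sbump.
Context {R : realType}.
Local Notation mu := (@lebesgue_measure R).

(** The classical bump exp(-1/t - 1/(1-t)), supported in [0, 1]. *)
Definition sbump (t : R) : R := flat_exp 0 t * flat_exp 0 (1 - t).

Lemma smooth1_sbump : smooth1 sbump.
Proof.
rewrite (_ : sbump = flat_exp 0 \* (fun t => flat_exp 0 (-1 * t + 1))).
  apply: smooth1M; first exact: smooth1_flat_exp.
  exact/smooth1_affine/smooth1_flat_exp.
by apply/funext => t; rewrite /sbump /= mulN1r addrC.
Qed.

Lemma sbump_ge0 t : 0 <= sbump t.
Proof. by rewrite mulr_ge0// flat_exp_ge0. Qed.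

Lemma sbump_le1 t : sbump t <= 1.
Proof.
by rewrite -[1]mulr1 ler_pM ?flat_exp_ge0//; exact: (flat_exp_bound 0).
Qed.

Lemma sbump_gt0 t : 0 < t < 1 -> 0 < sbump t.
Proof. by case/andP => t0 t1; rewrite mulr_gt0// flat_exp_gt0// subr_gt0. Qed.

Lemma sbump_le0 t : t <= 0 -> sbump t = 0.
Proof. by move=> t0; rewrite /sbump flat_exp_le0// mul0r. Qed.

Lemma sbump_ge1 t : 1 <= t -> sbump t = 0.
Proof. by move=> t1; rewrite /sbump [X in _ * X]flat_exp_le0 ?mulr0// subr_le0. Qed.

Lemma measurable_smooth1 f (D : set R) : smooth1 f ->
  measurable_fun D (f : measurableTypeR R -> measurableTypeR R).
Proof.
move=> sf; apply: measurable_funTS; apply: continuous_measurable_fun.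
exact: smooth1_continuous.
Qed.

Lemma measurable_sbump (D : set R) :
  measurable_fun D (sbump : measurableTypeR R -> measurableTypeR R).
Proof. by apply: measurable_smooth1; exact: smooth1_sbump. Qed.

Lemma integrable_sbump (A : set R) : measurable A ->
  mu.-integrable A (EFin \o sbump).
Proof.
move=> mA; suff : mu.-integrable [set: R] (EFin \o sbump).
  exact: integrableS.
apply: (@le_integrable _ _ _ mu setT measurableT _
  (EFin \o (\1_(`[0%R, 1%R]%classic : set R) : R -> R))) => //.
- by apply/measurable_EFinP; exact: measurable_sbump.
- move=> t _ /=; rewrite lee_fin ger0_norm ?sbump_ge0// indicE.
  have [t01|] := boolP (t \in `[0, 1]).
    by rewrite mem_set// normr1 sbump_le1.
  rewrite in_itv/= => /nandP[]; rewrite -ltNge => /ltW t01.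
    by rewrite sbump_le0.
  by rewrite sbump_ge1.
- by apply: integrable_indic_itv.
Qed.

(** A smoothed Heaviside step. Its height [sbump_int 1] is not normalised to 1; its positivity
    allows it to be cancelled at the end. *)
Definition sbump_int (t : R) : R := \int[mu]_(s in `]-oo, t]) sbump s.

Lemma is_derive_sbump_int (t : R) : is_derive t (1:R) sbump_int (sbump t).
Proof.
have [] := @continuous_FTC1 R sbump -oo%O t (t + 1).
- by rewrite ltrDl.
- exact: integrable_sbump.
- by rewrite ltNyr.
- exact/smooth1_continuous/smooth1_sbump.
by move=> dH H; split; [exact: dH|rewrite -derive1E; exact: H].
Qed.

Lemma derive1_sbump_int : derive1 sbump_int = sbump.
Proof.
by apply/funext => t; rewrite derive1E; have [_ ->] := is_derive_sbump_int t.
Qed.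

Lemma smooth1_sbump_int : smooth1 sbump_int.
Proof.
apply: smooth1_of_derive => [t|]; first by have [] := is_derive_sbump_int t.
by rewrite derive1_sbump_int; exact: smooth1_sbump.
Qed.

Lemma sbump_int_ge0 t : 0 <= sbump_int t.
Proof. by apply: Rintegral_ge0 => s _; exact: sbump_ge0. Qed.

Lemma sbump_int_le0 t : t <= 0 -> sbump_int t = 0.
Proof.
move=> t0; rewrite /sbump_int; under eq_Rintegral.
  move=> s; rewrite inE/= in_itv/= => st.
  rewrite sbump_le0; last exact: le_trans st t0.
  over.
by rewrite Rintegral_cst// mul0r.
Qed.

Lemma sbump_int_nd s t : s <= t -> sbump_int s <= sbump_int t.
Proof.
move=> st; rewrite /sbump_int fine_le//.
- by apply: integrable_fin_num => //; exact: integrable_sbump.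
- by apply: integrable_fin_num => //; exact: integrable_sbump.
apply: ge0_subset_integral => //=.
- apply/measurable_EFinP; exact: measurable_sbump.
- by move=> x _; rewrite lee_fin sbump_ge0.
- by apply: subset_itvl; rewrite bnd_simp.
Qed.

Lemma sbump_int_ge1 t : 1 <= t -> sbump_int t = sbump_int 1.
Proof.
rewrite le_eqVlt => /predU1P[<-//|t1].
rewrite /sbump_int.
rewrite (@itv_bndbnd_setU _ _ _ (BRight 1)) ?bnd_simp ?(ltW t1)//.
rewrite Rintegral_setU//.
- under [X in _ + X = _]eq_Rintegral.
    move=> s; rewrite inE/= in_itv/= => /andP[st _].
    rewrite sbump_ge1; last exact: ltW.
    over.
  by rewrite Rintegral_cst// mul0r addr0.
- exact: integrable_sbump (measurableU _ _ _ _).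
- apply/disj_setPS => s [/=]; rewrite !in_itv/= => s1 /andP[].
  by rewrite ltNge s1.
Qed.

Lemma sbump_int_le t : sbump_int t <= sbump_int 1.
Proof.
have [t1|/ltW t1] := leP t 1; first exact: sbump_int_nd.
by rewrite sbump_int_ge1.
Qed.

(** If the largest value of the step were 0, the step would vanish identically, and so would its
    derivative [sbump] at 1/2. *)
Lemma sbump_int1_gt0 : 0 < sbump_int 1.
Proof.
rewrite lt_neqAle sbump_int_ge0 andbT eq_sym; apply/eqP => H1.
have H t : sbump_int t = 0.
  by apply/eqP; rewrite eq_le sbump_int_ge0 -H1 sbump_int_le.
have := is_derive_sbump_int (2^-1).
rewrite (_ : sbump_int = cst 0); last by apply/funext => t; rewrite H.
case=> _; rewrite derive_cst => /esym/eqP; rewrite gt_eqF// sbump_gt0//.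
by rewrite invr_gt0 ltr0n/= invf_lt1 ?ltr1n.
Qed.

(* A smooth approximation of the indicator of [p, q], up to the factor
   [sbump_int 1]; its derivative is a difference of two concentrated bumps. *)
Definition plateau (p q e t : R) : R :=
  sbump_int ((t - p) / e) - sbump_int ((t - q) / e).

Lemma smooth1_sbump_int_scaled p e : smooth1 (fun t => sbump_int ((t - p) / e)).
Proof.
rewrite (_ : (fun _ => _) = (fun t => sbump_int (e^-1 * t + (- p / e)))).
  exact/smooth1_affine/smooth1_sbump_int.
by apply/funext => t; rewrite mulrBl mulrC mulNr.
Qed.

Lemma smooth1_plateau p q e : smooth1 (plateau p q e).
Proof. by apply: smooth1B; exact: smooth1_sbump_int_scaled. Qed.

Lemma is_derive_sbump_int_scaled (p e t : R) :
  is_derive t (1:R) (fun s : R => sbump_int ((s - p) / e))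
    (sbump ((t - p) / e) / e).
Proof.
have dl : is_derive t (1:R) (fun s : R => (s - p) / e) e^-1.
  by apply: is_derive_eq; rewrite /GRing.scale/= mulr0 add0r subr0 mulr1.
by have := @is_derive1_comp R sbump_int _ t _ _ (is_derive_sbump_int _) dl.
Qed.

Lemma derive1_plateau p q e t :
  derive1 (plateau p q e) t = (sbump ((t - p) / e) - sbump ((t - q) / e)) / e.
Proof.
rewrite derive1E mulrBl.
have [_ H] := is_deriveB (is_derive_sbump_int_scaled p e t)
  (is_derive_sbump_int_scaled q e t).
exact: H.
Qed.

(** The points [p] and [q] come in either order, the plateau being negative when q < p; hence the
    minimum and the maximum. *)
Lemma plateau_support p q e t : 0 < e ->
  ~ (Num.min p q <= t <= Num.max p q + e) -> plateau p q e t = 0.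
Proof.
move=> e0 /negP/nandP[]; rewrite -ltNge.
  rewrite lt_min => /andP[tp tq]; rewrite /plateau !sbump_int_le0 ?subrr//.
    by rewrite pmulr_lle0 ?invr_gt0// subr_le0 ltW.
  by rewrite pmulr_lle0 ?invr_gt0// subr_le0 ltW.
rewrite -ltrBrDr gt_max => /andP[pt qt].
rewrite /plateau !(@sbump_int_ge1 (_ / e)) ?subrr//.
  by rewrite ler_pdivlMr// mul1r; lra.
by rewrite ler_pdivlMr// mul1r; lra.
Qed.

End sbump.

(** * Weak derivatives on an interval *)

Section weak_derivative1.
Context {R : realType}.
Local Notation mu := (@lebesgue_measure R).

Lemma Rintegral_support d (T : measurableType d)
    (nu : {measure set T -> \bar R}) (B D : set T) (f : T -> R) :
  B `<=` D -> (forall x, D x -> ~ B x -> f x = 0) ->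
  \int[nu]_(x in D) f x = \int[nu]_(x in B) f x.
Proof.
move=> BD f0; rewrite Rintegral_mkcond [RHS]Rintegral_mkcond.
congr Rintegral; apply/funext => x; rewrite !patchE.
have [Bx|Bx] := pselect (B x); first by rewrite !mem_set//; exact: BD.
rewrite (memNset Bx); case: ifPn => // /set_mem Dx; exact: f0.
Qed.

(** The derivative of the step [sbump_int ((t - p) / e)]: a one-sided mollifier whose mass does not
    depend on [e]. *)
Definition scaled_bump (p e t : R) : R := sbump ((t - p) / e) / e.

Lemma scaled_bump_support p e t : 0 < e -> ~ (p < t < p + e) ->
  scaled_bump p e t = 0.
Proof.
move=> e0 /negP/nandP[]; rewrite -leNgt /scaled_bump => tp.
  by rewrite sbump_le0 ?mul0r// pmulr_lle0 ?invr_gt0// subr_le0.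
by rewrite sbump_ge1 ?mul0r// ler_pdivlMr// mul1r; lra.
Qed.

Lemma scaled_bump_ge0 p e t : 0 < e -> 0 <= scaled_bump p e t.
Proof. by move=> e0; rewrite divr_ge0 ?sbump_ge0// ltW. Qed.

Lemma scaled_bump_le p e t : 0 < e -> scaled_bump p e t <= e^-1.
Proof. by move=> e0; rewrite ler_pdivrMr// mulVf ?gt_eqF// sbump_le1. Qed.

Lemma smooth1_scaled_bump p e : smooth1 (scaled_bump p e).
Proof.
rewrite (_ : scaled_bump p e =
    cst e^-1 \* (fun t => sbump (e^-1 * t + (- p / e)))).
  apply: smooth1M; first exact: smooth1_cst.
  exact/smooth1_affine/smooth1_sbump.
by apply/funext => t; rewrite /scaled_bump /= mulrC mulrBl mulNr [t / e]mulrC.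
Qed.

Lemma measurable_scaled_bump p e (D : set (measurableTypeR R)) :
  measurable_fun D (scaled_bump p e).
Proof. by apply: measurable_smooth1; exact: smooth1_scaled_bump. Qed.

Lemma integral_scaled_bump p e : 0 < e ->
  \int[mu]_(t in `[p, p + e]) scaled_bump p e t = sbump_int 1.
Proof.
move=> e0; have pe : p < p + e by rewrite ltrDl.
rewrite /Rintegral (@continuous_FTC2 _ _ (fun t => sbump_int ((t - p) / e)))//=.
- have -> : (p + e - p) / e = 1 by rewrite addrAC subrr add0r divff ?gt_eqF.
  by rewrite subrr mul0r (sbump_int_le0 (lexx 0)) subr0.
- apply: continuous_subspaceT; exact/smooth1_continuous/smooth1_scaled_bump.
- have H := smooth1_sbump_int_scaled p e; split.
  + by move=> t _; exact: smooth1_derivable.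
  + by apply: cvg_at_right_filter; exact: smooth1_continuous H p.
  + by apply: cvg_at_left_filter; exact: smooth1_continuous H (p + e).
- move=> t _; rewrite derive1E; have [_ E] := is_derive_sbump_int_scaled p e t.
  exact: E.
Qed.

(** Mollification converges at a Lebesgue point even when the mollifier is off centre by a distance
    comparable to its width. This freedom lets the centres [p_ k] be rational while [p] is
    arbitrary. *)
Lemma scaled_bump_lebesgue_pt (V : R -> R) (p : R) (p_ e_ : nat -> R) :
  mu.-integrable setT (EFin \o V) -> lebesgue_pt V p ->
  (forall k, 0 < e_ k) -> e_ k @[k --> \oo] --> 0 ->
  (forall k, p <= p_ k <= p + e_ k) ->
  \int[mu]_t (V t * scaled_bump (p_ k) (e_ k) t) @[k --> \oo] -->
  V p * sbump_int 1.
Proof.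
move=> iV Lp e0 ecvg pp.
(* The bump lives in [p, p + 2e], which lies inside the open ball of radius 3e. It is at most 1/e
   and the ball has measure 6e, so the error is at most 6 times the mean of |V - V p| over the
   ball. *)
pose B k := ball p (3 * e_ k).
have e20 k : 0 < 3 * e_ k by rewrite mulr_gt0.
have mB k : measurable (B k : set (measurableTypeR R)) by exact: measurable_ball.
have muB k : mu (B k) = (6 * e_ k)%:E.
  rewrite lebesgue_measure_ball; last exact: ltW.
  by congr EFin; rewrite -mulr_natr; ring.
have sub k : `[p_ k, p_ k + e_ k]%classic `<=` B k.
  move=> t; rewrite /= in_itv/= /B /ball/= => /andP[t1 t2].
  have /andP[p1 p2] := pp k; have ek := e0 k.
  by rewrite ltr_norml; apply/andP; split; lra.
have supp k t : ~ B k t -> scaled_bump (p_ k) (e_ k) t = 0.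
  move=> Bt; apply: scaled_bump_support => // /andP[t1 t2]; apply: Bt.
  by apply: sub; rewrite /= in_itv/= !ltW.
have iB k : mu.-integrable (B k) (EFin \o V).
  by apply: integrableS iV.
have iBc k (c : R) : mu.-integrable (B k) (EFin \o cst c).
  by apply: integrable_cst => //=; rewrite muB ltry.
have iBVc k : mu.-integrable (B k) (EFin \o (fun t => V t - V p)).
  by have := integrableB (mB k) (iB k) (iBc k (V p)).
have bnd k t : `|scaled_bump (p_ k) (e_ k) t| <= (e_ k)^-1.
  by rewrite ger0_norm ?scaled_bump_ge0// scaled_bump_le.
have key k : `|\int[mu]_t (V t * scaled_bump (p_ k) (e_ k) t)
    - V p * sbump_int 1| <= 6 * fine (davg V p (3 * e_ k)).
  rewrite -(integral_scaled_bump (p_ k) (e0 k)).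
  rewrite (@Rintegral_support _ _ mu (B k) setT)//; last first.
    by move=> t _ /supp ->; rewrite mulr0.
  rewrite -(@Rintegral_support _ _ mu `[p_ k, p_ k + e_ k]%classic (B k))//;
    last first.
    move=> t _; rewrite /= in_itv/= => H; apply: scaled_bump_support => //.
    by case/andP => t1 t2; apply: H; rewrite !ltW.
  rewrite -RintegralZl//; last first.
    have := @integrable_bounded_mulr _ _ _ mu (B k) (cst 1)
      (scaled_bump (p_ k) (e_ k)) (e_ k)^-1 (mB k) (iBc _ _)
      (@measurable_scaled_bump (p_ k) (e_ k) (B k)) (fun t _ => bnd k t).
    by under eq_fun do rewrite mul1r.
  rewrite -RintegralB//; last 2 first.
    exact: integrable_bounded_mulr (iB k) (@measurable_scaled_bump (p_ k) (e_ k) (B k))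
      (fun t _ => bnd k t).
    exact: integrable_bounded_mulr (iBc k (V p)) (@measurable_scaled_bump (p_ k) (e_ k) (B k))
      (fun t _ => bnd k t).
  under eq_Rintegral do rewrite -mulrBl.
  have iBm := integrable_bounded_mulr (mB k) (iBVc k)
    (@measurable_scaled_bump (p_ k) (e_ k) (B k)) (fun t _ => bnd k t).
  apply: le_trans (le_normr_Rintegral (mB k) iBm) _.
  have iBa : mu.-integrable (B k) (EFin \o (fun t => `|V t - V p|)).
    exact: (integrable_abse (iBVc k)).
  apply: (@le_trans _ _ (\int[mu]_(t in B k) (`|V t - V p| * (e_ k)^-1))).
    apply: le_Rintegral => //.
    - exact: (integrable_abse iBm).
    - by have := integrableZr (mB k) (e_ k)^-1 iBa.
    - by move=> t Bt; rewrite normrM ler_wpM2l.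
  rewrite RintegralZr//.
  have -> : davg V p (3 * e_ k) =
      (((6 * e_ k)^-1)%:E * (\int[mu]_(t in B k) `|V t - V p|)%:E)%E.
    rewrite /davg /iavg muB inver gt_eqF ?mulr_gt0//; congr (_ * _)%E.
    by rewrite /Rintegral fineK//; exact: integrable_fin_num iBa.
  rewrite /= invfM mulrA mulrA mulfV ?mul1r// mulrC lexx //.
have e2cvg : 3 * e_ k @[k --> \oo] --> (0:R)^'+.
  move=> A [r /= r0 rA].
  move/cvgrPdist_lt : ecvg => /(_ (r / 3)); rewrite divr_gt0// => /(_ isT) H.
  suff : \forall k \near \oo, A (3 * e_ k) by [].
  near=> k; apply: rA => //=; rewrite sub0r normrN gtr0_norm//.
  rewrite mulrC -ltr_pdivlMr//; have : `|0 - e_ k| < r / 3 by near: k.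
  by rewrite sub0r normrN gtr0_norm.
have d0 : fine (davg V p (3 * e_ k)) @[k --> \oo] --> (0:R).
  by apply: fine_cvg; exact: (cvg_comp _ _ e2cvg Lp).
apply/cvgrPdist_le => /= e e_gt0.
move/cvgrPdist_le : d0 => /(_ (e / 6)); rewrite divr_gt0// => /(_ isT) H.
near=> k; rewrite distrC; apply: le_trans (key k) _.
rewrite mulrC -ler_pdivlMr//; apply: le_trans (ler_norm _) _.
rewrite -normrN -sub0r; near: k; exact: H.
Unshelve. all: by end_near. Qed.

End weak_derivative1.

Section weak_derivative1_ae.
Context {R : realType}.
Local Notation mu := (@lebesgue_measure R).

(** The steps tend to the step at [p] everywhere except at [p] itself and stay below [sbump_int 1],
    so dominated convergence applies. *)
Lemma sbump_int_tail_cvg (G : R -> R) (p : R) (p_ e_ : nat -> R) :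
  mu.-integrable setT (EFin \o G) ->
  (forall k, 0 < e_ k) -> e_ k @[k --> \oo] --> 0 ->
  (forall k, p <= p_ k <= p + e_ k) ->
  \int[mu]_t (G t * sbump_int ((t - p_ k) / e_ k)) @[k --> \oo] -->
  sbump_int 1 * \int[mu]_(t in `]p, +oo[) G t.
Proof.
move=> iG e0 ecvg pp.
have mG : measurable_fun setT (G : measurableTypeR R -> measurableTypeR R).
  by apply/measurable_EFinP; exact: (measurable_int mu iG).
have msb k : measurable_fun setT
    ((fun t => sbump_int ((t - p_ k) / e_ k)) :
      measurableTypeR R -> measurableTypeR R).
  by apply: measurable_smooth1; exact: smooth1_sbump_int_scaled.
have iGp : mu.-integrable setT (EFin \o (G \_ `]p, +oo[)).
  rewrite -restrict_EFin; apply: (integrable_mkcond _ _).1 => //.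
  exact: integrableS iG.
have mGp : measurable_fun setT
    ((G \_ `]p, +oo[) : measurableTypeR R -> measurableTypeR R).
  by apply/measurable_EFinP; exact: (measurable_int mu iGp).
rewrite mulrC Rintegral_mkcond -RintegralZr//.
apply: (@dominated_cvg_Rintegral _ _ _ mu setT _ _
  (fun t => `|G t| * sbump_int 1)) => //.
- by move=> k; apply: measurable_funM; [exact: mG|exact: msb].
- apply: measurable_funM; [exact: mGp|exact: measurable_cst].
- exists [set p]; split => //; first exact: lebesgue_measure_set1.
  apply: subsetCl => t /= tp _; rewrite patchE.
  have [tp'|pt|//] := ltgtP t p.
    rewrite memNset/=; last by rewrite in_itv/= andbT => /(lt_trans tp'); rewrite ltxx.
    rewrite mul0r (_ : (fun k => _) = cst 0); first exact: cvg_cst.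
    apply/funext => k; rewrite sbump_int_le0 ?mulr0//.
    rewrite pmulr_lle0 ?invr_gt0// subr_le0 (le_trans (ltW tp'))//.
    by have /andP[] := pp k.
  rewrite mem_set/=; last by rewrite in_itv/= pt.
  apply: cvg_near_cst.
  move/cvgrPdist_lt : ecvg => /(_ ((t - p) / 2)).
  rewrite divr_gt0 ?subr_gt0// => /(_ isT); apply: filterS => k.
  rewrite sub0r normrN gtr0_norm// => ek; rewrite sbump_int_ge1//.
  have /andP[_ pk] := pp k.
  by rewrite ler_pdivlMr// mul1r; lra.
- have := integrableZr measurableT (sbump_int 1) (integrable_abse iG).
  by [].
- move=> k t _; rewrite normrM ler_wpM2l// ger0_norm ?sbump_int_ge0//.
  exact: sbump_int_le.
Qed.

(** The tests form a countable family because, in both applications, each test brings its own null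
    set of lines or of points x. As the plateau sharpens, its derivative isolates v p - v q at
    Lebesgue points, while the plateau itself tends to the signed indicator of the interval between
    p and q. *)
Lemma weak_derivative_ae (a b : R) (v g : R -> R) :
  mu.-integrable `]a, b[ (EFin \o v) -> mu.-integrable `]a, b[ (EFin \o g) ->
  (forall (p q : rat) (k : nat),
    a < ratr p -> ratr p + k.+1%:R^-1 < b ->
    a < ratr q -> ratr q + k.+1%:R^-1 < b ->
    let psi := plateau (ratr p) (ratr q) k.+1%:R^-1 in
    \int[mu]_(t in `]a, b[) (v t * derive1 psi t) =
    - \int[mu]_(t in `]a, b[) (g t * psi t)) ->
  exists c, {ae mu, forall t, a < t < b ->
    v t = c + \int[mu]_(s in `]a, t]) g s}.
Proof.
move=> iv ig H.
pose V := v \_ `]a, b[; pose G := g \_ `]a, b[.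
have iV : mu.-integrable setT (EFin \o V).
  by rewrite -restrict_EFin; apply: (integrable_mkcond _ _).1.
have iG : mu.-integrable setT (EFin \o G).
  by rewrite -restrict_EFin; apply: (integrable_mkcond _ _).1.
have /lebesgue_differentiation Leb : locally_integrable setT V.
  by apply: open_integrable_locally iV; exact: openT.
pose I p := \int[mu]_(t in `]p, +oo[) G t.
pose M := @sbump_int R 1.
have M0 : 0 < M := sbump_int1_gt0.
pose e_ k : R := k.+1%:R^-1.
have e0 k : 0 < e_ k by rewrite invr_gt0.
have ecvg : e_ k @[k --> \oo] --> 0 := cvg_harmonic.
have ratseq p : exists p_ : nat -> rat,
    forall k, p < ratr (p_ k) < p + e_ k.
  have h k : exists q : rat, p < ratr q < p + e_ k.
    have /rat_in_itvoo[q] : p < p + e_ k by rewrite ltrDl.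
    by rewrite in_itv/=; exists q.
  by exists (fun k => sval (cid (h k))) => k; exact: (svalP (cid (h k))).
have key p q : a < p < b -> a < q < b -> lebesgue_pt V p -> lebesgue_pt V q ->
    v p - v q = I q - I p.
  move=> pab qab Lp Lq.
  have [p_ hp] := ratseq p; have [q_ hq] := ratseq q.
  have hp' k : p <= ratr (p_ k) <= p + e_ k by have /andP[? ?] := hp k; rewrite !ltW.
  have hq' k : q <= ratr (q_ k) <= q + e_ k by have /andP[? ?] := hq k; rewrite !ltW.
  have Ap := scaled_bump_lebesgue_pt iV Lp e0 ecvg hp'.
  have Aq := scaled_bump_lebesgue_pt iV Lq e0 ecvg hq'.
  have Bp := sbump_int_tail_cvg iG e0 ecvg hp'.
  have Bq := sbump_int_tail_cvg iG e0 ecvg hq'.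
  have AB := cvgB Ap Aq; have {}AB := AB eventually_filter.
  have BB := cvgB Bq Bp; have {}BB := BB eventually_filter.
  have iVb k x : mu.-integrable setT
      (EFin \o (fun t => V t * scaled_bump x (e_ k) t)).
    apply: (@integrable_bounded_mulr _ _ _ mu _ _ _ (e_ k)^-1) => //.
      exact: measurable_scaled_bump.
    by move=> t _; rewrite ger0_norm ?scaled_bump_ge0// scaled_bump_le.
  have iGb k x : mu.-integrable setT
      (EFin \o (fun t => G t * sbump_int ((t - x) / e_ k))).
    apply: (@integrable_bounded_mulr _ _ _ mu _ _ _ M) => //.
      by apply: measurable_smooth1; exact: smooth1_sbump_int_scaled.
    by move=> t _; rewrite ger0_norm ?sbump_int_ge0// sbump_int_le.
  have E : V p * M - V q * M = M * I q - M * I p.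
    apply: (cvg_unique (@Rhausdorff R) AB).
    apply: cvg_trans BB; apply: near_eq_cvg.
    (* The supports reach up to p + 2e and q + 2e at most, since the rational points exceed p and q
       by less than e. Halving the distances to [b] keeps these plateaus admissible. *)
    move/cvgrPdist_lt : (ecvg) => /(_ (Num.min ((b - p) / 2) ((b - q) / 2))).
    rewrite lt_min !divr_gt0 ?subr_gt0; [|by case/andP: qab|by [] |
      by case/andP: pab|by []] => /(_ isT); apply: filterS => k.
    rewrite sub0r normrN gtr0_norm// lt_min => /andP[ekp ekq] /=.
    have /andP[p1 p2] := hp k; have /andP[q1 q2] := hq k.
    have /andP[ap pb] := pab; have /andP[aq qb] := qab.
    have := H (p_ k) (q_ k) k (lt_trans ap p1) _ (lt_trans aq q1) _.
    rewrite -/(e_ k); move=> /(_ ltac:(lra) ltac:(lra)) /=.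
    set psi := plateau _ _ _ => Hk.
    have L1 : \int[mu]_t (V t * scaled_bump (ratr (p_ k)) (e_ k) t) -
        \int[mu]_t (V t * scaled_bump (ratr (q_ k)) (e_ k) t) =
        \int[mu]_(t in `]a, b[) (v t * derive1 psi t).
      rewrite -RintegralB//.
      rewrite [RHS]Rintegral_mkcond; apply: eq_Rintegral => t _.
      rewrite /V !patchE; case: ifPn => _; last by rewrite !mul0r subrr.
      by rewrite /psi derive1_plateau mulrBl mulrBr.
    have L2 : \int[mu]_t (G t * sbump_int ((t - ratr (p_ k)) / e_ k)) -
        \int[mu]_t (G t * sbump_int ((t - ratr (q_ k)) / e_ k)) =
        \int[mu]_(t in `]a, b[) (g t * psi t).
      rewrite -RintegralB//.
      rewrite [RHS]Rintegral_mkcond; apply: eq_Rintegral => t _.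
      rewrite /G !patchE; case: ifPn => _; last by rewrite !mul0r subrr.
      by rewrite /psi /plateau mulrBr.
    rewrite !fctE -opprB L2 -Hk -L1 //.
  apply: (mulfI (lt0r_neq0 M0)); rewrite mulrBr [RHS]mulrBr -E.
  rewrite /V !patchE !mem_set/= ?in_itv//=.
  by rewrite ![_ * M]mulrC.
pose J := \int[mu]_t G t.
have split_I p : I p = J - \int[mu]_(s in `]-oo, p]) G s.
  rewrite /I /J -(@Rintegral_itvB _ _ -oo%O +oo%O p)//=; first by rewrite set_itvNyy.
  by rewrite set_itvNyy.
(* One Lebesgue point [q] serves as base point for all the others. If there is none, almost no point
   lies in the interval and any constant will do. *)
have [[q [qab Lq]]|noq] := pselect (exists q, a < q < b /\ lebesgue_pt V q).
  exists (v q + I q - J).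
  apply: ae_imply Leb => p Lp pab.
  have := key p q pab qab Lp Lq; rewrite (split_I p) => /eqP.
  rewrite subr_eq => /eqP ->.
  rewrite (_ : \int[mu]_(s in `]a, p]) g s = \int[mu]_(s in `]-oo, p]) G s).
    move: (\int[mu]_(s in `]-oo, p]) G s) => X; ring.
  rewrite /G -Rintegral_mkcondr; congr Rintegral; apply/seteqP; split=> s /=.
    rewrite !in_itv/= => /andP[as_ sp]; split => //; rewrite as_ /=.
    by apply: le_lt_trans sp _; case/andP: pab.
  by rewrite !in_itv/= => -[-> /andP[-> _]].
exists 0; apply: ae_imply Leb => p Lp pab; exfalso; apply: noq.
by exists p.
Qed.

End weak_derivative1_ae.

(** * Boxes and Lebesgue measure on R^n *)

Section countable_ae.
Context d (T : measurableType d) {R : realType}.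
Variable mu : {measure set T -> \bar R}.

Lemma ae_forall_countable (I : countType) (P : I -> T -> Prop) :
  (forall i, {ae mu, forall x, P i x}) -> {ae mu, forall x i, P i x}.
Proof.
move=> aeP.
have : {ae mu, forall x (n : nat), if unpickle n is Some i then P i x else True}.
  apply: ae_foralln => n; case: unpickle => [i|]; first exact: aeP.
  exact: aeW.
by apply: ae_imply => x H i; have := H (pickle i); rewrite pickleK.
Qed.

End countable_ae.

Section boxes.
Context {R : realType} {n : nat}.
Implicit Types c d : 'I_n -> R.

Definition obox c d : set 'rV[R]_n := [set x | forall j, c j < x 0 j < d j].
Definition cbox c d : set 'rV[R]_n := [set x | forall j, c j <= x 0 j <= d j].

Lemma sub_obox_cbox c d : obox c d `<=` cbox c d.
Proof. by move=> x cxd j; have /andP[? ?] := cxd j; rewrite !ltW. Qed.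

Lemma coord_preimage_measurable (j : 'I_n) (Y : set (measurableTypeR R)) :
  measurable Y -> measurable ((fun x : 'rV[R]_n => x 0 j) @^-1` Y).
Proof.
move=> mY; rewrite -[X in measurable X]setTI.
exact: (measurable_coord j measurableT).
Qed.

Lemma measurable_obox c d : measurable (obox c d).
Proof.
rewrite (_ : obox c d = \bigcap_(j in [set: 'I_n])
  ((fun x : 'rV[R]_n => x 0 j) @^-1` `]c j, d j[%classic)).
  apply: fin_bigcap_measurable => // j _; apply: coord_preimage_measurable.
  exact: measurable_itv.
apply/seteqP; split=> [x xcd j _|x xcd j]; first by rewrite /= in_itv/= xcd.
by have := xcd j I; rewrite /= in_itv.
Qed.

Lemma compact_cbox c d : compact (cbox c d).
Proof.
rewrite (_ : cbox c d = [set v | forall j, `[c j, d j]%classic (v ord0 j)]).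
  exact: (@rV_compact R n (fun j => `[c j, d j]%classic)
    (fun j => @segment_compact R _ _)).
by apply/seteqP; split=> x xcd j; have := xcd j; rewrite /= in_itv.
Qed.

(** Rational corners make the boxes countable in number; having the closed box inside [O] makes
    products supported in it admissible test functions. *)
Lemma open_has_box (O : set 'rV[R]_n) (x : 'rV[R]_n) : open O -> O x ->
  exists (c d : {ffun 'I_n -> rat}),
    obox (ratr \o c) (ratr \o d) x /\ cbox (ratr \o c) (ratr \o d) `<=` O.
Proof.
move=> oO Ox; have /nbhs_ballP[e /= e0 xO] : nbhs x O by exact: open_nbhs_nbhs.
have h j : exists cd : rat * rat,
    x 0 j - e < ratr cd.1 < x 0 j /\ x 0 j < ratr cd.2 < x 0 j + e.
  have /rat_in_itvoo[q1] : x 0 j - e < x 0 j by rewrite ltrBlDr ltrDl.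
  rewrite in_itv/= => h1.
  have /rat_in_itvoo[q2] : x 0 j < x 0 j + e by rewrite ltrDl.
  by rewrite in_itv/= => h2; exists (q1, q2).
exists [ffun j => (sval (cid (h j))).1], [ffun j => (sval (cid (h j))).2].
split=> [j|y ycd]; rewrite /= ?ffunE.
  by have [/andP[_ ->] /andP[-> _]] := svalP (cid (h j)).
apply: xO; split => // i j; rewrite ord1.
have := ycd j; rewrite /= !ffunE => /andP[y1 y2].
have [/andP[c1 c2] /andP[d1 d2]] := svalP (cid (h j)).
by rewrite /ball/= ltr_norml; apply/andP; split; lra.
Qed.

Lemma open_bigcup_box (O : set 'rV[R]_n) : open O ->
  O = \bigcup_(cd in [set cd : {ffun 'I_n -> rat} * {ffun 'I_n -> rat} |
    cbox (ratr \o cd.1) (ratr \o cd.2) `<=` O])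
    obox (ratr \o cd.1) (ratr \o cd.2).
Proof.
move=> oO; apply/seteqP; split=> [x Ox|x [cd cdO]].
  have [c [d [xcd cdO]]] := open_has_box oO Ox.
  by exists (c, d).
by move/sub_obox_cbox/cdO.
Qed.

Lemma open_measurable_rV (O : set 'rV[R]_n) : open O -> measurable O.
Proof.
move=> oO; rewrite (open_bigcup_box oO) bigcup_mkcond.
apply: countable_bigcupT_measurable => [|cd]; first exact: countableP.
by case: ifPn => // _; exact: measurable_obox.
Qed.

(** The sigma-algebra is generated by coordinates, not by open sets; the link is that an open set is
    a countable union of rational boxes. *)
Lemma continuous_measurable_rV (f : 'rV[R]_n -> R) (D : set 'rV[R]_n) :
  continuous f -> measurable_fun D (f : _ -> measurableTypeR R).
Proof.
move=> cf; apply: measurable_funTS => _ Y mY; rewrite setTI.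
have H : (@ocitv R).-sigma.-measurable Y by [].
move: H; rewrite RGenOpens.measurableE => H.
have : measurable (f @^-1` Y); last by [].
move: Y H {mY}; apply: smallest_sub.
  split => [|A mA|F mF]; rewrite /=.
  - by rewrite preimage_set0.
  - rewrite setTD preimage_setC; exact: measurableC.
  - by rewrite preimage_bigcup; exact: bigcupT_measurable.
move=> _ [x [y ->]]; apply: open_measurable_rV.
by apply: open_comp => // z _; exact: cf.
Qed.

(** A generating family stable under intersection: the input of both the uniqueness theorem for
    measures and Dynkin's induction. *)
Definition oboxes : set (set 'rV[R]_n) :=
  [set B | exists c d, B = obox c d].

Lemma obox_setI c d c' d' : obox c d `&` obox c' d' =
  obox (fun j => Num.max (c j) (c' j)) (fun j => Num.min (d j) (d' j)).
Proof.
apply/seteqP; split=> x /=.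
  by move=> [h h'] j; rewrite gt_max lt_min; have /andP[-> ->] := h j; exact: h' j.
move=> h; split=> j; have := h j; rewrite gt_max lt_min;
  by move=> /andP[/andP[? ?] /andP[? ?]]; apply/andP.
Qed.

Lemma oboxes_setI : setI_closed oboxes.
Proof.
by move=> _ _ [c [d ->]] [c' [d' ->]]; rewrite obox_setI; eexists; eexists.
Qed.

Lemma bigcup_obox : \bigcup_(k : nat)
  obox (fun=> - k%:R) (fun=> k%:R) = [set: 'rV[R]_n].
Proof.
apply/seteqP; split=> // x _.
pose M j := (Num.truncn `|x 0 j|).+1.
exists (\max_(j < n) M j)%N => // j /=; rewrite -ltr_norml.
apply: lt_le_trans (truncnS_gt _) _; rewrite ler_nat.
exact: (leq_bigmax j).
Qed.

Lemma measurable_rV_oboxes :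
  @measurable _ 'rV[R]_n = <<s oboxes >>.
Proof.
apply/seteqP; split; last first.
  apply: smallest_sub; first exact: sigma_algebra_measurable.
  by move=> _ [c [d ->]]; exact: measurable_obox.
apply: smallest_sub; first exact: smallest_sigma_algebra.
move=> A; rewrite -bigcup_seq/= => -[j _ [Y mY <-]]; rewrite setTI.
have : (@ocitv R).-sigma.-measurable Y by [].
rewrite RGenOpens.measurableE; move: Y {mY}; apply: smallest_sub.
  have := smallest_sigma_algebra [set: 'rV[R]_n] oboxes.
  move=> [s0 sC sU]; split=> [|B mB|F mF] /=.
  - by rewrite preimage_set0.
  - by rewrite setTD preimage_setC -setTD; exact: sC.
  - by rewrite preimage_bigcup; exact: sU.
move=> _ [x [y ->]] /=.
rewrite (_ : _ @^-1` _ = \bigcup_(k : nat)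
  obox (fun i => if i == j then x else - k%:R)
       (fun i => if i == j then y else k%:R)).
  have [_ _ sU] := smallest_sigma_algebra [set: 'rV[R]_n] oboxes.
  apply: sU => k; apply: sub_sigma_algebra.
  by eexists; eexists; reflexivity.
apply/seteqP; split=> z /=; last first.
  by move=> [k _ /(_ j)]; rewrite eqxx in_itv.
rewrite in_itv/= => zxy.
have : [set: 'rV[R]_n] z by []; rewrite -bigcup_obox => -[k _ zk].
by exists k => // i; case: eqP => [->|_].
Qed.

End boxes.

Section leb_obox.
Context {R : realType}.
Local Notation mu := (@lebesgue_measure R).
Local Open Scope ereal_scope.

Lemma leb_obox m (c d : 'I_m -> R) : leb m (obox c d) =
  \prod_(j < m) mu `]c j, d j[%classic.
Proof.
rewrite (_ : obox c d = [set x | forall j, `]c j, d j[%classic (x ord0 j)]).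
  apply: (@leb_box R m (fun j => `]c j, d j[%classic)) => j.
  exact: measurable_itv.
by apply/seteqP; split=> x h j; have := h j; rewrite /= in_itv.
Qed.

Lemma leb_obox_lty m (c d : 'I_m -> R) : leb m (obox c d) < +oo.
Proof.
rewrite leb_obox.
have : \prod_(j < m) mu `]c j, d j[%classic \is a fin_num.
  elim/big_ind : _ => // [x y xf yf|j _]; first exact: fin_numM.
  by rewrite /= lebesgue_measure_itv/=; case: ifPn.
by rewrite fin_numE => /andP[_]; rewrite ltey.
Qed.

Lemma leb_bounded_lty m (A : set 'rV[R]_m) : measurable A -> bounded_set A ->
  leb m A < +oo.
Proof.
move=> mA [M [Mreal bA]].
(* [bounded_set] bounds the norm only by numbers strictly above [M], hence the first 1. The box is
   open, hence one more below. *)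
pose M' := (`|M| + 1)%R.
have AM x : A x -> (`|x| <= M')%R.
  by apply: bA; rewrite /M' (le_lt_trans (ler_norm M))// ltrDl.
apply: le_lt_trans (leb_obox_lty (fun j : 'I_m => - (M' + 1))%R (fun=> M' + 1)%R).
apply: le_measure; rewrite ?inE//; first exact: measurable_obox.
move=> x Ax j; rewrite -ltr_norml (@le_lt_trans _ _ M')// ?ltrDl//.
apply: le_trans (AM x Ax).
rewrite [leRHS]mx_normrE.
exact: (le_bigmax _ (fun ij => `|x ij.1 ij.2|%R) (ord0, j)).
Qed.

End leb_obox.

(** * Splitting off an arbitrary coordinate *)

Section insert_coordinate.
Context {R : realType} {n : nat}.
Implicit Types i : 'I_n.+1.
Local Notation mu := (@lebesgue_measure R).

(** [leb] is built by splitting off coordinate 0, whereas a partial derivative in direction [i]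
    calls for lines in that direction: [vins i (t, y)] runs along such a line as [t] varies. *)
Definition vins i (p : R * 'rV[R]_n) : 'rV[R]_n.+1 :=
  \row_j (if unlift i j is Some k then p.2 0 k else p.1).

Definition vdel i (x : 'rV[R]_n.+1) : R * 'rV[R]_n :=
  (x 0 i, \row_j x 0 (lift i j)).

Lemma vinsE i p : vins i p 0 i = p.1.
Proof. by rewrite mxE unlift_none. Qed.

Lemma vins_lift i p j : vins i p 0 (lift i j) = p.2 0 j.
Proof. by rewrite mxE liftK. Qed.

Lemma vdelK i : cancel (vdel i) (vins i).
Proof.
move=> x; apply/rowP => j; rewrite mxE.
by case: unliftP => [k ->|->] //=; rewrite mxE.
Qed.

Lemma measurable_vins i :
  measurable_fun setT (vins i : measurableTypeR R * 'rV[R]_n -> 'rV[R]_n.+1).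
Proof.
apply: measurable_fun_rV => k; case: (unliftP i k) => [j|] ->.
  rewrite (_ : (fun t => _) = (fun x : 'rV[R]_n => x 0 j : measurableTypeR R) \o
     @snd (measurableTypeR R) 'rV[R]_n).
    by apply: measurableT_comp => //; exact: measurable_coord.
  by apply/funext => t /=; rewrite vins_lift.
rewrite (_ : (fun t => _) = @fst (measurableTypeR R) 'rV[R]_n) //.
by apply/funext => t /=; rewrite vinsE.
Qed.

Lemma vins_obox i c d :
  vins i @^-1` obox c d =
  `]c i, d i[%classic `*` obox (c \o lift i) (d \o lift i).
Proof.
apply/seteqP; split=> -[t y] /=.
  move=> h; split; first by have := h i; rewrite vinsE /= in_itv.
  by move=> j /=; have := h (lift i j); rewrite vins_lift.
move=> [+ h] j; rewrite /= in_itv/= => tcd.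
by case: (unliftP i j) => [k|] ->; rewrite ?vins_lift ?vinsE//; exact: h.
Qed.

(** Both sides are measures in [A] that give a box the product of its side lengths, in whatever
    order; boxes of finite measure exhaust the space. *)
Lemma leb_vins i (A : set 'rV[R]_n.+1) : measurable A ->
  leb n.+1 A = (mu \x leb n)%E (vins i @^-1` A).
Proof.
move=> mA.
pose g (k : nat) : set 'rV[R]_n.+1 := obox (fun=> - k%:R) (fun=> k%:R).
pose m2 := measure_function_pushforward__canonical__measure_function_Measure
    (mu \x leb n)%E (measurable_vins i).
apply: (@measure_unique _ R _ (@oboxes R n.+1) g measurable_rV_oboxes
  (@oboxes_setI R n.+1) _ (@bigcup_obox R n.+1) (leb n.+1) m2) => //.
- by move=> k; exists (fun=> - k%:R), (fun=> k%:R).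
- move=> _ [c [d ->]]; rewrite /= /pushforward.
  transitivity ((mu \x leb n)%E (`]c i, d i[%classic `*`
      obox (c \o lift i) (d \o lift i))); last by rewrite -vins_obox.
  rewrite product_measure1E//; last exact: measurable_obox.
  rewrite !leb_obox (bigD1_ord i)//=.
- by move=> k; exact: leb_obox_lty.
Qed.

End insert_coordinate.

(** * Null sets of a product measure *)

Section product_null.
Context d1 d2 (T1 : measurableType d1) (T2 : measurableType d2) (R : realType).
Variable m1 : {sigma_finite_measure set T1 -> \bar R}.
Variable m2 : {sigma_finite_measure set T2 -> \bar R}.
Local Open Scope ereal_scope.

Lemma integral_eq0_ae d (T : measurableType d) (m : {measure set T -> \bar R})
    (F : T -> \bar R) : measurable_fun setT F -> (forall x, 0 <= F x) ->
  \int[m]_x F x = 0 <-> {ae m, forall x, F x = 0}.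
Proof.
move=> mF F0; have := ae_eq_integral_abs m measurableT mF.
under eq_integral do rewrite gee0_abs//.
move=> ->; split; first by apply: ae_imply => x; apply.
by apply: ae_imply => x H _.
Qed.

Lemma product_null1 (A : set (T1 * T2)) : measurable A ->
  (m1 \x m2) A = 0 <-> {ae m1, forall x, m2 (xsection A x) = 0}.
Proof.
move=> mA; rewrite /product_measure1; apply: integral_eq0_ae => //.
exact: measurable_fun_xsection.
Qed.

Lemma product_null2 (A : set (T1 * T2)) : measurable A ->
  (m1 \x m2) A = 0 <-> {ae m2, forall y, m1 (ysection A y) = 0}.
Proof.
move=> mA.
rewrite (@product_measure_unique _ _ _ _ _ m1 m2 (m1 \x^ m2))//; last first.
  by move=> A1 A2 mA1 mA2; exact: product_measure2E.
rewrite /product_measure2; apply: integral_eq0_ae => //.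
exact: measurable_fun_ysection.
Qed.

(** Each iterated statement says that the exceptional set is null for the product measure, which can
    be computed by sections in either direction. *)
Lemma ae_product_swap (P : T1 -> T2 -> Prop) :
  measurable [set z : T1 * T2 | ~ P z.1 z.2] ->
  {ae m1, forall x, {ae m2, forall y, P x y}} <->
  {ae m2, forall y, {ae m1, forall x, P x y}}.
Proof.
move=> mP.
have H1 x : {ae m2, forall y, P x y} <->
    m2 (xsection [set z : T1 * T2 | ~ P z.1 z.2] x) = 0.
  rewrite -negligibleP; last exact: measurable_xsection.
  rewrite xsectionE; exact: iff_refl.
have H2 y : {ae m1, forall x, P x y} <->
    m1 (ysection [set z : T1 * T2 | ~ P z.1 z.2] y) = 0.
  rewrite -negligibleP; last exact: measurable_ysection.
  rewrite ysectionE; exact: iff_refl.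
split=> H.
  have : (m1 \x m2) [set z : T1 * T2 | ~ P z.1 z.2] = 0.
    by apply/product_null1 => //; apply: ae_imply H => x /H1.
  by move=> /(product_null2 mP).1; apply: ae_imply => y /H2.
have : (m1 \x m2) [set z : T1 * T2 | ~ P z.1 z.2] = 0.
  by apply/product_null2 => //; apply: ae_imply H => x /H2.
by move=> /(product_null1 mP).1; apply: ae_imply => y /H1.
Qed.

End product_null.

(** * Fubini for real-valued integrals on rectangles *)

Section Rintegral_Fubini.
Context d1 d2 (T1 : measurableType d1) (T2 : measurableType d2) (R : realType).
Variable m1 : {sigma_finite_measure set T1 -> \bar R}.
Variable m2 : {sigma_finite_measure set T2 -> \bar R}.

Let m12 : {measure set (T1 * T2) -> \bar R} := (m1 \x m2)%E.

Lemma integrable_fine d (T : measurableType d) (m : {measure set T -> \bar R})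
  (D : set T) (F : T -> \bar R) : measurable D -> m.-integrable D F ->
  m.-integrable D (EFin \o (fun x => fine (F x))).
Proof.
move=> mD iF; have mF := measurable_int _ iF.
apply: (le_integrable mD _ _ iF).
  by apply/measurable_EFinP; apply: measurableT_comp.
by move=> x _ /=; case: (F x) => [r| |]//=; rewrite normr0 leey.
Qed.

(** An integrable function is finite almost everywhere, so applying [fine] to the inner integral of
    an iterated one changes it only on a null set. *)
Lemma Rintegral_fine d (T : measurableType d) (m : {measure set T -> \bar R})
  (D : set T) (F : T -> \bar R) : measurable D -> m.-integrable D F ->
  \int[m]_(x in D) fine (F x) = fine (\int[m]_(x in D) F x)%E.
Proof.
move=> mD iF; rewrite /Rintegral; congr fine; apply: ae_eq_integral => //.
- have := integrable_fine mD iF; exact: measurable_int.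
- exact: measurable_int iF.
- by apply: ae_imply (integrable_ae mD iF) => x H /H; exact: fineK.
Qed.

Section setT.
Variable H : T1 * T2 -> R.
Hypothesis iH : m12.-integrable setT (EFin \o H).

Let mH : measurable_fun setT (EFin \o H). Proof. exact: measurable_int iH. Qed.

Let iG : m2.-integrable setT (fubini_G m1 (EFin \o H)).
Proof.
apply/integrableP; split; first exact: (measurable_fubini_G iH).
apply: le_lt_trans ((integrable21ltyP m1 m2 mH).1 iH).
apply: ge0_le_integral => //.
- by apply: measurableT_comp => //; exact: (measurable_fubini_G iH).
- apply: (@measurable_fun_fubini_tonelli_G _ _ _ _ _ m1
    (abse \o (EFin \o H))).
    exact: measurableT_comp.
  by move=> z; exact: abse_ge0.
- move=> y _; apply: le_abse_integral => //.
  exact: (measurableT_comp mH (pair2_measurable y)).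
Qed.

Lemma integrable_Rintegral_F :
  m1.-integrable setT (EFin \o (fun x => \int[m2]_y H (x, y))).
Proof. exact: integrable_fine (integrable_fubini_F iH). Qed.

Lemma integrable_Rintegral_G :
  m2.-integrable setT (EFin \o (fun y => \int[m1]_x H (x, y))).
Proof. exact: integrable_fine iG. Qed.

Lemma Rintegral12 : \int[m1]_x \int[m2]_y H (x, y) = \int[m12]_z H z.
Proof.
rewrite (Rintegral_fine measurableT (integrable_fubini_F iH)).
by rewrite (integral12_prod_meas1 iH).
Qed.

Lemma Rintegral21 : \int[m2]_y \int[m1]_x H (x, y) = \int[m12]_z H z.
Proof.
rewrite (Rintegral_fine measurableT iG).
by rewrite (integral21_prod_meas1 iH).
Qed.

End setT.

Variables (D1 : set T1) (D2 : set T2) (H : T1 * T2 -> R).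
Hypotheses (mD1 : measurable D1) (mD2 : measurable D2).
Hypothesis iH : m12.-integrable (D1 `*` D2) (EFin \o H).

Let iH' : m12.-integrable setT (EFin \o (H \_ (D1 `*` D2))).
Proof.
rewrite -restrict_EFin; apply: (integrable_mkcond _ _).1 => //.
exact: measurableX.
Qed.

Let restrE (x : T1) (y : T2) : (H \_ (D1 `*` D2)) (x, y) =
  ((fun x => ((fun y => H (x, y)) \_ D2) y) \_ D1) x.
Proof.
rewrite !patchE; case: ifPn => [/set_mem [/= xD yD]|].
  by rewrite !mem_set.
move=> /negP HD; case: ifPn => // /set_mem xD; case: ifPn => // /set_mem yD.
by exfalso; apply: HD; rewrite inE.
Qed.

Lemma restr_Rintegral_F x : ((fun x => \int[m2]_(y in D2) H (x, y)) \_ D1) x =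
  \int[m2]_y (H \_ (D1 `*` D2)) (x, y).
Proof.
under [RHS]eq_Rintegral do rewrite restrE.
rewrite patchE; case: ifPn => [/set_mem xD|xD].
  rewrite Rintegral_mkcond; apply: eq_Rintegral => y _.
  by rewrite [RHS]patchE mem_set.
rewrite (_ : (fun _ => _) = cst 0) ?Rintegral_cst// ?mul0r//.
by apply/funext => y; rewrite patchE (negbTE xD).
Qed.

Lemma restr_Rintegral_G y : ((fun y => \int[m1]_(x in D1) H (x, y)) \_ D2) y =
  \int[m1]_x (H \_ (D1 `*` D2)) (x, y).
Proof.
under [RHS]eq_Rintegral do rewrite restrE.
rewrite patchE; case: ifPn => [/set_mem yD|yD].
  rewrite Rintegral_mkcond; apply: eq_Rintegral => x _.
  by rewrite !patchE (mem_set yD).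
rewrite (_ : (fun _ => _) = cst 0) ?Rintegral_cst// ?mul0r//.
by apply/funext => x; rewrite !patchE (negbTE yD) if_same.
Qed.

Lemma integrable_Fubini_F :
  m1.-integrable D1 (EFin \o (fun x => \int[m2]_(y in D2) H (x, y))).
Proof.
apply: (integrable_mkcond _ _).2 => //; rewrite restrict_EFin.
have := integrable_Rintegral_F iH'.
by congr (_.-integrable _ _); apply/funext => x; rewrite /= restr_Rintegral_F.
Qed.

Lemma integrable_Fubini_G :
  m2.-integrable D2 (EFin \o (fun y => \int[m1]_(x in D1) H (x, y))).
Proof.
apply: (integrable_mkcond _ _).2 => //; rewrite restrict_EFin.
have := integrable_Rintegral_G iH'.
by congr (_.-integrable _ _); apply/funext => x; rewrite /= restr_Rintegral_G.
Qed.

Lemma Rintegral_Fubini12 :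
  \int[m1]_(x in D1) \int[m2]_(y in D2) H (x, y) =
  \int[m12]_(z in D1 `*` D2) H z.
Proof.
rewrite [RHS]Rintegral_mkcond -(Rintegral12 iH') Rintegral_mkcond.
by apply: eq_Rintegral => x _; rewrite restr_Rintegral_F.
Qed.

Lemma Rintegral_Fubini21 :
  \int[m2]_(y in D2) \int[m1]_(x in D1) H (x, y) =
  \int[m12]_(z in D1 `*` D2) H z.
Proof.
rewrite [RHS]Rintegral_mkcond -(Rintegral21 iH') Rintegral_mkcond.
by apply: eq_Rintegral => x _; rewrite restr_Rintegral_G.
Qed.

Lemma ae_integrable_slice2 :
  {ae m2, forall y, D2 y -> m1.-integrable D1 (EFin \o (fun x => H (x, y)))}.
Proof.
apply: ae_imply (ae_integrable2 iH') => y + yD2.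
move=> iHy; apply: (integrable_mkcond _ _).2 => //; rewrite restrict_EFin.
move: iHy; congr (_.-integrable _ _); apply/funext => x /=.
by rewrite restrE !patchE (mem_set yD2).
Qed.

End Rintegral_Fubini.

(** * Weak partial derivatives on lines *)

Section product_functions.
Context {R : realType} {n : nat}.
Implicit Types F : 'I_n -> R -> R.

(** Tensor products: a partial derivative of one is another one, so smoothness on R^n reduces to
    smoothness of the factors. *)
Definition prodfun F (x : 'rV[R]_n) : R := \prod_(j < n) F j (x 0 j).

Lemma differentiable_smooth1_coord f (j : 'I_n) (x : 'rV[R]_n) : smooth1 f ->
  differentiable (fun y : 'rV[R]_n => f (y 0 j)) x.
Proof.
move=> sf; apply: (@differentiable_comp _ _ _ _ (fun y : 'rV[R]_n => y 0 j) f).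
  exact: differentiable_coord.
by apply/derivable1_diffP; exact: smooth1_derivable.
Qed.

Lemma differentiable_prodfun F (x : 'rV[R]_n) : (forall j, smooth1 (F j)) ->
  differentiable (prodfun F) x.
Proof.
move=> sF; rewrite /prodfun.
elim: (index_enum 'I_n) => [|j s IH].
  under eq_fun do rewrite big_nil; exact: differentiable_cst.
under eq_fun do rewrite big_cons.
by apply: differentiableM => //; exact: differentiable_smooth1_coord.
Qed.

Definition derive_coord i F : 'I_n -> R -> R :=
  fun j => if j == i then derive1 (F i) else F j.

Lemma partial_prodfun i F : (forall j, smooth1 (F j)) ->
  partial i (prodfun F) = prodfun (derive_coord i F).
Proof.
move=> sF; apply/funext => x; rewrite /partial.
(* Along the line through [x] in direction [i] only the factor [F i] varies; the rest is this
   constant. *)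
pose C := \prod_(j < n | j != i) F j (x 0 j).
have E h : prodfun F (h *: delta_mx 0 i + x) = C * F i (h + x 0 i).
  rewrite /prodfun (bigD1 i)//= mulrC !mxE !eqxx mulr1; congr (_ * _).
  by apply: eq_bigr => j /negbTE ji; rewrite !mxE eqxx ji mulr0 add0r.
transitivity ('D_1 (fun t => C * F i t) (x 0 i)).
  rewrite /derive; set f1 := (fun _ : R => _); set f2 := (fun _ : R => _).
  suff -> : f1 = f2 by [].
  apply/funext => h; rewrite /f1 /f2 /=; congr (_ *: _).
  have -> : prodfun F x = C * F i (x 0 i).
    by have := E 0; rewrite scale0r !add0r.
  by rewrite E /GRing.scale/= mulr1.
rewrite deriveMl ?derive1E; last exact: smooth1_derivable.
rewrite /prodfun [RHS](bigD1 i)//= /derive_coord eqxx derive1E mulrC.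
congr (_ * _); apply: eq_bigr => j /negbTE ji.
by rewrite ji.
Qed.

Lemma smooth1_derive_coord i F : (forall j, smooth1 (F j)) ->
  forall j, smooth1 (derive_coord i F j).
Proof.
move=> sF j; rewrite /derive_coord; case: ifPn => // _.
exact: smooth1_derive1.
Qed.

Lemma smooth_prodfun F : (forall j, smooth1 (F j)) -> smooth (prodfun F).
Proof.
move=> sF s x.
have [F' sF' ->] : exists2 F', (forall j, smooth1 (F' j)) &
    foldr partial (prodfun F) s = prodfun F'.
  elim: s => [|i s [F' sF' E]]; first by exists F.
  exists (derive_coord i F'); first exact: smooth1_derive_coord.
  by rewrite /= E partial_prodfun.
exact: differentiable_prodfun.
Qed.

Lemma test_function_prodfun (O : set 'rV[R]_n) F (c d : 'I_n -> R) :
  (forall j, smooth1 (F j)) -> cbox c d `<=` O ->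
  (forall j t, ~ (c j <= t <= d j) -> F j t = 0) ->
  test_function O (prodfun F).
Proof.
move=> sF cdO F0; split; first exact: smooth_prodfun.
exists (cbox c d); split => //; first exact: compact_cbox.
move=> x /existsNP[j] /F0 Fj; rewrite /prodfun (bigD1 j)//= Fj.
by rewrite mul0r.
Qed.

End product_functions.

Section box_bump.
Context {R : realType}.

(* A smooth function that tends to the indicator of ]c, d[ as k grows. *)
Definition itv_bump (c d : R) (k : nat) (t : R) : R :=
  flat_exp 0 (k%:R * (t - c)) * flat_exp 0 (k%:R * (d - t)).

Lemma smooth1_itv_bump c d k : smooth1 (itv_bump c d k).
Proof.
rewrite (_ : itv_bump c d k = (fun t => flat_exp 0 (k%:R * t + - (k%:R * c))) \*
  (fun t => flat_exp 0 (- k%:R * t + k%:R * d))).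
  by apply: smooth1M; exact/smooth1_affine/smooth1_flat_exp.
apply/funext => t; rewrite /itv_bump /= mulrBr; congr (_ * flat_exp _ _).
by rewrite mulrBr addrC mulNr.
Qed.

Lemma itv_bump_ge0 c d k t : 0 <= itv_bump c d k t.
Proof. by rewrite mulr_ge0// flat_exp_ge0. Qed.

Lemma itv_bump_le1 c d k t : itv_bump c d k t <= 1.
Proof.
by rewrite -[1]mulr1 ler_pM ?flat_exp_ge0//; exact: (flat_exp_bound 0).
Qed.

Lemma itv_bump_out c d k t : ~ (c < t < d) -> itv_bump c d k t = 0.
Proof.
move=> /negP/nandP[]; rewrite -leNgt => tcd; rewrite /itv_bump.
  by rewrite flat_exp_le0 ?mul0r// mulr_ge0_le0 ?ler0n// subr_le0.
by rewrite [X in _ * X]flat_exp_le0 ?mulr0// mulr_ge0_le0 ?ler0n// subr_le0.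
Qed.

Lemma flat_exp0_scaled_cvg (a : R) : 0 < a ->
  flat_exp 0 (k%:R * a) @[k --> \oo] --> (1 : R).
Proof.
move=> a0.
apply/cvgrPdist_le => /= e e0; near=> k.
have k0 : 0 < k%:R * a.
  by rewrite mulr_gt0// ltr0n; near: k; exact: nbhs_infty_gt.
rewrite /flat_exp k0 expr0 invr1 mul1r ger0_norm; last first.
  by rewrite subr_ge0 -[leRHS]expR0 ler_expR oppr_le0 invr_ge0 ltW.
(* By e^(-s) >= 1 - s with s = 1/(ka), the distance to 1 is at most 1/(ka). *)
rewrite lerBlDr; apply: (le_trans _ (lerD (lexx e) (expR_ge1Dx _))).
rewrite addrCA lerDl subr_ge0 -lef_pV2 ?posrE ?invr_gt0// invrK.
rewrite -ler_pdivrMr//; near: k; exact: nbhs_infty_ger.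
Unshelve. all: by end_near. Qed.

Lemma itv_bump_cvg c d t : c < t < d ->
  itv_bump c d k t @[k --> \oo] --> (1 : R).
Proof.
move=> /andP[ct td]; rewrite -[X in _ --> X]mulr1.
by apply: cvgM; apply: flat_exp0_scaled_cvg; rewrite subr_gt0.
Qed.

End box_bump.

(** * The zero set of a primitive *)

Section primitive_zero_set.
Context {R : realType}.
Local Notation mu := (@lebesgue_measure R).

(** A zero with nonzero derivative is isolated, hence the only zero in some interval with rational
    ends. Each such interval, encoded by [N], accounts for at most one point, so these zeros are
    covered by countably many null sets. *)
Lemma ae_not_isolated_zero (V : R -> R) :
  {ae mu, forall t, V t = 0 -> derivable V t 1 -> derive1 V t = 0}.
Proof.
pose N (r : rat * rat) t := [/\ ratr r.1 < t < ratr r.2, V t = 0 &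
  forall s, ratr r.1 < s < ratr r.2 -> V s = 0 -> s = t].
have aeN r : {ae mu, forall t, ~ N r t}.
  have [[t0 Nt0]|noN] := pselect (exists t0, N r t0).
    exists [set t0]; split => //; first exact: lebesgue_measure_set1.
    move=> t /= /contrapT [rt Vt _]; have [_ _] := Nt0; exact.
  by apply: aeW => t Nt; apply: noN; exists t.
apply: ae_imply (ae_forall_countable aeN) => t noN Vt dV.
apply/eqP; apply: contrapT => /negP dVt.
have [e /= e0 He] : \forall h \near 0^', V (h + t) <> 0.
  have : h^-1 *: ((V \o shift t) (h *: (1:R)) - V t) @[h --> 0^'] --> derive1 V t.
    by rewrite derive1E.
  move=> /cvgr_neq0 /(_ dVt); apply: filterS => h.
  rewrite /= Vt subr0 [h *: _]mulr1 => + H.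
  by rewrite H scaler0 eqxx.
have /rat_in_itvoo[r1] : t - e < t by rewrite ltrBlDr ltrDl.
rewrite in_itv/= => /andP[h1 h2].
have /rat_in_itvoo[r2] : t < t + e by rewrite ltrDl.
rewrite in_itv/= => /andP[h3 h4].
apply: (noN (r1, r2)); split => //=; first by rewrite h2 h3.
move=> s /andP[s1 s2] Vs; apply/eqP; apply: contrapT => /negP st.
apply: (He (s - t)); rewrite ?subrK//=.
  by rewrite sub0r normrN ltr_norml; apply/andP; split; lra.
by rewrite subr_eq0.
Qed.

(** Almost everywhere the primitive is differentiable with derivative [g], so the previous lemma
    applies to the primitive; only then is the primitive replaced by [v], which need not be
    differentiable anywhere. *)
Lemma primitive_zero_ae (a b C : R) (v g : R -> R) :
  mu.-integrable `]a, b[ (EFin \o g) ->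
  {ae mu, forall t, a < t < b -> v t = C + \int[mu]_(s in `]a, t]) g s} ->
  {ae mu, forall t, a < t < b -> v t = 0 -> g t = 0}.
Proof.
move=> ig aev.
pose G := g \_ `]a, b[.
have iG : mu.-integrable setT (EFin \o G).
  by rewrite -restrict_EFin; apply: (integrable_mkcond _ _).1.
have locG : locally_integrable setT G.
  by apply: open_integrable_locally iG; exact: openT.
have iG' y : mu.-integrable [set` Interval (BRight a) (BRight y)] (EFin \o G).
  exact: integrableS iG.
pose F x := \int[mu]_(t in `]a, x]) G t.
have := ae_imply2 _ (FTC1 iG' locG) (ae_not_isolated_zero (cst C \+ F)).
pose S t := a < t < b -> C + F t = 0 -> g t = 0.
move=> /(_ S) aeS.
have {}aeS : {ae mu, forall t, S t}.
  apply: aeS => t + + tab CF.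
  case/andP: (tab) => ta tb.
  rewrite lte_fin => /(_ ta) [dF F't].
  have dcst : derivable (cst C : R -> R) t 1 by exact: derivable_cst.
  have dC : derivable (cst C \+ F) t 1 := derivableD dcst dF.
  move=> /(_ CF dC).
  rewrite derive1E (deriveD dcst dF).
  rewrite derive_cst add0r -derive1E.
  have -> : derive1 F t = G t by exact: F't.
  by rewrite /G patchE mem_set//= in_itv/= tab.
apply: ae_imply2 aeS aev => t St vt tab vt0.
apply: St => //; rewrite -vt0 vt//; congr (_ + _).
apply: eq_Rintegral => s; rewrite inE/= in_itv/= => /andP[as_ st].
rewrite /G patchE mem_set//= in_itv/= as_ /=.
by apply: le_lt_trans st _; case/andP: tab.
Qed.

End primitive_zero_set.

Section zero_on_boxes.
Context {R : realType} {n : nat}.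

(** The measurable sets over which [F] integrates to 0 contain the boxes and are stable under
    complements and disjoint unions, so Dynkin's induction reaches every measurable set. *)
Lemma zero_on_boxes (F : 'rV[R]_n -> R) :
  (leb n).-integrable setT (EFin \o F) ->
  (forall c d : 'I_n -> R, \int[leb n]_(x in obox c d) F x = 0) ->
  {ae leb n, forall x, F x = 0}.
Proof.
move=> iF F0.
have mF : measurable_fun setT F by apply/measurable_EFinP; exact: measurable_int iF.
have iFS S : measurable S -> (leb n).-integrable S (EFin \o F).
  by move=> mS; exact: integrableS iF.
(* Stability under complements needs the integral over the whole space, which is a limit of
   integrals over growing boxes. *)
have FT : \int[leb n]_x F x = 0.
  have cvgF : \int[leb n]_x (F \_ (obox (fun=> - k%:R) (fun=> k%:R))) x
      @[k --> \oo] --> \int[leb n]_x F x.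
    apply: (@dominated_cvg_Rintegral _ _ _ (leb n) setT _ F (fun x => `|F x|)) => //.
    - move=> k; apply/(measurable_restrictT _ _).1; first exact: measurable_obox.
      exact: measurable_funTS.
    - apply: aeW => x _; apply: cvg_near_cst.
      have : [set: 'rV[R]_n] x by []; rewrite -bigcup_obox => -[k _ xk].
      near=> l; rewrite patchE mem_set// => j.
      have kl : k%:R <= l%:R :> R by rewrite ler_nat; near: l; exact: nbhs_infty_ge.
      by have /andP[? ?] := xk j; apply/andP; split; lra.
    - exact: integrable_abse iF.
    - move=> k x _; rewrite patchE; case: ifPn => // _.
      by rewrite normr0 /=.
  apply: (cvg_unique (@Rhausdorff R) cvgF).
  rewrite (_ : (fun k => _) = cst 0); first exact: cvg_cst.
  apply/funext => k; rewrite -[RHS](F0 (fun=> - k%:R) (fun=> k%:R)).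
  by rewrite [RHS]Rintegral_mkcond.
have FS S : measurable S -> \int[leb n]_(x in S) F x = 0.
  move=> mS; have : <<s @oboxes R n >> S by rewrite -measurable_rV_oboxes.
  move: {mS} S.
  apply: (dynkin_induction measurable_rV_oboxes (@oboxes_setI R n)
    (P := fun S => \int[leb n]_(x in S) F x = 0)) => //.
  - by move=> _ [c [d ->]]; exact: F0.
  - move=> S mS FS0; move: FT; rewrite -(setUv S) Rintegral_setU//.
    + by rewrite FS0 add0r.
    + exact: measurableC.
    + by rewrite setUv.
    + by rewrite disj_set2E setICr.
  - move=> S mS tS S0; rewrite /Rintegral integral_bigcup//; last first.
      by apply: iFS; exact: bigcupT_measurable.
    rewrite eseries0// => k _ _.
    rewrite -[LHS]fineK; last by apply: integrable_fin_num => //; exact: iFS.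
    by have := S0 k; rewrite /Rintegral => ->.
have := @integral_ae_eq _ _ _ (leb n) setT measurableT (cst 0%E) (EFin \o F) iF
  (@measurable_cst _ _ _ _ _ _).
move=> H; have := H _ => {}H.
apply: ae_imply (H _) => [x /(_ I)[]//|].
move=> S _ mS; rewrite integral0 -[LHS]fineK; last first.
  by apply: integrable_fin_num => //; exact: iFS.
by have := FS S mS; rewrite /Rintegral => ->.
Unshelve. all: by end_near. Qed.

End zero_on_boxes.

Section integral_vins.
Context {R : realType} {m : nat} (i : 'I_m.+1).
Local Notation mu := (@lebesgue_measure R).

Let mul : {measure set (measurableTypeR R * 'rV[R]_m) -> \bar R} := (mu \x leb m)%E.

Let pf := measure_function_pushforward__canonical__measure_function_Measure
    mul (measurable_vins i).

Lemma measurable_vins_preimage (D : set 'rV[R]_m.+1) : measurable D ->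
  measurable (vins i @^-1` D : set (measurableTypeR R * 'rV[R]_m)).
Proof.
move=> mD; rewrite -[X in measurable X]setTI.
exact: (measurable_vins i measurableT).
Qed.

Lemma ge0_integral_vins (D : set 'rV[R]_m.+1) (f : 'rV[R]_m.+1 -> \bar R) :
  measurable D -> measurable_fun D f -> (forall x, D x -> (0 <= f x)%E) ->
  (\int[leb m.+1]_(x in D) f x = \int[mul]_(z in vins i @^-1` D) f (vins i z))%E.
Proof.
move=> mD mf f0.
transitivity (\int[pf]_(x in D) f x)%E.
  by apply: eq_measure_integral => A mA _; exact: (leb_vins i).
rewrite ge0_integral_pushforward//; first exact: measurable_vins.
by move=> x /set_mem; exact: f0.
Qed.

Lemma integrable_vins (D : set 'rV[R]_m.+1) (h : 'rV[R]_m.+1 -> R) :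
  measurable D -> (leb m.+1).-integrable D (EFin \o h) ->
  mul.-integrable (vins i @^-1` D) (EFin \o (h \o vins i)).
Proof.
move=> mD /integrableP[mh hoo]; apply/integrableP; split.
  apply: (measurable_comp (F := D)) mh _ => //.
    by move=> _ [z Dz <-].
  exact: measurable_funTS (measurable_vins i).
rewrite /= -(@ge0_integral_vins D (fun x => `|(h x)%:E|%E))//.
exact: measurableT_comp.
Qed.

Lemma Rintegral_vins (D : set 'rV[R]_m.+1) (h : 'rV[R]_m.+1 -> R) :
  measurable D -> (leb m.+1).-integrable D (EFin \o h) ->
  \int[leb m.+1]_(x in D) h x = \int[mul]_(z in vins i @^-1` D) h (vins i z).
Proof.
move=> mD ih; rewrite Rintegral_mkcond /Rintegral; congr fine.
have ih' : (leb m.+1).-integrable setT (EFin \o (h \_ D)).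
  by rewrite -restrict_EFin; apply: (integrable_mkcond _ _).1.
transitivity (\int[pf]_x ((h \_ D) x)%:E)%E.
  by apply: eq_measure_integral => A mA _; exact: (leb_vins i).
rewrite (@integral_pushforward _ _ _ _ _ _ (measurable_vins i) mul setT
  (EFin \o (h \_ D)))//.
- rewrite preimage_setT [RHS]integral_mkcond; apply: eq_integral => z _ /=.
  rewrite !patchE (_ : (z \in vins i @^-1` D) = (vins i z \in D)); last first.
    by apply/idP/idP; rewrite !inE.
  by case: ifPn.
- exact: measurable_int ih'.
- exact: (integrable_vins measurableT ih').
Qed.

End integral_vins.

(** * Weak partial derivatives restricted to lines *)

Section slices.
Context {R : realType} {m : nat}.
Local Notation mu := (@lebesgue_measure R).

Lemma smooth1_bounded (f : R -> R) (a b : R) : smooth1 f ->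
  exists M, forall t, a < t < b -> `|f t| <= M.
Proof.
move=> sf; have [ab|ba] := leP a b; last first.
  by exists 0 => t /andP[h1 h2]; have := lt_trans h1 (lt_trans h2 ba); rewrite ltxx.
have : {within `[a, b], continuous (fun t => `|f t|)}.
  apply: continuous_subspaceT => t.
  by apply: continuous_comp; [exact: smooth1_continuous|exact: norm_continuous].
move=> /(EVT_max ab)[c _ cM]; exists `|f c| => t /andP[h1 h2].
by apply: cM; rewrite in_itv/= !ltW.
Qed.

Variables (O : set 'rV[R]_m.+1) (i : 'I_m.+1) (v g : 'rV[R]_m.+1 -> R).
Variables (c d : 'I_m.+1 -> R).
Hypotheses (oO : open O) (cdO : cbox c d `<=` O) (wp : weak_partial O i v g).
Hypotheses (iv : (leb m.+1).-integrable (obox c d) (EFin \o v))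
           (ig : (leb m.+1).-integrable (obox c d) (EFin \o g)).

Let I := `]c i, d i[%classic : set (measurableTypeR R).
Let B := obox (c \o lift i) (d \o lift i).
Let mB : measurable B. Proof. exact: measurable_obox. Qed.

(** Its vanishing is the one-dimensional weak derivative identity, tested with [psi], on the line
    through [y]. *)
Let slice_integral (psi : R -> R) (y : 'rV[R]_m) :=
  \int[mu]_(t in I) (v (vins i (t, y)) * derive1 psi t + g (vins i (t, y)) * psi t).

Section test.
Variable psi : R -> R.
Hypotheses (spsi : smooth1 psi)
  (psi0 : forall t, ~ (c i < t < d i) -> psi t = 0)
  (dpsi0 : forall t, ~ (c i < t < d i) -> derive1 psi t = 0).

Let h (x : 'rV[R]_m.+1) := v x * derive1 psi (x 0 i) + g x * psi (x 0 i).

Let mcoord f : smooth1 f ->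
  measurable_fun (obox c d) (fun x : 'rV[R]_m.+1 => f (x 0 i) : measurableTypeR R).
Proof.
move=> sf; apply: measurable_funTS.
apply: (@measurableT_comp _ _ _ _ _ _ (f : measurableTypeR R -> measurableTypeR R)).
  exact: measurable_smooth1.
exact: measurable_coord.
Qed.

Let ivpsi f (k : 'rV[R]_m.+1 -> R) : smooth1 f ->
  (leb m.+1).-integrable (obox c d) (EFin \o k) ->
  (leb m.+1).-integrable (obox c d) (EFin \o (fun x => k x * f (x 0 i))).
Proof.
move=> sf ik; have [M fM] := smooth1_bounded (c i) (d i) sf.
apply: (integrable_bounded_mulr (M := M)) => //; first exact: measurable_obox.
  exact: mcoord.
by move=> x xcd; exact: fM (xcd i).
Qed.

Let ih : (leb m.+1).-integrable (obox c d) (EFin \o h).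
Proof.
have := integrableD (measurable_obox c d) (ivpsi (smooth1_derive1 spsi) iv)
  (ivpsi spsi ig).
by apply: eq_integrable; [exact: measurable_obox|].
Qed.

Let mul : {measure set (measurableTypeR R * 'rV[R]_m) -> \bar R} := (mu \x leb m)%E.

Let ihv : mul.-integrable (I `*` B) (EFin \o (h \o vins i)).
Proof.
have := integrable_vins i (measurable_obox c d) ih.
by rewrite vins_obox.
Qed.

Lemma integrable_slice_integral :
  (leb m).-integrable B (EFin \o slice_integral psi).
Proof.
have := @integrable_Fubini_G _ _ _ _ _ mu (leb m) I B _
  (measurable_itv `]c i, d i[) mB ihv.
apply: eq_integrable => // y _ /=; congr EFin; apply: eq_Rintegral => t _.
by rewrite /h vinsE.
Qed.

(* Test the weak derivative against psi(x_i) times bumps that approach the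
   indicator of the box ]c', d'[ in the other coordinates. *)
Lemma slice_integral_box (c' d' : 'I_m -> R) :
  \int[leb m]_(y in B `&` obox c' d') slice_integral psi y = 0.
Proof.
pose c2 k := Num.max (c (lift i k)) (c' k).
pose d2 k := Num.min (d (lift i k)) (d' k).
have E : B `&` obox c' d' = obox c2 d2 by exact: obox_setI.
pose chi N := prodfun (fun k => itv_bump (c2 k) (d2 k) N).
(* [FN N f] places [f] in coordinate [i] and bumps in the others. With f = 1 only the bumps remain,
   so [X N] is [chi N] read on R^(m+1). *)
pose FN N f j := if unlift i j is Some k then itv_bump (c2 k) (d2 k) N else f.
pose X N := prodfun (FN N (cst 1)).
have FNi N f : FN N f i = f by rewrite /FN unlift_none.
have FNl N f k : FN N f (lift i k) = itv_bump (c2 k) (d2 k) N by rewrite /FN liftK.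
have sFN N f j : smooth1 f -> smooth1 (FN N f j).
  by move=> sf; rewrite /FN; case: unlift => [k|//]; exact: smooth1_itv_bump.
have prodFN N f x : prodfun (FN N f) x = f (x 0 i) * X N x.
  rewrite /X /prodfun (bigD1_ord i)//= [in RHS](bigD1_ord i)//= !FNi mul1r.
  by congr (_ * _); apply: eq_bigr => k _; rewrite !FNl.
have Xvins N t y : X N (vins i (t, y)) = chi N y.
  rewrite /X /chi /prodfun (bigD1_ord i)//= FNi mul1r; apply: eq_bigr => k _.
  by rewrite FNl vins_lift.
have FN0 N f j t : (forall t, ~ (c i < t < d i) -> f t = 0) ->
    ~ (c j < t < d j) -> FN N f j t = 0.
  move=> f0; case: (unliftP i j) => [k ->|->] tcd; last by rewrite FNi f0.
  rewrite FNl itv_bump_out//; rewrite gt_max lt_min => /andP[/andP[h1 _] /andP[h2 _]].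
  by apply: tcd; rewrite h1.
have prodFN0 N f x : (forall t, ~ (c i < t < d i) -> f t = 0) ->
    ~ obox c d x -> prodfun (FN N f) x = 0.
  move=> f0 /existsNP[j]; rewrite /prodfun (bigD1 j)//= => /(FN0 N f j _ f0) ->.
  by rewrite mul0r.
have chi01 N y : 0 <= chi N y <= 1.
  rewrite /chi /prodfun; elim/big_ind : _ => //; first by rewrite ler01 lexx.
    move=> x z /andP[x0 x1] /andP[z0 z1]; rewrite mulr_ge0//=.
    by rewrite -[1]mulr1 ler_pM.
  by move=> k _; rewrite itv_bump_ge0 itv_bump_le1.
have X1 N x : `|X N x| <= 1.
  by rewrite -(vdelK i x) Xvins; have /andP[h0 h1] := chi01 N (vdel i x).2;
    rewrite ger0_norm.
have mprod p (F : 'I_p -> R -> R) (D : set 'rV[R]_p) : (forall j, smooth1 (F j)) ->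
    measurable_fun D (prodfun F : _ -> measurableTypeR R).
  move=> sF; apply: continuous_measurable_rV => x.
  by apply: differentiable_continuous; exact: differentiable_prodfun.
have mX N : measurable_fun (obox c d) (X N).
  by apply: mprod => j; apply: sFN; exact: smooth1_cst.
have mchi N : measurable_fun B (chi N).
  by apply: mprod => k; exact: smooth1_itv_bump.
have zero N : \int[leb m]_(y in B) (slice_integral psi y * chi N y) = 0.
  have testN : test_function O (prodfun (FN N psi)).
    apply: (test_function_prodfun _ cdO) => [j|j t tcd]; first exact: sFN.
    by apply: FN0 => // /andP[h1 h2]; apply: tcd; rewrite !ltW.
  have := wp testN.
  rewrite partial_prodfun; last by move=> j; exact: sFN.
  (* Differentiating in direction [i] leaves the bumps untouched, so they factor out of both sides
     of the identity. *)
  have -> : derive_coord i (FN N psi) = FN N (derive1 psi).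
    apply/funext => j; rewrite /derive_coord.
    case: (unliftP i j) => [k ->|->]; last by rewrite eqxx !FNi.
    by rewrite eq_sym (negbTE (neq_lift _ _)) !FNl.
  have subO : obox c d `<=` O by move=> x /sub_obox_cbox; exact: cdO.
  rewrite !(Rintegral_support _ subO); last 2 first.
  - by move=> x _ xcd; rewrite prodFN0 ?mulr0.
  - by move=> x _ xcd; rewrite prodFN0 ?mulr0.
  have ihX f k : smooth1 f -> (leb m.+1).-integrable (obox c d) (EFin \o k) ->
      (leb m.+1).-integrable (obox c d) (EFin \o (fun x => k x * prodfun (FN N f) x)).
    move=> sf ik.
    have := integrable_bounded_mulr (measurable_obox c d) (ivpsi sf ik) (mX N)
      (fun x _ => X1 N x).
    by apply: eq_integrable => [|x _ /=]; [exact: measurable_obox|rewrite prodFN mulrA].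
  move/eqP; rewrite -subr_eq0 opprK -RintegralD; [|exact: measurable_obox
    |by apply: ihX => //; exact: smooth1_derive1|exact: ihX].
  under eq_Rintegral do rewrite !prodFN !mulrA -mulrDl -/(h _).
  have ihXi := integrable_bounded_mulr (measurable_obox c d) ih (mX N)
    (fun x _ => X1 N x).
  rewrite (Rintegral_vins i (measurable_obox c d) ihXi) vins_obox.
  have ihXv := integrable_vins i (measurable_obox c d) ihXi.
  rewrite vins_obox in ihXv.
  rewrite -(@Rintegral_Fubini21 _ _ _ _ _ mu (leb m) I B _
    (measurable_itv `]c i, d i[) mB ihXv) => /eqP H0.
  rewrite -[RHS]H0; apply: ae_eq_Rintegral => //.
  - apply: measurable_funM; last exact: mchi.
    by apply/measurable_EFinP; exact: measurable_int integrable_slice_integral.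
  - apply/measurable_EFinP.
    exact: measurable_int (@integrable_Fubini_G _ _ _ _ _ mu (leb m) I B _
      (measurable_itv `]c i, d i[) mB ihXv).
  - have := @ae_integrable_slice2 _ _ _ _ _ mu (leb m) I B _
      (measurable_itv `]c i, d i[) mB ihv.
    apply: ae_imply => y + yB => /(_ yB) ihy.
    under [RHS]eq_Rintegral do rewrite /= Xvins.
    rewrite RintegralZr//=; last exact: measurable_itv.
    by congr (_ * _); apply: eq_Rintegral => t _; rewrite /h vinsE.
(* The bumps lie between 0 and 1 and tend to the indicator of the open box, being 0 off it for every
   [N]; this makes the limit pointwise everywhere. *)
have lim : \int[leb m]_(y in B) (slice_integral psi y * chi N y) @[N --> \oo] -->
    \int[leb m]_(y in B) (slice_integral psi \_ (obox c2 d2)) y.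
  have msl : measurable_fun B (slice_integral psi).
    by apply/measurable_EFinP; exact: measurable_int integrable_slice_integral.
  apply: (@dominated_cvg_Rintegral _ _ _ (leb m) B _ _
    (fun y => `|slice_integral psi y|)) => //.
  - by move=> N; apply: measurable_funM => //; exact: mchi.
  - apply/(measurable_restrict _ (measurable_obox _ _)) => //.
    exact: measurable_funS msl.
  - apply: aeW => y _; rewrite patchE; case: ifPn => [/set_mem ycd|ycd].
      have chi1 : chi N y @[N --> \oo] --> (1 : R).
        rewrite /chi /prodfun; elim: (index_enum _) => [|k s IH].
          by under eq_fun do rewrite big_nil; exact: cvg_cst.
        under eq_fun do rewrite big_cons.
        have := cvgM (itv_bump_cvg (ycd k)) IH.
        by rewrite mulr1; exact.
      have := cvgM (cvg_cst (slice_integral psi y)) chi1.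
      by rewrite mulr1; exact.
    rewrite (_ : (fun N => _) = cst 0); first exact: cvg_cst.
    apply/funext => N; rewrite /chi /prodfun.
    have /existsNP[k yk] : ~ obox c2 d2 y by move=> H; move: ycd; rewrite mem_set.
    by rewrite (bigD1 k)//= itv_bump_out// mul0r mulr0.
  - exact: integrable_abse integrable_slice_integral.
  - move=> N y _; rewrite normrM -[leRHS]mulr1 ler_wpM2l//.
    by have /andP[h0 h1] := chi01 N y; rewrite ger0_norm.
have -> : B `&` obox c' d' = B `&` obox c2 d2 by rewrite -E setIA setIid.
rewrite Rintegral_mkcondr; apply: (cvg_unique (@Rhausdorff R) lim).
rewrite (_ : (fun N => _) = cst 0); first exact: cvg_cst.
by apply/funext => N; exact: zero.
Qed.

Lemma slice_integral_ae0 : {ae leb m, forall y, B y -> slice_integral psi y = 0}.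
Proof.
have iF : (leb m).-integrable setT (EFin \o (slice_integral psi \_ B)).
  rewrite -restrict_EFin; apply: (integrable_mkcond _ _).1 => //.
  exact: integrable_slice_integral.
have : {ae leb m, forall y, (slice_integral psi \_ B) y = 0}.
  apply: zero_on_boxes => // c' d'.
  by rewrite -Rintegral_mkcondl slice_integral_box.
by apply: ae_imply => y; rewrite patchE => + yB; rewrite mem_set.
Qed.

End test.

Lemma plateau_support_in (a b : R) (p q e t : R) : 0 < e ->
  a < p -> p + e < b -> a < q -> q + e < b -> ~ (a < t < b) ->
  plateau p q e t = 0 /\ derive1 (plateau p q e) t = 0.
Proof.
move=> e0 ap pb aq qb tab; split.
  apply: plateau_support => // /andP[]; rewrite ge_min -lerBlDr le_max.
  move=> h1 h2; apply: tab; apply/andP; split.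
    by case/orP: h1; apply: lt_le_trans.
  by case/orP: h2; rewrite lerBlDr => h2; apply: le_lt_trans h2 _.
have z x : a < x -> x + e < b -> scaled_bump x e t = 0.
  move=> ax xb; apply: scaled_bump_support => // /andP[h1 h2]; apply: tab.
  by rewrite (lt_trans ax h1) (lt_trans h2 xb).
rewrite derive1_plateau mulrBl.
by have := z p ap pb; have := z q aq qb; rewrite /scaled_bump => -> ->; rewrite subrr.
Qed.

(** The slice identity holds off a null set of lines that depends on [psi]. The rational plateaus
    are countable, so one null set serves them all, and they are the tests that [weak_derivative_ae]
    asks for. *)
Lemma slice_primitive : {ae leb m, forall y, B y -> exists C,
  {ae mu, forall t, c i < t < d i ->
    v (vins i (t, y)) = C + \int[mu]_(s in `]c i, t]) g (vins i (s, y))}}.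
Proof.
pose psi (r : rat * rat * nat) : R -> R :=
  plateau (ratr r.1.1) (ratr r.1.2) r.2.+1%:R^-1.
pose good (r : rat * rat * nat) := [/\ c i < ratr r.1.1,
  ratr r.1.1 + r.2.+1%:R^-1 < d i, c i < ratr r.1.2 &
  ratr r.1.2 + r.2.+1%:R^-1 < d i].
have all_psi r : {ae leb m, forall y, good r -> B y -> slice_integral (psi r) y = 0}.
  have [gr|ngr] := pselect (good r); last by apply: aeW => y /ngr.
  have [h1 h2 h3 h4] := gr.
  have e0 : (0 : R) < r.2.+1%:R^-1 by rewrite invr_gt0.
  have sup t tab := plateau_support_in e0 h1 h2 h3 h4 (t := t) tab.
  have := @slice_integral_ae0 (psi r) (smooth1_plateau _ _ _)
    (fun t tab => (sup t tab).1) (fun t tab => (sup t tab).2).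
  by apply: ae_imply => y H _.
have slice k : (leb m.+1).-integrable (obox c d) (EFin \o k) ->
    {ae leb m, forall y, B y -> mu.-integrable I (EFin \o (fun t => k (vins i (t, y))))}.
  move=> ik; have := integrable_vins i (measurable_obox c d) ik.
  rewrite vins_obox => ikv.
  exact: (@ae_integrable_slice2 _ _ _ _ _ mu (leb m) I B _
      (measurable_itv `]c i, d i[) mB ikv).
apply: ae_imply2 (ae_forall_countable all_psi)
  (ae_imply2 (fun y H1 H2 => conj H1 H2) (slice _ iv) (slice _ ig)).
move=> y H [sv sg] By.
apply: (weak_derivative_ae (sv By) (sg By)) => p q k h1 h2 h3 h4.
have := H (p, q, k) (And4 h1 h2 h3 h4) By.
rewrite /slice_integral /psi /= => {}H.
have bnd f : smooth1 f -> forall l, mu.-integrable I (EFin \o l) ->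
    mu.-integrable I (EFin \o (fun t => l t * f t)).
  move=> sf l il; have [M fM] := smooth1_bounded (c i) (d i) sf.
  apply: (@integrable_bounded_mulr _ _ _ mu I l f M (measurable_itv _) il).
    by apply: measurable_smooth1.
  by move=> t; rewrite /I/= in_itv/=; exact: fM.
have spsi : smooth1 (plateau (ratr p) (ratr q) (k.+1%:R^-1 : R)).
  exact: smooth1_plateau.
apply/eqP; rewrite -subr_eq0 opprK; apply/eqP; rewrite -[RHS]H.
rewrite RintegralD.
- by [].
- exact: measurable_itv.
- by apply: (bnd _ _ _ (sv By)); exact: smooth1_derive1.
- exact: (bnd _ _ _ (sg By)).
Qed.

End slices.

(** * Weak derivatives on the zero set *)

Section zero_set.
Context {R : realType}.
Local Notation mu := (@lebesgue_measure R).

Lemma ae_leb_slices (m : nat) (i : 'I_m.+1) (A : set 'rV[R]_m.+1) :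
  measurable A ->
  {ae leb m, forall y, {ae mu, forall t, ~ A (vins i (t, y))}} ->
  {ae leb m.+1, forall x, ~ A x}.
Proof.
move=> mA H; exists A; split => //; last by move=> x /= /contrapT.
rewrite (leb_vins i mA); apply/(product_null2 mu (leb m)).
  exact: measurable_vins_preimage.
apply: ae_imply H => y H; apply/negligibleP.
  apply: measurable_ysection; exact: measurable_vins_preimage.
case: H => N [mN N0 HN]; exists N; split => // t /= tA; apply: HN => /=.
by move: tA; rewrite ysectionE /= => tA /(_ tA).
Qed.

(** On a set of finite measure the bound |f| <= 1 + f^2 replaces Cauchy-Schwarz. *)
Lemma L2_integrable (n : nat) (O A : set 'rV[R]_n) (f : 'rV[R]_n -> R) :
  measurable O -> measurable A -> A `<=` O -> (leb n A < +oo)%E ->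
  L2 O f -> (leb n).-integrable A (EFin \o f).
Proof.
move=> mO mA AO Aoo [mf f2].
have ic : (leb n).-integrable A (EFin \o cst (1 : R)) by exact: integrable_cst.
have i2 : (leb n).-integrable A (fun x => (f x ^+ 2)%:E) by exact: integrableS f2.
apply: (le_integrable mA _ _ (integrableD mA ic i2)).
  apply/measurable_EFinP; exact: measurable_funS mf.
move=> x Ax /=; rewrite lee_fin.
rewrite [leRHS]ger0_norm; last by rewrite addr_ge0// sqr_ge0.
rewrite -(real_normK (num_real (f x))).
have := sqr_ge0 (`|f x| - 1); have := normr_ge0 (f x).
by move: (`|f x|) => z; nra.
Qed.

(* On almost every line the weak derivative is the derivative of a primitive,
   which vanishes at every accumulation point of the zero set. *)
Lemma weak_partial_zero_set (n : nat) (O : set 'rV[R]_n) (i : 'I_n) (v g : 'rV[R]_n -> R) :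
  open O -> L2 O v -> L2 O g -> weak_partial O i v g ->
  {ae leb n, forall x, O x -> v x = 0 -> g x = 0}.
Proof.
case: n O i v g => [|m] O i v g; first by case: i.
move=> oO L2v L2g wp.
have mO := open_measurable_rV oO.
have box (cd : {ffun 'I_m.+1 -> rat} * {ffun 'I_m.+1 -> rat}) :
    {ae leb m.+1, forall x, cbox (ratr \o cd.1) (ratr \o cd.2) `<=` O ->
       obox (ratr \o cd.1 : 'I_m.+1 -> R) (ratr \o cd.2) x -> v x = 0 -> g x = 0}.
  set c := ratr \o cd.1; set d := ratr \o cd.2.
  have [cdO|] := pselect (cbox c d `<=` O); last by move=> ncd; apply: aeW => x /ncd.
  have subO : obox c d `<=` O by move=> x /sub_obox_cbox; exact: cdO.
  have mcd := measurable_obox c d.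
  have iv := L2_integrable mO mcd subO (leb_obox_lty c d) L2v.
  have ig := L2_integrable mO mcd subO (leb_obox_lty c d) L2g.
  (* The bad points in the box. Repeating the box in each preimage makes [A] measurable although [v]
     and [g] are measurable only on [O]. *)
  pose A := obox c d `&` ((obox c d `&` v @^-1` [set 0]) `&` (obox c d `&` g @^-1` (~` [set 0]))).
  have mA : measurable A.
    apply: measurableI => //; apply: measurableI.
      have [mv _] := L2v; have := measurable_funS mO subO mv; apply => //.
    have [mg _] := L2g; have := measurable_funS mO subO mg; apply => //.
    by apply: measurableC; exact: measurable_set1.
  suff : {ae leb m.+1, forall x, ~ A x}.
    apply: ae_imply => x nA _ xcd vx; have [//|gx] := pselect (g x = 0).
    by exfalso; apply: nA.
  apply: (ae_leb_slices (i := i)) => //.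
  have igv := integrable_vins i mcd ig.
  rewrite vins_obox in igv.
  have igs := @ae_integrable_slice2 _ _ _ _ _ mu (leb m)
    (`]c i, d i[%classic) (obox (c \o lift i) (d \o lift i)) _
    (measurable_itv `]c i, d i[) (measurable_obox _ _) igv.
  apply: ae_imply2 igs (slice_primitive cdO wp iv ig).
  move=> y ig_y prim_y.
  have [yB|nyB] := pselect (obox (c \o lift i) (d \o lift i) y); last first.
    apply: aeW => t [tcd _]; apply: nyB.
    have : (vins i @^-1` obox c d) (t, y) by [].
    by rewrite vins_obox => -[].
  have [C aeC] := prim_y yB.
  apply: ae_imply (primitive_zero_ae (ig_y yB) aeC) => t H [tcd [[_ v0] [_ g0]]].
  apply: g0; apply: H => //.
  have : (vins i @^-1` obox c d) (t, y) by [].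
  by rewrite vins_obox /= in_itv/= => -[].
apply: ae_imply (ae_forall_countable box) => x H Ox.
have [c [d [xcd cdO]]] := open_has_box oO Ox.
exact: H (c, d) cdO xcd.
Qed.

End zero_set.

(** * Weak time derivatives *)

Section time_primitive.
Context {R : realType} {n : nat}.
Local Notation mu := (@lebesgue_measure R).

(** Continuity includes both ends, while [g] is controlled only on the open interval; extending it
    by 0 changes no integral, endpoints being null. *)
Lemma primitive_continuous (a b : R) (g : R -> R) : a < b ->
  mu.-integrable `]a, b[ (EFin \o g) ->
  {within `[a, b], continuous (fun t => \int[mu]_(s in `]a, t]) g s)}.
Proof.
move=> ab ig.
pose G := g \_ `]a, b[.
have iG : mu.-integrable setT (EFin \o G).
  by rewrite -restrict_EFin; apply: (integrable_mkcond _ _).1.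
have iGS (D : set (measurableTypeR R)) : measurable D -> mu.-integrable D (EFin \o G).
  by move=> mD; exact: integrableS iG.
have cG := parameterized_integral_continuous (ltW ab) (iGS _ (measurable_itv `[a, b])).
apply: subspace_eq_continuous cG => t; rewrite inE/= in_itv/= => /andP[at_ tb].
rewrite /from_subspace /= /parameterized_integral.
rewrite -Rintegral_itv_obnd_cbnd; last by apply: iGS.
rewrite -Rintegral_itv_bndo_bndc; last by apply: iGS.
have sub : `]a, t[%classic `<=` `]a, b[%classic.
  by apply: subset_itvl; rewrite bnd_simp.
rewrite -[RHS]Rintegral_itv_bndo_bndc; last by apply: integrableS ig.
apply: eq_Rintegral => s; rewrite inE => /sub sab.
by rewrite /G patchE mem_set.
Qed.

Variables (T : R) (O : set 'rV[R]_n).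
Hypotheses (T0 : 0 < T) (mO : measurable O) (Ooo : (leb n O < +oo)%E).

Let I : set (measurableTypeR R) := `]0, T[%classic.
Let mI : measurable I. Proof. exact: measurable_itv. Qed.

Let mul : {measure set (measurableTypeR R * 'rV[R]_n) -> \bar R} := (mu \x leb n)%E.

Lemma ge0_integral_domain12 (D1 : set (measurableTypeR R)) (D2 : set 'rV[R]_n)
    (f : measurableTypeR R * 'rV[R]_n -> R) : measurable D1 -> measurable D2 ->
  measurable_fun (D1 `*` D2) f -> (forall z, (D1 `*` D2) z -> 0 <= f z) ->
  (\int[mul]_(z in D1 `*` D2) (f z)%:E =
   \int[mu]_(t in D1) \int[leb n]_(x in D2) (f (t, x))%:E)%E.
Proof.
move=> m1 m2 mf f0; rewrite integral_mkcond fubini_tonelli1.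
- rewrite [RHS]integral_mkcond; apply: eq_integral => t _.
  rewrite patchE /fubini_F; case: ifPn => [/set_mem tD|tD].
    rewrite [RHS]integral_mkcond; apply: eq_integral => x _; rewrite !patchE.
    congr (if _ then _ else _); apply/idP/idP; rewrite !inE.
      by case.
    by split.
  rewrite integral0_eq// => x _; rewrite patchE memNset// => -[/= tD1 _].
  by move: tD; rewrite mem_set.
- apply/(measurable_restrictT _ _).1; first exact: measurableX.
  exact/measurable_EFinP.
- by move=> z; rewrite patchE; case: ifPn => // /set_mem Dz; rewrite lee_fin f0.
Qed.

Lemma ge0_integral_domain21 (D1 : set (measurableTypeR R)) (D2 : set 'rV[R]_n)
    (f : measurableTypeR R * 'rV[R]_n -> R) : measurable D1 -> measurable D2 ->
  measurable_fun (D1 `*` D2) f -> (forall z, (D1 `*` D2) z -> 0 <= f z) ->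
  (\int[mul]_(z in D1 `*` D2) (f z)%:E =
   \int[leb n]_(x in D2) \int[mu]_(t in D1) (f (t, x))%:E)%E.
Proof.
move=> m1 m2 mf f0; rewrite integral_mkcond fubini_tonelli2.
- rewrite [RHS]integral_mkcond; apply: eq_integral => x _.
  rewrite patchE /fubini_G; case: ifPn => [/set_mem xD|xD].
    rewrite [RHS]integral_mkcond; apply: eq_integral => t _; rewrite !patchE.
    congr (if _ then _ else _); apply/idP/idP; rewrite !inE.
      by case.
    by split.
  rewrite integral0_eq// => t _; rewrite patchE memNset// => -[/= _ xD1].
  by move: xD; rewrite mem_set.
- apply/(measurable_restrictT _ _).1; first exact: measurableX.
  exact/measurable_EFinP.
- by move=> z; rewrite patchE; case: ifPn => // /set_mem Dz; rewrite lee_fin f0.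
Qed.

Lemma measurable_ge0_slice_integral (D1 : set (measurableTypeR R))
    (D2 : set 'rV[R]_n) (f : measurableTypeR R * 'rV[R]_n -> R) :
  measurable D1 -> measurable D2 ->
  measurable_fun (D1 `*` D2) f -> (forall z, (D1 `*` D2) z -> 0 <= f z) ->
  measurable_fun D2 (fun x => \int[mu]_(t in D1) (f (t, x))%:E)%E.
Proof.
move=> m1 m2 mf f0.
have mG : measurable_fun setT (fubini_G mu ((EFin \o f) \_ (D1 `*` D2))).
  apply: measurable_fun_fubini_tonelli_G.
    apply/(measurable_restrictT _ _).1; first exact: measurableX.
    exact/measurable_EFinP.
  by move=> z; rewrite patchE; case: ifPn => // /set_mem Dz; rewrite lee_fin f0.
apply: eq_measurable_fun (measurable_funS measurableT (@subsetT _ D2) mG).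
move=> x xD; rewrite /fubini_G [RHS]integral_mkcond; apply: eq_integral => t _.
rewrite !patchE; congr (if _ then _ else _); apply/idP/idP; rewrite !inE.
  by case.
by split => //; exact: set_mem.
Qed.

Lemma measurable_ge0_slice_integral1 (D1 : set (measurableTypeR R))
    (D2 : set 'rV[R]_n) (f : measurableTypeR R * 'rV[R]_n -> R) :
  measurable D1 -> measurable D2 ->
  measurable_fun (D1 `*` D2) f -> (forall z, (D1 `*` D2) z -> 0 <= f z) ->
  measurable_fun D1 (fun t => \int[leb n]_(x in D2) (f (t, x))%:E)%E.
Proof.
move=> m1 m2 mf f0.
have mF : measurable_fun setT (fubini_F (leb n) ((EFin \o f) \_ (D1 `*` D2))).
  apply: measurable_fun_fubini_tonelli_F.
    apply/(measurable_restrictT _ _).1; first exact: measurableX.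
    exact/measurable_EFinP.
  by move=> z; rewrite patchE; case: ifPn => // /set_mem Dz; rewrite lee_fin f0.
apply: eq_measurable_fun (measurable_funS measurableT (@subsetT _ D1) mF).
move=> t tD; rewrite /fubini_F [RHS]integral_mkcond; apply: eq_integral => x _.
rewrite !patchE; congr (if _ then _ else _); apply/idP/idP; rewrite !inE.
  by case.
by split => //; exact: set_mem.
Qed.

Let prod_lty : (mul (I `*` O) < +oo)%E.
Proof.
have -> : mul (I `*` O) = (mu I * leb n O)%E by exact: product_measure1E.
have -> : mu I = T%:E by rewrite lebesgue_measure_itv/= lte_fin T0 oppr0 adde0.
by rewrite lte_mul_pinfty// lee_fin ltW.
Qed.

Lemma time_L2_integrable_sqr u : time_L2 T O u ->
  mul.-integrable (I `*` O) (EFin \o (fun z => u z.1 z.2 ^+ 2)).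
Proof.
move=> [mf u2]; have mf2 : measurable_fun (I `*` O) (fun z => u z.1 z.2 ^+ 2).
  exact: measurable_funX.
apply/integrableP; split; first exact/measurable_EFinP.
under eq_integral do rewrite /= ger0_norm ?sqr_ge0//.
rewrite (ge0_integral_domain12 mI mO mf2)// => z _; exact: sqr_ge0.
Qed.

Lemma time_L2_integrableM u v : time_L2 T O u -> time_L2 T O v ->
  mul.-integrable (I `*` O) (EFin \o (fun z => u z.1 z.2 * v z.1 z.2)).
Proof.
move=> L2u L2v; have mIO : measurable (I `*` O) by exact: measurableX.
apply: (le_integrable mIO _ _ (integrableD mIO (time_L2_integrable_sqr L2u)
  (time_L2_integrable_sqr L2v))).
  apply/measurable_EFinP; apply: measurable_funM; first by case: L2u.
  by case: L2v.
move=> z _ /=; rewrite lee_fin normrM.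
rewrite [leRHS]ger0_norm; last by rewrite addr_ge0// sqr_ge0.
rewrite -(real_normK (num_real (u z.1 z.2))) -(real_normK (num_real (v z.1 z.2))).
move: (`|u z.1 z.2|) (`|v z.1 z.2|) (normr_ge0 (u z.1 z.2)) (normr_ge0 (v z.1 z.2)).
by move=> a b a0 b0; have := sqr_ge0 (a - b); nra.
Qed.

Lemma time_L2_integrable u : time_L2 T O u ->
  mul.-integrable (I `*` O) (EFin \o (fun z => u z.1 z.2)).
Proof.
move=> L2u; have L21 : time_L2 T O (fun _ _ => 1).
  split; first exact: measurable_cst.
  have := ge0_integral_domain12 mI mO (@measurable_cst _ _ _ _ (I `*` O) (1 : R))
    (fun _ _ => ler01).
  have -> : (\int[mul]_(z in I `*` O) (1 : R)%:E)%E = mul (I `*` O).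
    by rewrite integral_cst ?mul1e//; exact: measurableX.
  by under [in X in _ -> X]eq_integral do (under eq_integral do rewrite expr1n);
    move=> <-.
have := time_L2_integrableM L2u L21; apply: eq_integrable => [|z _ /=].
  exact: measurableX.
by rewrite mulr1.
Qed.

Lemma ae_integrable_time_slice u : time_L2 T O u ->
  ae_in O (fun x => mu.-integrable `]0, T[ (EFin \o u ^~ x)).
Proof.
move=> /time_L2_integrable iu.
exact: (@ae_integrable_slice2 _ _ _ _ _ mu (leb n) I O _ mI mO iu).
Qed.

Lemma time_test_plateau (p q e : R) : 0 < e ->
  0 < p -> p + e < T -> 0 < q -> q + e < T -> time_test T (plateau p q e).
Proof.
move=> e0 p0 pT q0 qT; split.
  by move=> k t; apply: smooth1_derivable; apply: smooth1_derive1n; exact: smooth1_plateau.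
exists `[Num.min p q, Num.max p q + e]%classic; split.
- exact: segment_compact.
- move=> t; rewrite /= !in_itv/= => /andP[h1 h2].
  rewrite (lt_le_trans _ h1) ?lt_min ?p0//= (le_lt_trans h2)//.
  by rewrite -ltrBrDr gt_max !ltrBrDr pT.
- by move=> t; rewrite /= in_itv/= => H; exact: plateau_support.
Qed.

(** The countable family of plateaus again gives one null set of points x for all tests. The
    constant [C] stays unknown here: an identity at almost every time does not see u(0). *)
Lemma ae_time_primitive u ut : time_L2 T O u -> time_L2 T O ut ->
  weak_time_derivative T O u ut ->
  ae_in O (fun x => mu.-integrable `]0, T[ (EFin \o ut ^~ x) /\
    exists C, {ae mu, forall t, 0 < t < T ->
      u t x = C + \int[mu]_(s in `]0, t]) ut s x}).
Proof.
move=> L2u L2ut wtd.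
pose psi (r : rat * rat * nat) : R -> R :=
  plateau (ratr r.1.1) (ratr r.1.2) r.2.+1%:R^-1.
pose good (r : rat * rat * nat) := [/\ (0 : R) < ratr r.1.1,
  ratr r.1.1 + r.2.+1%:R^-1 < T, (0 : R) < ratr r.1.2 &
  ratr r.1.2 + r.2.+1%:R^-1 < T].
have all_psi r : {ae leb n, forall x, good r -> O x ->
    \int[mu]_(t in `]0, T[) (u t x * derive1 (psi r) t) =
    - \int[mu]_(t in `]0, T[) (ut t x * psi r t)}.
  have [[h1 h2 h3 h4]|ngr] := pselect (good r); last by apply: aeW => y /ngr.
  have := wtd (psi r) (time_test_plateau _ h1 h2 h3 h4).
  by rewrite invr_gt0 ltr0n => /(_ isT); apply: ae_imply => x H _.
have := ae_imply2 (fun x H1 H2 => conj H1 H2)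
  (ae_integrable_time_slice L2u) (ae_integrable_time_slice L2ut).
apply: ae_imply2 (ae_forall_countable all_psi) => x H [iu iut] Ox.
split; first exact: iut.
apply: (weak_derivative_ae (iu Ox) (iut Ox)) => p q k h1 h2 h3 h4.
exact: H (p, q, k) (And4 h1 h2 h3 h4) Ox.
Qed.

End time_primitive.

(** * Values at a prescribed time *)

Section pointwise_in_time.
Context {R : realType} {n : nat}.
Local Notation mu := (@lebesgue_measure R).

Lemma limn_einf_ge (u : nat -> \bar R) (c : \bar R) (K : nat) :
  (forall k, (K <= k)%N -> (c <= u k)%E) -> (c <= limn_einf u)%E.
Proof.
move=> cu; rewrite limn_einf_lim; apply: lime_ge; first exact: is_cvg_einfs.
exists K => // k /= Kk; apply: le_ereal_inf_tmp => _ [l /= kl <-].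
by apply: cu; exact: leq_trans kl.
Qed.

Lemma ge0_cvge0 (f : nat -> \bar R) : (forall k, 0 <= f k)%E ->
  (forall eta : R, 0 < eta -> \forall k \near \oo, (f k <= eta%:E)%E) ->
  f @ \oo --> 0%E.
Proof.
move=> f0 fe; apply/fine_cvgP; split.
  apply: filterS (fe _ ltr01) => k fk.
  by rewrite ge0_fin_numE// (le_lt_trans fk)// ltry.
apply/cvgrPdist_le => /= eta /fe; apply: filterS => k fk.
rewrite sub0r normrN ger0_norm ?fine_ge0// -lee_fin fineK//.
by rewrite ge0_fin_numE// (le_lt_trans fk)// ltry.
Qed.

(** Convergence to 0 in L^1 does not give pointwise convergence of the whole sequence. Fatou gives a
    lower limit 0, which is enough to contradict a positive lower bound, with no subsequence to
    extract. *)
Lemma ae_limn_einf_eq0 d (T : measurableType d) (nu : {measure set T -> \bar R})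
    (D : set T) (F : nat -> T -> \bar R) : measurable D ->
  (forall k, measurable_fun D (F k)) -> (forall k x, D x -> (0 <= F k x)%E) ->
  (\int[nu]_(x in D) F k x)%E @[k --> \oo] --> 0%E ->
  {ae nu, forall x, D x -> limn_einf (F ^~ x) = 0%E}.
Proof.
move=> mD mF F0 cvF.
have l0 x : D x -> (0 <= limn_einf (F ^~ x))%E.
  by move=> Dx; apply: (@limn_einf_ge _ _ 0%N) => k _; exact: F0.
have ml : measurable_fun D (fun x => limn_einf (F ^~ x)).
  apply: measurableT_comp => //; apply: measurable_fun_limn_esup => k.
  exact: measurableT_comp.
have := fatou nu mD mF F0.
rewrite (cvg_limn_einf_sup cvF).1 => le0.
have /(ae_eq_integral_abs nu mD ml).1 :
    (\int[nu]_(x in D) `|limn_einf (F ^~ x)|)%E = 0%E.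
  apply/eqP; rewrite eq_le integral_ge0 ?andbT//.
  apply: le_trans le0; rewrite le_eqVlt; apply/orP; left; apply/eqP.
  by apply: eq_integral => x /set_mem Dx; rewrite gee0_abs ?l0.
by apply: ae_imply => x.
Qed.

Variables (T : R) (O : set 'rV[R]_n).
Hypotheses (T0 : 0 < T) (mO : measurable O) (Ooo : (leb n O < +oo)%E).
Variables u ut : R -> 'rV[R]_n -> R.
Hypotheses (L2u : time_L2 T O u) (L2ut : time_L2 T O ut)
  (wtd : weak_time_derivative T O u ut) (cu : continuous_L2 T O u).

(* Averaging u(s) over short intervals J next to t: the averages of
   (u(s) - u(t))^2 tend to 0 in L^1(O) by continuity, and on almost every x
   they stay away from 0 unless the primitive takes the value u(t, x). *)
Lemma ae_time_primitive_at (t : R) : t \in `[0, T] ->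
  ae_in O (fun x => forall C, {ae mu, forall s, 0 < s < T ->
      u s x = C + \int[mu]_(r in `]0, s]) ut r x} ->
    u t x = C + \int[mu]_(r in `]0, t]) ut r x).
Proof.
move=> tT; have [L2ut_ cut] := cu tT.
pose e k : R := k.+1%:R^-1.
have e0 k : 0 < e k by rewrite invr_gt0.
have e1 k : e k <= 1 by rewrite invf_le1// ler1n.
have ecvg : e k @[k --> \oo] --> 0 := cvg_harmonic.
have /andP[t0 tleT] : 0 <= t <= T by move: tT; rewrite in_itv.
(* [J k] is the image of ]0, T[ under the contraction of centre [t] and ratio [e k]. It therefore
   stays inside ]0, T[ for every [t] in [0, T], the two ends included, and has length [e k * T]. *)
pose a k := t * (1 - e k).
pose J k : set (measurableTypeR R) := `]a k, a k + e k * T[%classic.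
have mJ k : measurable (J k) by exact: measurable_itv.
have eT0 k : 0 < e k * T by rewrite mulr_gt0.
have muJ k : mu (J k) = (e k * T)%:E.
  by rewrite lebesgue_measure_itv/= lte_fin ltrDl eT0 -EFinB addrAC subrr add0r.
have Jsub k s : J k s -> 0 < s < T /\ `|s - t| <= e k * T.
  rewrite /J/= in_itv/= /a => /andP[h1 h2]; have := e0 k; have := e1 k.
  have te : t * e k <= T * e k by rewrite ler_wpM2r// ltW.
  have te0 : 0 <= t * e k by rewrite mulr_ge0// ltW.
  have tT1 : (T - t) * e k <= T - t by rewrite ler_piMr// subr_ge0.
  have t1 : t * e k <= t by rewrite ler_piMr.
  move: h1 h2; rewrite mulrBr mulr1 [e k * T]mulrC; rewrite mulrBl in tT1 => h1 h2 k1 k0.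
  by split; [apply/andP; split; lra|rewrite ler_norml; apply/andP; split; lra].
have JI k : J k `<=` `]0, T[%classic.
  by move=> s /Jsub[+ _]; rewrite /= in_itv.
pose sq (z : measurableTypeR R * 'rV[R]_n) : R := (u z.1 z.2 - u t z.2) ^+ 2.
have msq k : measurable_fun (J k `*` O) sq.
  apply: measurable_funX; apply: measurable_funB.
    have [mf _] := L2u; apply: measurable_funS mf; first exact: measurableX.
    by move=> z [Jz Oz]; split => //; exact: JI Jz.
  have [mut _] := L2ut_.
  apply: (measurable_comp mO _ mut) => [_ [z [_ Oz] <-]//|].
  exact: measurable_funTS measurable_snd.
have sq0 z : 0 <= sq z by exact: sqr_ge0.
have mul k : measurable (J k `*` O) by exact: measurableX.
pose F k x : \bar R := ((e k * T)^-1%:E * \int[mu]_(s in J k) (sq (s, x))%:E)%E.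
have mF k : measurable_fun O (F k).
  apply: measurable_funeM.
  by apply: (measurable_ge0_slice_integral (mJ k) mO (msq k)) => z _; exact: sq0.
have F0 k x : O x -> (0 <= F k x)%E.
  move=> _; apply: mule_ge0; first by rewrite lee_fin invr_ge0 ltW.
  by apply: integral_ge0 => s _; rewrite lee_fin.
have intF k : (\int[leb n]_(x in O) F k x =
    (e k * T)^-1%:E * \int[mu]_(s in J k) L2dist_sq O (u s) (u t))%E.
  have ms := measurable_ge0_slice_integral (mJ k) mO (msq k) (fun z _ => sq0 z).
  have ek0 : (0 <= (e k * T)^-1%:E)%E by rewrite lee_fin invr_ge0 ltW.
  rewrite (ge0_integralZl (leb n) mO ms _ ek0); last first.
    by move=> x _; apply: integral_ge0 => s _; rewrite lee_fin.
  congr (_ * _)%E; rewrite -(ge0_integral_domain21 (mJ k) mO (msq k))//.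
  by rewrite (ge0_integral_domain12 (mJ k) mO (msq k)).
have cvF : (\int[leb n]_(x in O) F k x)%E @[k --> \oo] --> 0%E.
  apply: ge0_cvge0 => [k|eta eta0]; first by apply: integral_ge0 => x; exact: F0.
  move: (cut) => /fine_cvgP[fin_d /cvgrPdist_le/(_ _ eta0) cv_d'].
  have : \forall s \near within `[0, T]%classic (nbhs t),
      (L2dist_sq O (u s) (u t) <= eta%:E)%E.
    near=> s; have fs : L2dist_sq O (u s) (u t) \is a fin_num by near: s.
    rewrite -(fineK fs) lee_fin (le_trans (ler_norm _))//.
    rewrite -normrN -sub0r; near: s; exact: cv_d'.
  rewrite /within /= => /nbhs_ballP[r /= r0 Hr].
  have : \forall k \near \oo, e k < r / T.
    by apply: (cvgr_lt (0 : R)) => //; rewrite divr_gt0.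
  apply: filterS => k; rewrite ltr_pdivlMr// => ekr.
  rewrite intF -lee_pdivlMl ?invr_gt0// invrK -EFinM mulrC EFinM -muJ.
  rewrite -integral_cst//; apply: ge0_le_integral => //.
  - by move=> s _; apply: integral_ge0 => x _; rewrite lee_fin sqr_ge0.
  - exact: (measurable_ge0_slice_integral1 (mJ k) mO (msq k) (fun z _ => sq0 z)).
  - move=> s Js; apply: Hr.
      by have [_] := Jsub k s Js; rewrite /ball/= distrC => /le_lt_trans; apply.
    by have [/andP[h1 h2] _] := Jsub k s Js; rewrite /= in_itv/= !ltW.
have slices := ae_imply2 (fun x H1 H2 => conj H1 H2)
  (ae_integrable_time_slice T0 mO Ooo L2u) (ae_integrable_time_slice T0 mO Ooo L2ut).
apply: ae_imply2 (ae_limn_einf_eq0 mO mF F0 cvF) slices => x H [iu iut] Ox C aeC.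
have {H} Hx := H Ox; have {iu} iu := iu Ox; have {iut} iut := iut Ox.
pose U s := C + \int[mu]_(r in `]0, s]) ut r x.
rewrite -/(U t); apply: contrapT => /eqP utx.
pose D := (U t - u t x) ^+ 2.
have D0 : 0 < D by rewrite /D exprn_even_gt0//= subr_eq0 eq_sym.
have cU : {within `[0, T], continuous U}.
  have := primitive_continuous T0 iut.
  move=> cI s; apply: cvgD; [exact: cvg_cst|exact: cI].
have cphi : (U s - u t x) ^+ 2 @[s --> within `[0, T]%classic (nbhs t)] --> D.
  have Ut : U s @[s --> within `[0, T]%classic (nbhs t)] --> U t.
    by move/subspace_continuousP : cU; exact.
  have cB : U s - u t x @[s --> within `[0, T]%classic (nbhs t)] --> U t - u t x.
    by apply: cvgB => //; exact: cvg_cst.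
  rewrite /D expr2; under eq_fun do rewrite expr2.
  exact: cvgM.
(* If u(t, x) differed from the continuous primitive, the averages over [J k] would be at least D/2
   for all large [k], since u(., x) equals the primitive almost everywhere. *)
have : \forall s \near within `[0, T]%classic (nbhs t), D / 2 <= (U s - u t x) ^+ 2.
  apply: (cvgr_ge D) => //; rewrite ltr_pdivrMr// ltr_pMr// ltr1n //.
rewrite /within /= => /nbhs_ballP[r /= r0 Hr].
have : \forall k \near \oo, e k < r / T.
  by apply: (cvgr_lt (0 : R)) => //; rewrite divr_gt0.
move=> [K _ HK].
have : ((D / 2)%:E <= limn_einf (F ^~ x))%E.
  apply: (@limn_einf_ge _ _ K) => k /HK /=; rewrite ltr_pdivlMr// => ekr.
  rewrite /F -lee_pdivrMl ?invr_gt0// invrK -EFinM mulrC EFinM -muJ.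
  rewrite -integral_cst//; apply: ae_ge0_le_integral => //.
  - by move=> s _; rewrite lee_fin divr_ge0// ltW.
  - by move=> s _; rewrite lee_fin.
  - apply/measurable_EFinP; apply: measurable_funX; apply: measurable_funB => //.
    apply: measurable_funS (JI k) _ => //.
    by apply/measurable_EFinP; exact: measurable_int iu.
    exact: (@measurable_cst _ _ _ _ (J k) (u t x)).
  - apply: ae_imply aeC => s us Js; rewrite lee_fin /sq /=.
    have [sT sr] := Jsub k s Js; rewrite (us sT) -/(U s).
    apply: Hr; first by rewrite /ball/= distrC (le_lt_trans sr).
    by case/andP: sT => h1 h2; rewrite /= in_itv/= !ltW.
by rewrite Hx lee_fin leNgt divr_gt0.
Unshelve. all: by end_near. Qed.

End pointwise_in_time.

(** * Test functions and Sobolev functions *)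

Section test_functions.
Context {R : realType} {n : nat}.
Variable O : set 'rV[R]_n.
Hypotheses (oO : open O) (bO : bounded_set O).
Implicit Types (f g phi : 'rV[R]_n -> R).

Let mO : measurable O. Proof. exact: open_measurable_rV. Qed.
Let Ooo : (leb n O < +oo)%E. Proof. exact: leb_bounded_lty. Qed.

Lemma smooth_continuous f : smooth f -> continuous f.
Proof. by move=> sf x; apply: differentiable_continuous; exact: (sf [::]). Qed.

Lemma smooth_partial i f : smooth f -> smooth (partial i f).
Proof. by move=> sf s x; have := sf (rcons s i) x; rewrite foldr_rcons. Qed.

Lemma partialB i f g : (forall x, differentiable f x) ->
  (forall x, differentiable g x) ->
  partial i (f \- g) = partial i f \- partial i g.
Proof.
move=> df dg; apply/funext => x; rewrite /partial deriveB//.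
  exact: diff_derivable.
exact: diff_derivable.
Qed.

Lemma smoothB f g : smooth f -> smooth g -> smooth (f \- g).
Proof.
move=> sf sg s x.
have -> : foldr partial (f \- g) s = foldr partial f s \- foldr partial g s.
  elim: s => [//|i s IH] /=; rewrite IH.
  exact: (partialB i (sf s) (sg s)).
by apply: differentiableB; [exact: sf|exact: sg].
Qed.

Lemma supported_in_partial i phi : supported_in O phi ->
  supported_in O (partial i phi).
Proof.
move=> [K [cK KO phi0]]; exists K; split => // x nKx.
have oK : open (~` K) by apply/closed_openC; apply: compact_closed cK; exact: norm_hausdorff.
rewrite /partial; have nx : \forall y \near x, phi y = cst 0 y.
  have : nbhs x (~` K) by exact: open_nbhs_nbhs.
  by apply: filterS => y; exact: phi0.
by rewrite (near_eq_derive _ nx) derive_cst.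
Qed.

Lemma test_function_partial i phi : test_function O phi ->
  test_function O (partial i phi).
Proof.
move=> [sphi supp]; split; first exact: smooth_partial.
exact: supported_in_partial.
Qed.

Lemma test_functionB phi psi : test_function O phi -> test_function O psi ->
  test_function O (phi \- psi).
Proof.
move=> [sphi [K [cK KO phi0]]] [spsi [L [cL LO psi0]]].
split; first exact: smoothB.
exists (K `|` L); split; first exact: compactU.
  by move=> x [/KO|/LO].
by move=> x /not_orP[/phi0 /= -> /psi0 ->]; rewrite subrr.
Qed.

Lemma test_function_bounded phi : test_function O phi ->
  exists M, forall x, `|phi x| <= M.
Proof.
move=> [sphi [K [cK KO phi0]]].
have [[x0 Kx0]|nK] := pselect (K !=set0); last first.
  by exists 0 => x; rewrite phi0 ?normr0// => Kx; apply: nK; exists x.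
have cphi : {within K, continuous (fun x => `|phi x|)}.
  apply: continuous_subspaceT => x; apply: continuous_comp.
    exact: smooth_continuous.
  exact: norm_continuous.
have K0 : K !=set0 by exists x0.
have [c _ cM] := EVT_max_rV K0 cK cphi.
exists `|phi c| => x; have [Kx|nKx] := pselect (K x).
  by apply: cM; rewrite inE.
by rewrite phi0// normr0.
Qed.

Lemma measurable_test_function phi (D : set 'rV[R]_n) : test_function O phi ->
  measurable_fun D (phi : _ -> measurableTypeR R).
Proof. by move=> [sphi _]; apply: continuous_measurable_rV; exact: smooth_continuous. Qed.

Lemma L2_integrableM f g : L2 O f -> L2 O g ->
  (leb n).-integrable O (EFin \o (fun x => f x * g x)).
Proof.
move=> [mf f2] [mg g2].
apply: (le_integrable mO _ _ (integrableD mO f2 g2)).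
  by apply/measurable_EFinP; exact: measurable_funM.
move=> x _ /=; rewrite lee_fin normrM.
rewrite [leRHS]ger0_norm; last by rewrite addr_ge0// sqr_ge0.
rewrite -(real_normK (num_real (f x))) -(real_normK (num_real (g x))).
move: (`|f x|) (`|g x|) (normr_ge0 (f x)) (normr_ge0 (g x)).
by move=> a b a0 b0; have := sqr_ge0 (a - b); nra.
Qed.

Lemma L2_cst (c : R) : L2 O (cst c).
Proof.
split; first exact: measurable_cst.
by have := integrable_cst (mu := leb n) (c ^+ 2) mO Ooo.
Qed.

Lemma L2D f g : L2 O f -> L2 O g -> L2 O (f \+ g).
Proof.
move=> L2f L2g; have [mf f2] := L2f; have [mg g2] := L2g.
split; first exact: measurable_funD.
have := integrableD mO (integrableD mO f2 g2) (integrableZl mO 2 (L2_integrableM L2f L2g)).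
apply: eq_integrable => // x _ /=; rewrite -!EFinD; congr EFin; ring.
Qed.

Lemma L2N f : L2 O f -> L2 O (\- f).
Proof.
move=> [mf f2]; split; first exact: measurable_funN.
by under eq_fun do rewrite /= sqrrN.
Qed.

Lemma L2B f g : L2 O f -> L2 O g -> L2 O (f \- g).
Proof. by move=> L2f L2g; apply: L2D => //; exact: L2N. Qed.

Lemma L2_laplacian (D2f : 'I_n -> 'I_n -> 'rV[R]_n -> R) :
  (forall i, L2 O (D2f i i)) -> L2 O (laplacian D2f).
Proof.
move=> H; rewrite (_ : laplacian D2f = \sum_(i < n) D2f i i); last first.
  by apply/funext => x; rewrite fct_sumE.
elim/big_ind : _ => // [|f g]; [exact: (L2_cst 0)|exact: L2D].
Qed.

Lemma L2_test_function phi : test_function O phi -> L2 O phi.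
Proof.
move=> tphi; have mphi := @measurable_test_function _ O tphi; split => //.
have [M phiM] := test_function_bounded tphi.
have := integrable_cst (mu := leb n) (M ^+ 2) mO Ooo.
apply: le_integrable => //.
  by apply/measurable_EFinP; exact: measurable_funX.
move=> x _ /=; rewrite lee_fin !ger0_norm ?sqr_ge0//.
by rewrite -(real_normK (num_real (phi x))) lerXn2r ?nnegrE// (le_trans _ (phiM x)).
Qed.

Lemma weak_partialB i f f' g g' : L2 O f -> L2 O f' -> L2 O g -> L2 O g' ->
  weak_partial O i f g -> weak_partial O i f' g' ->
  weak_partial O i (f \- f') (g \- g').
Proof.
move=> Lf Lf' Lg Lg' wp wp' phi tphi.
have tdphi := test_function_partial i tphi.
have Lphi := L2_test_function tphi; have Ldphi := L2_test_function tdphi.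
under eq_Rintegral do rewrite /= mulrBl.
rewrite RintegralB//; [|exact: L2_integrableM|exact: L2_integrableM].
under [in RHS]eq_Rintegral do rewrite /= mulrBl.
rewrite RintegralB//; [|exact: L2_integrableM|exact: L2_integrableM].
by rewrite wp// wp'// opprB opprK addrC.
Qed.

Lemma H1_gradB f f' Df Df' : H1_grad O f Df -> H1_grad O f' Df' ->
  H1_grad O (f \- f') (fun i => Df i \- Df' i).
Proof.
move=> [Lf Hf] [Lf' Hf']; split; first exact: L2B.
move=> i; have [L1 w1] := Hf i; have [L2 w2] := Hf' i.
by split; [exact: L2B|exact: weak_partialB].
Qed.

Lemma H2_jetB f f' Df Df' D2f D2f' : H2_jet O f Df D2f -> H2_jet O f' Df' D2f' ->
  H2_jet O (f \- f') (fun i => Df i \- Df' i) (fun i j => D2f i j \- D2f' i j).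
Proof.
move=> [H1 H2] [H1' H2']; split; first exact: H1_gradB.
by move=> i; exact: H1_gradB.
Qed.

Lemma laplacianB (D2f D2f' : 'I_n -> 'I_n -> 'rV[R]_n -> R) x :
  laplacian (fun i j => D2f i j \- D2f' i j) x =
  laplacian D2f x - laplacian D2f' x :> R.
Proof. by rewrite /laplacian -sumrB. Qed.

(* Stampacchia's lemma applied to f and then to its first derivatives. *)
Lemma laplacian_zero_set f Df D2f : H2_jet O f Df D2f ->
  ae_in O (fun x => f x = 0 -> laplacian D2f x = 0).
Proof.
move=> [[Lf Hf] H2].
have H i : ae_in O (fun x => f x = 0 -> D2f i i x = 0).
  have [LDi wi] := Hf i; have [_ H2i] := H2 i; have [LD2 w2] := H2i i.
  apply: ae_imply2 (weak_partial_zero_set oO Lf LDi wi)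
    (weak_partial_zero_set oO LDi LD2 w2).
  by move=> x h1 h2 Ox f0; apply: h2 => //; exact: h1.
apply: ae_imply (ae_forall_countable H) => x {}H Ox f0.
by rewrite /laplacian big1// => i _; exact: H.
Qed.

Lemma L2dist_sqB f f' g g' : L2 O f -> L2 O f' -> L2 O g -> L2 O g' ->
  (L2dist_sq O (f \- f')%R (g \- g')%R <= 2%:E * (L2dist_sq O f g + L2dist_sq O f' g'))%E.
Proof.
move=> Lf Lf' Lg Lg'.
have mB h h' : L2 O h -> L2 O h' -> measurable_fun O (fun x => ((h x - h' x) ^+ 2)%:E).
  by move=> [mh _] [mh' _]; apply/measurable_EFinP; apply: measurable_funX;
    exact: measurable_funB.
rewrite /L2dist_sq -ge0_integralD//; [|by move=> x _; rewrite lee_fin sqr_ge0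
  |exact: mB|by move=> x _; rewrite lee_fin sqr_ge0|exact: mB].
rewrite -ge0_integralZl//; [|by apply: emeasurable_funD; exact: mB
  |by move=> x _; rewrite -EFinD lee_fin addr_ge0// sqr_ge0].
apply: ge0_le_integral => //.
- by move=> x _; rewrite lee_fin sqr_ge0.
- by apply: mB; exact: L2B.
- by apply: measurable_funeM; apply: emeasurable_funD; exact: mB.
- move=> x _; rewrite -EFinD -EFinM lee_fin /=.
  have := sqr_ge0 ((f x - g x) + (f' x - g' x)); nra.
Qed.

Lemma cvg_L2dist_sqB (f_ f'_ : nat -> 'rV[R]_n -> R) f f' :
  (forall k, L2 O (f_ k)) -> (forall k, L2 O (f'_ k)) -> L2 O f -> L2 O f' ->
  L2dist_sq O (f_ k) f @[k --> \oo] --> 0%E ->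
  L2dist_sq O (f'_ k) f' @[k --> \oo] --> 0%E ->
  L2dist_sq O (f_ k \- f'_ k) (f \- f') @[k --> \oo] --> 0%E.
Proof.
move=> L_ L'_ Lf Lf' c c'.
have c2 : (2%:E * (L2dist_sq O (f_ k) f + L2dist_sq O (f'_ k) f'))%E
    @[k --> \oo] --> 0%E.
  rewrite -[X in _ --> X](mule0 2%:E); apply: cvgeZl => //.
  by rewrite -[X in _ --> X]adde0; exact: cvgeD.
apply: (squeeze_cvge _ (cvg_cst 0%E) c2).
apply: nearW => k; rewrite L2dist_sqB// andbT.
by apply: integral_ge0 => x _; rewrite lee_fin sqr_ge0.
Qed.

Lemma H10B f f' : H10 O f -> H10 O f' -> H10 O (f \- f').
Proof.
move=> [Df [H1f [phi [tphi [c1 c2]]]]] [Df' [H1f' [phi' [tphi' [c1' c2']]]]].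
exists (fun i => Df i \- Df' i); split; first exact: H1_gradB.
exists (fun k => phi k \- phi' k); split.
  by move=> k; exact: test_functionB.
have [Lf Hf] := H1f; have [Lf' Hf'] := H1f'.
split.
  by apply: cvg_L2dist_sqB => // k; exact: L2_test_function.
move=> i; have [LDf _] := Hf i; have [LDf' _] := Hf' i.
rewrite (_ : (fun k => _) = (fun k => L2dist_sq O
    (partial i (phi k) \- partial i (phi' k)) (Df i \- Df' i))).
  by apply: cvg_L2dist_sqB => // k; apply: L2_test_function;
    exact: test_function_partial.
apply/funext => k; rewrite partialB//.
  by have [s _] := tphi k; exact: (s [::]).
by have [s _] := tphi' k; exact: (s [::]).
Qed.

(** Weighted Young inequality in place of Cauchy-Schwarz: |g d| <= a g^2 + d^2 / a for every a > 0,
    with [a] chosen before [k]. *)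
Lemma L2dist_cvg_Rintegral g f (f_ : nat -> 'rV[R]_n -> R) :
  L2 O g -> L2 O f -> (forall k, L2 O (f_ k)) ->
  L2dist_sq O (f_ k) f @[k --> \oo] --> 0%E ->
  \int[leb n]_(x in O) (g x * f_ k x) @[k --> \oo] --> \int[leb n]_(x in O) (g x * f x).
Proof.
move=> Lg Lf L_ cv.
pose G := \int[leb n]_(x in O) (g x ^+ 2).
have G0 : 0 <= G by apply: Rintegral_ge0 => x _; exact: sqr_ge0.
have ig2 : (leb n).-integrable O (EFin \o (fun x => g x ^+ 2)) by case: Lg.
have id2 k : (leb n).-integrable O (EFin \o (fun x => (f_ k x - f x) ^+ 2)).
  by have [_] := L2B (L_ k) Lf.
have key (a : R) k : 0 < a -> `|\int[leb n]_(x in O) (g x * f x) -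
    \int[leb n]_(x in O) (g x * f_ k x)| <=
    a * G + a^-1 * fine (L2dist_sq O (f_ k) f).
  move=> a0.
  have igf := L2_integrableM Lg Lf; have igfk := L2_integrableM Lg (L_ k).
  have igd := L2_integrableM Lg (L2B Lf (L_ k)).
  rewrite -RintegralB//.
  under eq_Rintegral do rewrite -mulrBr.
  apply: le_trans (le_normr_Rintegral mO igd) _.
  rewrite /G /L2dist_sq -/(Rintegral _ _ _) -RintegralZl// -RintegralZl//.
  have ia := integrableZl mO a ig2; have ia' := integrableZl mO a^-1 (id2 k).
  rewrite -RintegralD//.
  apply: le_Rintegral => //.
  - exact: integrable_abse igd.
  - by have := integrableD mO ia ia'; apply: eq_integrable.
  - move=> x _; rewrite normrM /= -[f_ k x - f x]opprB sqrrN.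
    rewrite -(real_normK (num_real (g x))) -(real_normK (num_real (f x - f_ k x))).
    move: (`|g x|) (`|f x - f_ k x|) (normr_ge0 (g x)) (normr_ge0 (f x - f_ k x)).
    move=> p q p0 q0.
    rewrite -(ler_pM2l a0) mulrDr [a * (a^-1 * _)]mulrA mulfV ?gt_eqF// mul1r.
    have := sqr_ge0 (a * p - q); have := mulr_ge0 p0 q0; nra.
apply/cvgrPdist_le => /= e e0.
(* This makes a G at most e/2; the added 1 covers G = 0. The other half of e then bounds the
   distance term, scaled by 1/a. *)
pose a := e / (2 * (G + 1)).
have G10 : 0 < G + 1 by rewrite ltr_wpDl.
have a0 : 0 < a by rewrite divr_gt0// mulr_gt0.
have ae0 : 0 < a * (e / 2) by rewrite mulr_gt0// divr_gt0.
move/fine_cvgP : cv => [_ /cvgrPdist_le /(_ _ ae0)]; apply: filterS => k.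
rewrite sub0r normrN => /(le_trans (ler_norm _)) dk.
apply: le_trans (key a k a0) _.
have h1 : a * G <= e / 2.
  rewrite /a -mulrA [_^-1 * _]mulrC mulrA ler_pdivrMr ?mulr_gt0//.
  by rewrite mulrA divfK ?pnatr_eq0// ler_pM2l// ler_wpDr.
have h2 : a^-1 * fine (L2dist_sq O (f_ k) f) <= e / 2.
  by rewrite mulrC ler_pdivrMr// mulrC.
by rewrite [e]splitr lerD.
Qed.

End test_functions.

(** * The energy inequality for the Laplacian *)

Section energy.
Context {R : realType} {n : nat}.
Variable O : set 'rV[R]_n.
Hypotheses (oO : open O) (bO : bounded_set O).

Let mO : measurable O. Proof. exact: open_measurable_rV. Qed.

Lemma Rintegral_sum_L2 (I : Type) (s : seq I) (F : I -> 'rV[R]_n -> R) g :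
  (forall i, L2 O (F i)) -> L2 O g ->
  \int[leb n]_(x in O) ((\sum_(i <- s) F i x) * g x) =
  \sum_(i <- s) \int[leb n]_(x in O) (F i x * g x).
Proof.
move=> LF Lg; elim: s => [|i s IH].
  under eq_Rintegral do rewrite big_nil mul0r.
  by rewrite big_nil Rintegral_cst// mul0r.
rewrite big_cons -IH -RintegralD//.
- by apply: eq_Rintegral => x _; rewrite big_cons mulrDl.
- exact: L2_integrableM.
- apply: L2_integrableM => //.
  elim: s {IH} => [|j s IH].
    by under eq_fun do rewrite big_nil; exact: (L2_cst oO bO 0).
  by under eq_fun do rewrite big_cons; exact: L2D.
Qed.

(* The gradient of the approximating test functions is itself made of test
   functions, so the two weak gradients of z need not be compared a.e. *)
Lemma laplacian_energy z Dz D2z : H2_jet O z Dz D2z -> H10 O z ->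
  \int[leb n]_(x in O) (laplacian D2z x * z x) <= 0.
Proof.
move=> [[Lz Hz] H2z] [Dz' [[_ Hz'] [zeta [tz [c1 c2]]]]].
have LD2 i j : L2 O (D2z i j) by have [_ H] := H2z i; have [] := H j.
rewrite /laplacian Rintegral_sum_L2//.
apply: sumr_le0 => i _.
have [LDz wz] := Hz i; have [LDz' wz'] := Hz' i.
have [_ H2i] := H2z i; have [_ w2] := H2i i.
have Lzeta k : L2 O (zeta k) by exact: L2_test_function.
have Ldzeta k : L2 O (partial i (zeta k)).
  by apply: L2_test_function => //; exact: test_function_partial.
have l1 := L2dist_cvg_Rintegral oO LDz LDz' Ldzeta (c2 i).
have l2 := L2dist_cvg_Rintegral oO (LD2 i i) Lz Lzeta c1.
have l3 := L2dist_cvg_Rintegral oO LDz' LDz' Ldzeta (c2 i).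
have E1 : \int[leb n]_(x in O) (Dz i x * Dz' i x) =
    - \int[leb n]_(x in O) (D2z i i x * z x).
  apply: (cvg_unique (@Rhausdorff R) l1).
  rewrite (_ : (fun k => _) = (fun k => - \int[leb n]_(x in O)
      (D2z i i x * zeta k x))); first exact: cvgN.
  by apply/funext => k; exact: w2.
(* Tested with the i-th derivative of [zeta k], either gradient gives the same integral of z; in the
   limit [Dz] may be replaced by [Dz'], and [E1] becomes minus a square. *)
have E2 : \int[leb n]_(x in O) (Dz i x * Dz' i x) =
    \int[leb n]_(x in O) (Dz' i x * Dz' i x).
  apply: (cvg_unique (@Rhausdorff R) l1).
  rewrite (_ : (fun k => _) = (fun k => \int[leb n]_(x in O)
      (Dz' i x * partial i (zeta k) x))) //.
  apply/funext => k; have tk := test_function_partial i (tz k).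
  by have := wz _ tk; rewrite wz'// => /oppr_inj.
rewrite -[leLHS]opprK -E1 E2 oppr_le0.
by apply: Rintegral_ge0 => x _; rewrite -expr2 sqr_ge0.
Qed.

End energy.

(** * Primitives: the barrier and the square *)

Section primitive1.
Context {R : realType}.
Local Notation mu := (@lebesgue_measure R).

Lemma primitive_patch (a b t : R) (g : R -> R) : t <= b ->
  mu.-integrable `]a, b[ (EFin \o g) ->
  \int[mu]_(s in `]a, t]) g s = \int[mu]_(s in `]a, t]) (g \_ `]a, b[) s.
Proof.
move=> tb ig.
have iG : mu.-integrable setT (EFin \o (g \_ `]a, b[)).
  by rewrite -restrict_EFin; apply: (integrable_mkcond _ _).1.
have sub : `]a, t[%classic `<=` `]a, b[%classic.
  by apply: subset_itvl; rewrite bnd_simp.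
rewrite -Rintegral_itv_bndo_bndc; last by apply: integrableS ig.
rewrite -Rintegral_itv_bndo_bndc; last by apply: integrableS iG.
by apply: eq_Rintegral => s; rewrite inE => /sub sab; rewrite patchE mem_set.
Qed.

(** Suppose U(t1) < c and go back to the last time [s0] before t1 at which U >= c. After it U is
    below [c], so [g] vanishes almost everywhere and U(t1) = U(s0), a contradiction. *)
Lemma primitive_ge_barrier (T c u0 : R) (g : R -> R) : 0 < T ->
  mu.-integrable `]0, T[ (EFin \o g) -> c <= u0 ->
  {ae mu, forall t, 0 < t < T -> u0 + \int[mu]_(s in `]0, t]) g s < c -> g t = 0} ->
  forall t, 0 <= t <= T -> c <= u0 + \int[mu]_(s in `]0, t]) g s.
Proof.
move=> T0 ig cu0 aeg t1 /andP[t10 t1T].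
pose U t := u0 + \int[mu]_(s in `]0, t]) g s.
have cU : {within `[0, T], continuous U}.
  have := primitive_continuous T0 ig.
  by move=> cI s; apply: cvgD; [exact: cvg_cst|exact: cI].
rewrite leNgt; apply/negP => Ut1.
pose S := [set s | 0 <= s <= t1 /\ c <= U s].
have S0 : S 0.
  split; first by rewrite lexx.
  by rewrite /U set_itv_ge ?bnd_simp ?ltxx// Rintegral_set0 addr0.
have supS : has_sup S.
  by split; [exists 0|exists t1 => s [/andP[]]].
pose s0 := sup S.
have s00 : 0 <= s0 by apply: ub_le_sup => //; exact: supS.2.
have s0t1 : s0 <= t1 by apply: ge_sup; [exists 0|move=> s [/andP[]]].
(* The supremum is attained: by continuity U < c at [s0] would persist nearby, but points of [S]
   come arbitrarily close to [s0]. *)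
have cs0 : c <= U s0.
  rewrite leNgt; apply/negP => Us0.
  have s0T : `[0, T]%classic s0 by rewrite /= in_itv/= s00 (le_trans s0t1).
  have cvs0 : U s @[s --> within `[0, T]%classic (nbhs s0)] --> U s0.
    by move/subspace_continuousP : cU; exact.
  have : \forall s \near within `[0, T]%classic (nbhs s0), U s < c.
    exact: (cvgr_lt (U s0)).
  rewrite /within /= => /nbhs_ballP[r /= r0 Hr].
  have [s [Ss1 Ss2] s0s] := sup_adherent r0 supS.
  have ss0 : s <= s0 by apply: ub_le_sup => //; exact: supS.2.
  have : U s < c.
    apply: Hr; first by rewrite /ball/= ltr_norml; apply/andP; split; rewrite -/s0 in s0s; lra.
    have /andP[h1 h2] := Ss1.
    by rewrite /= in_itv/= h1 (le_trans h2).
  by rewrite ltNge Ss2.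
pose G := g \_ `]0, T[.
have iG : mu.-integrable setT (EFin \o G).
  by rewrite -restrict_EFin; apply: (integrable_mkcond _ _).1.
have UG t : t <= T -> U t = u0 + \int[mu]_(s in `]0, t]) G s.
  by move=> tT; rewrite /U (primitive_patch tT ig).
have : U t1 - U s0 = 0.
  rewrite !UG//; last exact: le_trans s0t1 _.
  rewrite opprD addrACA subrr add0r.
  rewrite Rintegral_itvB ?bnd_simp//; last by apply: integrableS iG.
  rewrite (@ae_eq_Rintegral _ _ _ mu _ _ (cst 0))//.
  - by rewrite Rintegral_cst// mul0r.
  - apply: measurable_funTS; apply/measurable_EFinP; exact: measurable_int iG.
  - apply: ae_imply aeg => t gt; rewrite /= in_itv/= => /andP[s0t tt1].
    rewrite /G patchE; case: ifPn => // /set_mem; rewrite /= in_itv/= => tT.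
    apply: gt => //; rewrite -/(U t) ltNge; apply/negP => cUt.
    have : t <= s0.
      apply: ub_le_sup; first exact: supS.2.
      by split => //; rewrite tt1 andbT ltW//; case/andP: tT.
    by rewrite leNgt s0t.
move/eqP; rewrite subr_eq0 => /eqP E; move: Ut1; rewrite -/(U t1) E ltNge.
by rewrite cs0.
Qed.

(** The chain rule for the square of a primitive, by Fubini: the square of the integral is the
    integral of g(s) g(r) over a square, and each of the halves r <= s and s < r contributes the
    integral of [g] times its primitive. *)
Lemma sqr_primitive (t : R) (g : R -> R) : 
  mu.-integrable `]0, t] (EFin \o g) ->
  (\int[mu]_(s in `]0, t]) g s) ^+ 2 =
  2 * \int[mu]_(s in `]0, t]) (g s * \int[mu]_(r in `]0, s]) g r).
Proof.
move=> ig.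
pose D : set (measurableTypeR R) := `]0, t]%classic.
have mD : measurable D by exact: measurable_itv.
pose G := g \_ D.
have iG : mu.-integrable setT (EFin \o G).
  by rewrite -restrict_EFin; apply: (integrable_mkcond _ _).1.
have mG : measurable_fun setT (G : measurableTypeR R -> measurableTypeR R).
  by apply/measurable_EFinP; exact: measurable_int iG.
pose K (z : measurableTypeR R * measurableTypeR R) : R := G z.1 * G z.2.
pose mm : {measure set (measurableTypeR R * measurableTypeR R) -> \bar R} :=
  (mu \x mu)%E.
have mK : measurable_fun setT K.
  by apply: measurable_funM; [exact: measurableT_comp mG measurable_fst
    |exact: measurableT_comp mG measurable_snd].
have iK : mm.-integrable setT (EFin \o K).
  apply/(integrable12ltyP mu mu).
    by apply/measurable_EFinP.
  have iaG : (\int[mu]_r `|(G r)%:E| < +oo)%E by move/integrableP : iG => [].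
  have E s : (\int[mu]_r `|(K (s, r))%:E| = `|(G s)%:E| * \int[mu]_r `|(G r)%:E|)%E.
    rewrite -ge0_integralZl//.
    + by apply: eq_integral => r _; rewrite /K /= normrM EFinM.
    + by apply: measurableT_comp => //; exact: measurable_int iG.
  under eq_integral do rewrite /= E.
  rewrite ge0_integralZr//.
  + by rewrite lte_mul_pinfty ?integral_ge0// ge0_fin_numE ?integral_ge0.
  + by apply: measurableT_comp => //; exact: measurable_int iG.
  + exact: integral_ge0.
pose A : set (measurableTypeR R * measurableTypeR R) := [set z | z.2 <= z.1].
have mA : measurable A.
  have -> : A = (fun z => z.1 - z.2) @^-1` `[0, +oo[%classic.
    by apply/seteqP; split=> z; rewrite /A /= in_itv/= andbT subr_ge0.
  rewrite -[X in measurable X]setTI.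
  have : measurable_fun setT (fun z : measurableTypeR R * measurableTypeR R =>
      z.1 - z.2 : measurableTypeR R).
    by apply: measurable_funB; [exact: measurable_fst|exact: measurable_snd].
  by apply => //; exact: measurable_itv.
have iKB (B : set (measurableTypeR R * measurableTypeR R)) : measurable B ->
    mm.-integrable setT (EFin \o (fun z => K z * \1_B z)).
  move=> mB; apply: (@integrable_bounded_mulr _ _ _ mm setT K (\1_B) 1) => //.
  move=> z _; rewrite indicE; case: (_ \in _); rewrite ?normr1// normr0.
  exact: ler01.
pose Gam s := \int[mu]_(r in `]0, s]) g r.
(* Whether [B] contains [s] is left open, so that this covers both the closed and the open half of
   the square; the two differ by one point on each line. *)
have GamE s (B : set (measurableTypeR R)) : measurable B -> D s ->
    (forall r, r < s -> B r) -> (forall r, s < r -> ~ B r) ->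
    \int[mu]_r (G r * \1_B r) = Gam s.
  move=> mB Ds lts gts.
  have [s0 st] : 0 < s /\ s <= t by move: Ds; rewrite /D/= in_itv => /andP[].
  rewrite /Gam [RHS]Rintegral_mkcond.
  apply: (@ae_eq_Rintegral _ _ _ mu setT) => //.
  - by apply: measurable_funM.
  - apply/(measurable_restrictT _ _).1; first exact: measurable_itv.
    have mg : measurable_fun D g by apply/measurable_EFinP; exact: measurable_int ig.
    apply: measurable_funS mg => // r; rewrite /D /= !in_itv/= => /andP[-> rs].
    exact: le_trans st.
  - exists [set s]; split => //; first exact: lebesgue_measure_set1.
    apply: subsetCl => r /= rs _.
    have [rlt|rgt|//] := ltgtP r s.
      rewrite indicE mem_set; last exact: lts.
      rewrite mulr1 /G !patchE.
      have -> : (r \in D) = (r \in `]0, s]%classic).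
        apply/idP/idP; rewrite !inE /D /= !in_itv/= => /andP[-> _].
          exact: ltW.
        exact: le_trans (ltW rlt) st.
      by [].
    rewrite indicE memNset; last exact: gts.
    rewrite mulr0 patchE memNset//= in_itv/= leNgt rgt andbF.
    by [].
have E0 : \int[mm]_z K z = (\int[mu]_(s in `]0, t]) g s) ^+ 2.
  rewrite -(Rintegral12 iK) [in RHS]Rintegral_mkcond -/D -/G.
  under eq_Rintegral do rewrite /K /= RintegralZl//.
  by rewrite RintegralZr// expr2.
have E1 : \int[mm]_z (K z * \1_A z) = \int[mu]_(s in `]0, t]) (g s * Gam s).
  rewrite -(Rintegral12 (iKB A mA)) [in RHS]Rintegral_mkcond.
  apply: eq_Rintegral => s _; rewrite [RHS]patchE.
  have mB : measurable [set r : measurableTypeR R | r <= s].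
    by rewrite (_ : [set r | _] = `]-oo, s]%classic)//; apply/seteqP; split=> r;
      rewrite /= in_itv.
  rewrite (_ : (fun r => _) = (fun r => G s * (G r * \1_[set r | r <= s] r))).
    rewrite RintegralZl//; last first.
      apply: (@integrable_bounded_mulr _ _ _ mu setT G _ 1) => // r _.
      by rewrite indicE; case: (_ \in _); rewrite ?normr1// normr0 ler01.
    have -> : G s = if s \in D then g s else 0 by rewrite /G patchE.
    case: ifPn => [/set_mem sD|_]; last by rewrite mul0r.
    congr (_ * _); apply: GamE => // r; first exact: ltW.
    by move=> sr /=; apply/negP; rewrite -ltNge.
  apply/funext => r; rewrite /K /= mulrA; congr (_ * _).
(* Integrating the other half in the opposite order exchanges the roles of the two variables. *)
have E2 : \int[mm]_z (K z * \1_(~` A) z) = \int[mu]_(s in `]0, t]) (g s * Gam s).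
  rewrite -(Rintegral21 (iKB _ (measurableC mA))) [in RHS]Rintegral_mkcond.
  apply: eq_Rintegral => s _; rewrite [RHS]patchE.
  have mB : measurable [set r : measurableTypeR R | r < s].
    by rewrite (_ : [set r | _] = `]-oo, s[%classic)//; apply/seteqP; split=> r;
      rewrite /= in_itv.
  rewrite (_ : (fun r => _) = (fun r => G s * (G r * \1_[set r | r < s] r))).
    rewrite RintegralZl//; last first.
      apply: (@integrable_bounded_mulr _ _ _ mu setT G _ 1) => // r _.
      by rewrite indicE; case: (_ \in _); rewrite ?normr1// normr0 ler01.
    have -> : G s = if s \in D then g s else 0 by rewrite /G patchE.
    case: ifPn => [/set_mem sD|_]; last by rewrite mul0r.
    congr (_ * _); apply: GamE => // r.
    by move=> sr /=; apply/negP; rewrite -leNgt ltW.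
  apply/funext => r; rewrite /K /= mulrA [G r * _]mulrC; congr (_ * _).
  rewrite !indicE; congr (_%:R); congr nat_of_bool.
  apply/idP/idP => /set_mem H; apply/mem_set; move: H; rewrite /A /=.
    by move=> /negP; rewrite -ltNge.
  by rewrite ltNge => /negP.
rewrite -E0 mulrDl mul1r -{1}E1 -E2 -RintegralD//; [|exact: iKB|].
  apply: eq_Rintegral => z _; rewrite -mulrDr !indicE in_setC.
  by case: (_ \in _); rewrite /= ?addr0 ?add0r mulr1.
by apply: iKB; exact: measurableC.
Qed.

(** Here [t] may be [T], where [g] is not controlled. The previous lemma is applied to [g] cut off
    to the open interval, and the endpoint is then discarded. *)
Lemma sqr_primitive_oo (t T : R) (g : R -> R) : t <= T ->
  mu.-integrable `]0, T[ (EFin \o g) ->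
  (\int[mu]_(s in `]0, t]) g s) ^+ 2 =
  2 * \int[mu]_(s in `]0, t[) (g s * \int[mu]_(r in `]0, s]) g r).
Proof.
move=> tT ig.
have sub : `]0, t[%classic `<=` `]0, T[%classic by apply: subset_itvl; rewrite bnd_simp.
have igt : mu.-integrable `]0, t[ (EFin \o g) by apply: integrableS ig.
pose G := g \_ `]0, t[.
have iG : mu.-integrable setT (EFin \o G).
  by rewrite -restrict_EFin; apply: (integrable_mkcond _ _).1.
have Gout s : ~ `]0, t[%classic s -> G s = 0.
  by move=> ns; rewrite /G patchE memNset.
have Gin s : `]0, t[%classic s -> G s = g s.
  by move=> sI; rewrite /G patchE mem_set.
have oc : `]0, t[%classic `<=` (`]0, t]%classic : set R).
  by move=> s; rewrite /= !in_itv/= => /andP[-> /ltW].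
have := @sqr_primitive t G; rewrite (@Rintegral_support _ _ _ mu _ _ _ oc); last first.
  by move=> s _; exact: Gout.
rewrite (@Rintegral_support _ _ _ mu _ _ (fun s => G s * _) oc); last first.
  by move=> s _ /Gout ->; rewrite mul0r.
rewrite -(Rintegral_itv_bndo_bndc igt).
rewrite (_ : \int[mu]_(s in `]0, t[) G s = \int[mu]_(s in `]0, t[) g s); last first.
  by apply: eq_Rintegral => s /set_mem; exact: Gin.
move=> ->; last by apply: integrableS iG.
congr (2 * _); apply: eq_Rintegral => s /set_mem sI; rewrite Gin//; congr (_ * _).
apply: eq_Rintegral => r /set_mem; rewrite /= in_itv/= => /andP[r0 rs].
by apply: Gin; move: sI; rewrite /= !in_itv/= r0 => /andP[_]; exact: le_lt_trans.
Qed.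

Lemma Rintegral_ae_le0 d (X : measurableType d) (nu : {measure set X -> \bar R})
    (D : set X) (F : X -> R) : measurable D -> nu.-integrable D (EFin \o F) ->
  {ae nu, forall x, D x -> F x <= 0} -> \int[nu]_(x in D) F x <= 0.
Proof.
move=> mD iF F0; have mF : measurable_fun D F.
  by apply/measurable_EFinP; exact: measurable_int iF.
rewrite -oppr_ge0 -RintegralN//.
rewrite (@ae_eq_Rintegral _ _ _ nu D _ (fun x => `|F x|))//.
- exact: Rintegral_ge0.
- exact: measurable_funN.
- exact: measurableT_comp.
- by apply: ae_imply F0 => x H /H Fx; rewrite ler0_norm.
Qed.

End primitive1.

(** * The evolution problems *)

Section time_evolution.
Context {R : realType} {n : nat}.
Local Notation mu := (@lebesgue_measure R).
Variables (T : R) (O : set 'rV[R]_n).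
Hypotheses (T0 : 0 < T) (oO : open O) (bO : bounded_set O).

Let mO : measurable O. Proof. exact: open_measurable_rV. Qed.
Let Ooo : (leb n O < +oo)%E. Proof. exact: leb_bounded_lty. Qed.

Section primitive.
Variables u ut : R -> 'rV[R]_n -> R.
Hypotheses (L2u : time_L2 T O u) (L2ut : time_L2 T O ut)
  (wtd : weak_time_derivative T O u ut) (cu : continuous_L2 T O u).

(** At time 0 the integral runs over an empty interval, so [ae_time_primitive_at] identifies the
    constant with u(0, x). *)
Lemma ae_time_primitive0 :
  ae_in O (fun x => mu.-integrable `]0, T[ (EFin \o ut ^~ x) /\
    {ae mu, forall t, 0 < t < T ->
      u t x = u 0 x + \int[mu]_(s in `]0, t]) ut s x}).
Proof.
have zT : 0 \in `[0, T] by rewrite in_itv/= lexx ltW.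
have H0 := ae_time_primitive_at T0 mO Ooo L2u L2ut cu zT.
apply: ae_imply2 (ae_time_primitive T0 mO Ooo L2u L2ut wtd) H0 => x H1 H2 Ox.
have [iut [C aeC]] := H1 Ox; split => //.
by have := H2 Ox C aeC; rewrite set_itv_ge ?bnd_simp ?ltxx// Rintegral_set0 addr0 => ->.
Qed.

Lemma time_primitive t : t \in `[0, T] ->
  ae_in O (fun x => u t x = u 0 x + \int[mu]_(s in `]0, t]) ut s x).
Proof.
move=> tT; apply: ae_imply2 ae_time_primitive0
  (ae_time_primitive_at T0 mO Ooo L2u L2ut cu tT) => x H1 H2 Ox.
have [_ aeC] := H1 Ox; exact: H2.
Qed.

End primitive.

Lemma full_times_ae E : full_times T E -> {ae mu, forall t, 0 < t < T -> E t}.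
Proof.
move=> [_ [N [mN N0 EN]]]; exists N; split => // t /= /not_implyP[tT nE].
by apply: EN; split => //; rewrite /= in_itv.
Qed.

(** Since H(0) = 0, the equation forces u_t = 0 at contact as well as below the obstacle. The rest
    is the barrier lemma on almost every line x = const. *)
Lemma degenerate_ge_obstacle E u ut Du D2u f uc u0 :
  full_times T E -> strong_evolution T O E u ut Du D2u ->
  L2 O uc -> ae_in O (fun x => uc x < u0 x) ->
  (forall t, E t -> ae_in O (fun x => ut t x - heaviside (u t x - uc x) *
     (laplacian (fun i j => D2u i j t) x + f x) = 0)) ->
  ae_in O (fun x => u 0 x = u0 x) ->
  forall t, t \in `[0, T] -> ae_in O (fun x => uc x <= u t x).
Proof.
move=> Efull su [muc _] uc0 eqn u00 t tT.
have [L2u _ _ L2ut _ _ _ wtd cu] := su.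
pose I : set (measurableTypeR R) := `]0, T[%classic.
(* This consequence of the equation mentions only [u], [uc] and [ut], so its exceptional set is
   jointly measurable and the order of the quantifiers over time and space can be exchanged. *)
pose P (s : measurableTypeR R) (x : 'rV[R]_n) :=
  (I `*` O) (s, x) -> u s x <= uc x -> ut s x = 0.
have mIO : measurable (I `*` O) by apply: measurableX => //; exact: measurable_itv.
have mP : measurable [set z : measurableTypeR R * 'rV[R]_n | ~ P z.1 z.2].
  have [mu_ _] := L2u; have [mut _] := L2ut.
  have muc' : measurable_fun (I `*` O) (fun z : measurableTypeR R * 'rV[R]_n => uc z.2).
    apply: (measurable_comp mO _ muc) => [_ [z [_ Oz] <-]//|].
    exact: measurable_funTS measurable_snd.
  have mle : measurable ((I `*` O) `&` (fun z : measurableTypeR R * 'rV[R]_n =>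
      u z.1 z.2 - uc z.2) @^-1` `]-oo, 0]%classic).
    by apply: (measurable_funB mu_ muc') => //; exact: measurable_itv.
  have mne : measurable ((I `*` O) `&` (fun z : measurableTypeR R * 'rV[R]_n =>
      ut z.1 z.2) @^-1` (~` [set 0])).
    by apply: mut => //; apply: measurableC; exact: measurable_set1.
  rewrite (_ : [set z | _] = ((I `*` O) `&` (fun z : measurableTypeR R * 'rV[R]_n =>
      u z.1 z.2 - uc z.2) @^-1` `]-oo, 0]%classic) `&`
      ((I `*` O) `&` (fun z : measurableTypeR R * 'rV[R]_n =>
      ut z.1 z.2) @^-1` (~` [set 0]))); first exact: measurableI.
  apply/seteqP; split=> -[s x]; rewrite /P /= in_itv/= subr_le0.
    by move=> /not_implyP[h1 /not_implyP[h2 h3]].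
  by move=> [[h1 h2] [_ h3]] H; apply: h3; exact: H.
have aeP : {ae mu, forall s, {ae leb n, forall x, P s x}}.
  apply: ae_imply (full_times_ae Efull) => s Es.
  have [sT|nsT] := pselect (0 < s < T); last first.
    by apply: aeW => x [+ _]; rewrite /I/= in_itv.
  apply: ae_imply (eqn s (Es sT)) => x H [_ Ox] ule.
  move: (H Ox); rewrite /heaviside ifF ?mul0r ?subr0//.
  by apply/negbTE; rewrite -leNgt subr_le0.
have {}aeP := (ae_product_swap mu (leb n) mP).1 aeP.
have H0 := ae_time_primitive0 L2u L2ut wtd cu.
have Ht := time_primitive L2u L2ut wtd cu tT.
have u0uc := ae_imply2 (fun x H1 H2 => conj H1 H2) u00 uc0.
have H1 := ae_imply2 (fun x H1 H2 => conj H1 H2) u0uc aeP.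
apply: ae_imply2 H1 (ae_imply2 (fun x H1 H2 => conj H1 H2) H0 Ht).
move=> x [[u0x ucx] Px] [H0x Htx] Ox.
have [iut aeu] := H0x Ox; rewrite (Htx Ox).
apply: (primitive_ge_barrier T0 iut).
- by rewrite (u0x Ox) ltW// ucx.
- apply: ae_imply2 aeu Px => s us Ps sT ulec.
  apply: Ps; last by rewrite (us sT) ltW.
  by split => //; rewrite /I/= in_itv.
- by move: tT; rewrite in_itv.
Qed.

End time_evolution.

(** * From the degenerate problem to the obstacle problem, and uniqueness *)

Section equivalence.
Context {R : realType} {n : nat}.
Local Notation mu := (@lebesgue_measure R).
Variables (T : R) (O : set 'rV[R]_n).
Hypotheses (T0 : 0 < T) (oO : open O) (bO : bounded_set O).
Variables f uc u0 : 'rV[R]_n -> R.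

Let mO : measurable O. Proof. exact: open_measurable_rV. Qed.

Lemma degenerate_complementarity E u Duc D2uc :
  full_times T E -> H2_jet O uc Duc D2uc ->
  ae_in O (fun x => uc x < u0 x) ->
  ae_in O (fun x => laplacian D2uc x + f x <= 0) ->
  degenerate_solution T O f uc u0 E u -> complementarity_solution T O f uc u0 E u.
Proof.
move=> Efull juc uc0 lapuc [ut [Du [D2u [su eqn u00]]]].
have Luc : L2 O uc by case: juc => -[].
have uge := degenerate_ge_obstacle T0 oO bO Efull su Luc uc0 eqn u00.
have ET t : E t -> t \in `[0, T].
  by case: Efull => EI _ /EI; rewrite /= !in_itv/= => /andP[h1 h2]; rewrite !ltW.
have key t : E t -> ae_in O (fun x => uc x <= u t x /\
    ((uc x < u t x /\ ut t x = laplacian (fun i j => D2u i j t) x + f x) \/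
     (u t x = uc x /\ ut t x = 0 /\
      laplacian (fun i j => D2u i j t) x + f x <= 0))).
  move=> Et; have jut := evol_H2 su Et.
  (* The zero set of u(t) - u^c is the contact set; on it the sign of Delta u + f is inherited from
     the obstacle. *)
  have lap0 := laplacian_zero_set oO (H2_jetB oO bO jut juc).
  have h1 := ae_imply2 (fun x H1 H2 => conj H1 H2) (eqn t Et) (uge t (ET t Et)).
  apply: ae_imply2 h1 (ae_imply2 (fun x H1 H2 => conj H1 H2) lap0 lapuc).
  move=> x [ex ux] [lx lucx] Ox.
  have {ex} ex := ex Ox; have {ux} ux := ux Ox.
  have {lx} lx := lx Ox; have {lucx} lucx := lucx Ox.
  split => //; move: ux; rewrite le_eqVlt => /predU1P[E0|lt0]; [right|left].
    split => //; move: ex; rewrite E0 subrr /heaviside ltxx mul0r subr0 => ->.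
    split => //; have := lx; rewrite /= E0 subrr laplacianB => /(_ erefl)/eqP.
    by rewrite subr_eq0 => /eqP ->.
  split => //; move/eqP: ex; rewrite /heaviside subr_gt0 lt0 mul1r subr_eq0.
  by move=> /eqP.
exists ut, Du, D2u; split => //.
- by move=> t Et; apply: uge; exact: ET.
- move=> t /key; apply: ae_imply => x H /H[_ [[_ ->//]|[_ [-> //]]]].
- move=> t /key; apply: ae_imply => x H /H[_ [[_ ->]|[-> _]]].
    by rewrite (addrC (laplacian _ _)) addrK subrr mulr0.
  by rewrite subrr mul0r.
Qed.

Lemma complementarity_obstacle E w : full_times T E ->
  L2 O f -> L2 O uc -> H10 O u0 -> ae_in O (fun x => uc x < u0 x) ->
  complementarity_solution T O f uc u0 E w -> obstacle_solution T O f uc u0 E w.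
Proof.
move=> Efull Lf Luc H10u0 uc0 [wt [Dw [D2w [sw wge eqn compl w00]]]].
exists wt, Dw, D2w; split => //.
- by move=> t Et; split; [exact: evol_H10 sw t Et|exact: wge].
- move=> t phi Et [[Dphi [[Lphi _] _]] phige].
  have [[Lw _] H2w] := evol_H2 sw Et.
  have LD2 i : L2 O (D2w i i t) by have [_ H] := H2w i; have [] := H i.
  have Llap : L2 O (laplacian (fun i j => D2w i j t)).
    exact: (L2_laplacian oO bO LD2).
  have Lwt := evol_dt_slice sw Et.
  have Lres : L2 O (fun x => wt t x - laplacian (fun i j => D2w i j t) x - f x).
    by apply: (L2B oO _ Lf); exact: L2B.
  (* The integrand is nonnegative only almost everywhere, so it is exchanged for its absolute value
     before positivity of the integral is used. *)
  rewrite (@ae_eq_Rintegral _ _ _ (leb n) O _ (fun x =>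
    `|(wt t x - laplacian (fun i j => D2w i j t) x - f x) * (phi x - w t x)|))//.
  + by apply: Rintegral_ge0 => x _; exact: normr_ge0.
  + apply: measurable_funM; first by case: Lres.
    by have [] := L2B oO Lphi Lw.
  + apply: measurableT_comp => //; apply: measurable_funM; first by case: Lres.
    by have [] := L2B oO Lphi Lw.
  + have h1 := ae_imply2 (fun x H1 H2 => conj H1 H2) (eqn t Et) (compl t Et).
    apply: ae_imply2 h1 phige => x [H1 H2] H3 Ox.
    rewrite ger0_norm//; have {}H1 := H1 Ox; have {}H2 := H2 Ox; have {}H3 := H3 Ox.
    set r := wt t x - _ - _ in H2 *.
    have r0 : 0 <= r by rewrite /r -addrA -opprD subr_ge0.
    (* Passing through the obstacle: the first product is nonnegative because [phi] lies in the
       convex set, the second vanishes by complementarity. *)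
    have -> : r * (phi x - w t x) = r * (phi x - uc x) - (w t x - uc x) * r by ring.
    by rewrite H2 subr0 mulr_ge0// subr_ge0.
- by split => //; apply: ae_imply uc0 => x H Ox; rewrite ltW// H.
Qed.

(** The equations enter only through the sign of the integral of z_t z at times common to [E] and
    [F], which are still almost all times. *)
Lemma strong_evolution_unique E F u ut Du D2u w wt Dw D2w :
  full_times T E -> full_times T F ->
  strong_evolution T O E u ut Du D2u -> strong_evolution T O F w wt Dw D2w ->
  ae_in O (fun x => u 0 x = w 0 x) ->
  (forall t, E t -> F t ->
    \int[leb n]_(x in O) ((ut t x - wt t x) * (u t x - w t x)) <= 0) ->
  forall t, t \in `[0, T] -> ae_in O (fun x => u t x = w t x).
Proof.
move=> Efull Ffull su sw z00 zzt t tT.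
have [L2u _ _ L2ut _ _ _ wtdu cu] := su.
have [L2w _ _ L2wt _ _ _ wtdw cw] := sw.
have Ooo : (leb n O < +oo)%E by exact: leb_bounded_lty.
have [t0 tleT] : 0 <= t /\ t <= T by move: tT; rewrite in_itv => /andP[].
pose J : set (measurableTypeR R) := `]0, t[%classic.
have mJ : measurable J by exact: measurable_itv.
have JI : J `<=` `]0, T[%classic by apply: subset_itvl; rewrite bnd_simp.
pose H (p : measurableTypeR R * 'rV[R]_n) : R :=
  (ut p.1 p.2 - wt p.1 p.2) * (u p.1 p.2 - w p.1 p.2).
have mI : measurable (`]0, T[%classic : set (measurableTypeR R)) by exact: measurable_itv.
have mIO := measurableX mI mO.
have iM := time_L2_integrableM mO.
(* The integrand z_t z expands into four products of functions in L^2 of time and space. *)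
have iHI : (mu \x leb n)%E.-integrable (`]0, T[%classic `*` O) (EFin \o H).
  have := integrableD mIO
    (integrableB mIO (iM T _ _ L2ut L2u) (iM T _ _ L2ut L2w))
    (integrableB mIO (iM T _ _ L2wt L2w) (iM T _ _ L2wt L2u)).
  apply: eq_integrable => // p _ /=; rewrite -!EFinD; congr EFin.
  by rewrite /H; ring.
have iH : (mu \x leb n)%E.-integrable (J `*` O) (EFin \o H).
  apply: integrableS iHI => //; first exact: measurableX.
  by move=> p [h1 h2]; split => //; exact: JI.
have sq : ae_in O (fun x => (u t x - w t x) ^+ 2 =
    2 * \int[mu]_(s in J) H (s, x)).
  have Hu := ae_time_primitive0 T0 oO bO L2u L2ut wtdu cu.
  have Hw := ae_time_primitive0 T0 oO bO L2w L2wt wtdw cw.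
  have Hut := time_primitive T0 oO bO L2u L2ut wtdu cu tT.
  have Hwt := time_primitive T0 oO bO L2w L2wt wtdw cw tT.
  have Hs := @ae_integrable_slice2 _ _ _ _ _ mu (leb n) J O _ mJ mO iH.
  have H1 := ae_imply2 (fun x A B => conj A B) Hu Hw.
  have H2 := ae_imply2 (fun x A B => conj A B) Hut Hwt.
  have H3 := ae_imply2 (fun x A B => conj A B) z00 Hs.
  apply: ae_imply2 H1 (ae_imply2 (fun x A B => conj A B) H2 H3).
  move=> x [h1 h2] [[h3 h4] [h5 h6]] Ox.
  have [iut aeu] := h1 Ox; have [iwt aew] := h2 Ox.
  have {h3} h3 := h3 Ox; have {h4} h4 := h4 Ox; have {h5} h5 := h5 Ox.
  have {h6} iHx := h6 Ox.
  pose g s := ut s x - wt s x.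
  have ig : mu.-integrable `]0, T[ (EFin \o g) by exact: (integrableB mI iut iwt).
  have prim s : s <= T -> \int[mu]_(r in `]0, s]) ut r x -
      \int[mu]_(r in `]0, s]) wt r x = \int[mu]_(r in `]0, s]) g r.
    move=> sT; rewrite (primitive_patch sT iut) (primitive_patch sT iwt).
    rewrite (primitive_patch sT ig).
    have ip k : mu.-integrable `]0, T[ (EFin \o k) ->
        mu.-integrable `]0, s] (EFin \o (k \_ `]0, T[)).
      move=> ik; have : mu.-integrable setT (EFin \o (k \_ `]0, T[)).
        by rewrite -restrict_EFin; apply: (integrable_mkcond _ _).1.
      by apply: integrableS.
    rewrite -RintegralB//; [|exact: ip|exact: ip].
    apply: eq_Rintegral => r _; rewrite !patchE; case: ifPn => // _.
    by rewrite subrr.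
  rewrite h3 h4 h5 opprD addrACA subrr add0r prim// (sqr_primitive_oo tleT ig).
  congr (2 * _); apply: ae_eq_Rintegral => //.
  - apply: measurable_funM.
      apply: measurable_funS JI _ => //.
      by apply/measurable_EFinP; exact: measurable_int ig.
    have cI := primitive_continuous T0 ig.
    have := subspace_continuous_measurable_fun (measurable_itv `[0, T]) cI.
    apply: measurable_funS => // s /JI; rewrite /= !in_itv/= => /andP[? ?].
    by rewrite !ltW.
  - by apply/measurable_EFinP; exact: measurable_int iHx.
  - apply: ae_imply2 aeu aew => s us ws sJ.
    have sT : 0 < s < T by have := JI s sJ; rewrite /= in_itv.
    rewrite /H /= (us sT) (ws sT) h5 opprD addrACA subrr add0r prim//.
    by case/andP: sT => _ /ltW.
have [Lut _] := cu t tT; have [Lwt _] := cw t tT.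
have Lz := L2B oO Lut Lwt; have [mz iz2] := Lz.
have int_le0 : \int[leb n]_(x in O) ((u t x - w t x) ^+ 2) <= 0.
  rewrite (@ae_eq_Rintegral _ _ _ (leb n) O _ (fun x => 2 * \int[mu]_(s in J) H (s, x)))//.
  - have iG := @integrable_Fubini_G _ _ _ _ _ mu (leb n) J O _ mJ mO iH.
    (* Integrated over [O], the pointwise identity becomes, by Fubini, a time integral whose
       integrand is nonpositive for almost every s. *)
    rewrite RintegralZl// pmulr_rle0//.
    rewrite (@Rintegral_Fubini21 _ _ _ _ _ mu (leb n) J O _ mJ mO iH).
    rewrite -(@Rintegral_Fubini12 _ _ _ _ _ mu (leb n) J O _ mJ mO iH).
    apply: Rintegral_ae_le0 => //.
      exact: (@integrable_Fubini_F _ _ _ _ _ mu (leb n) J O _ mJ mO iH).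
    apply: ae_imply2 (full_times_ae Efull) (full_times_ae Ffull) => s Es Fs sJ.
    have sT : 0 < s < T by have := JI s sJ; rewrite /= in_itv.
    exact: zzt (Es sT) (Fs sT).
  - exact: measurable_funX.
  - apply: measurable_funM => //.
    apply/measurable_EFinP.
    exact: measurable_int (@integrable_Fubini_G _ _ _ _ _ mu (leb n) J O _ mJ mO iH).
have mz2 : measurable_fun O (fun x => ((u t x - w t x) ^+ 2)%:E).
  exact: measurable_int iz2.
have : (\int[leb n]_(x in O) `|((u t x - w t x) ^+ 2)%:E|)%E = 0%E.
  under eq_integral do rewrite gee0_abs ?lee_fin ?sqr_ge0//.
  rewrite -[LHS]fineK; last exact: integrable_fin_num iz2.
  congr EFin; apply/eqP; rewrite eq_le int_le0 andTb.
  by apply: Rintegral_ge0 => x _; exact: sqr_ge0.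
move/(ae_eq_integral_abs (leb n) mO mz2).1; apply: ae_imply => x Hx Ox.
by have [/eqP] := Hx Ox; rewrite sqrf_eq0 subr_eq0 => /eqP.
Qed.

Lemma obstacle_unique E F u w : full_times T E -> full_times T F ->
  L2 O f ->
  obstacle_solution T O f uc u0 E u -> obstacle_solution T O f uc u0 F w ->
  forall t, t \in `[0, T] -> ae_in O (fun x => u t x = w t x).
Proof.
move=> Efull Ffull Lf [ut [Du [D2u [su uK uvar u00 _]]]]
  [wt [Dw [D2w [sw wK wvar w00 _]]]].
apply: (strong_evolution_unique Efull Ffull su sw).
  by apply: ae_imply2 u00 w00 => x H1 H2 Ox; rewrite H1// H2.
move=> t Et Ft.
have ju := evol_H2 su Et; have jw := evol_H2 sw Ft.
have := laplacian_energy oO bO (H2_jetB oO bO ju jw)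
  (H10B oO bO (evol_H10 su Et) (evol_H10 sw Ft)).
have := uvar t (w t) Et (wK t Ft); have := wvar t (u t) Ft (uK t Et).
have [[Lu _] H2u] := ju; have [[Lw _] H2w] := jw.
have LD2u i : L2 O (D2u i i t) by have [_ H] := H2u i; have [] := H i.
have LD2w i : L2 O (D2w i i t) by have [_ H] := H2w i; have [] := H i.
have Llapu := L2_laplacian oO bO (D2f := fun i j => D2u i j t) LD2u.
have Llapw := L2_laplacian oO bO (D2f := fun i j => D2w i j t) LD2w.
have Lut := evol_dt_slice su Et; have Lwt := evol_dt_slice sw Ft.
have Lres : L2 O (fun x => ut t x - laplacian (fun i j => D2u i j t) x - f x).
  by apply: (L2B oO _ Lf); exact: L2B.
have Lres' : L2 O (fun x => wt t x - laplacian (fun i j => D2w i j t) x - f x).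
  by apply: (L2B oO _ Lf); exact: L2B.
have Lz := L2B oO Lu Lw; have Lz' := L2B oO Lw Lu.
move=> h1 h2 h3; have := addr_ge0 h1 h2.
have i1 := L2_integrableM oO Lres Lz'; have i2 := L2_integrableM oO Lres' Lz.
rewrite -RintegralD//.
have Lzt := L2B oO Lut Lwt; have Llap := L2B oO Llapu Llapw.
have i3 := L2_integrableM oO Lzt Lz; have i4 := L2_integrableM oO Llap Lz.
(* In the sum [h4] of the two inequalities [f] cancels, leaving the integral of (Delta z - z_t) z
   nonnegative with z = u - w; this bounds the integral of z_t z by the one in [h3]. *)
move=> h4; apply: le_trans h3; rewrite -subr_ge0.
rewrite -RintegralB//; last first.
  apply: eq_integrable i4 => // x _ /=.
  by rewrite (laplacianB (fun i j => D2u i j t) (fun i j => D2w i j t)).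
apply: le_trans h4 _; rewrite le_eqVlt; apply/orP; left; apply/eqP.
apply: eq_Rintegral => x _.
rewrite (laplacianB (fun i j => D2u i j t) (fun i j => D2w i j t)) /=.
ring.
Qed.

End equivalence.

Theorem proposition2p1 (R : realType) (n : nat) (hn : (0 < n)%N)
    (Omega : set 'rV[R]_n) (hOmega : smooth_bounded_domain Omega)
    (T : R) (hT : 0 < T)
    (u0 f uc : 'rV[R]_n -> R)
    (hu0 : H10 Omega u0) (hf : L2 Omega f)
    (Duc : 'I_n -> 'rV[R]_n -> R) (D2uc : 'I_n -> 'I_n -> 'rV[R]_n -> R)
    (huc : H2_jet Omega uc Duc D2uc)
    (huc_bd : nonpos_on_boundary Omega uc)
    (hu0uc : ae_in Omega (fun x => uc x < u0 x))
    (hLuc : ae_in Omega (fun x => laplacian D2uc x + f x <= 0))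
    (E : set R) (hE : full_times T E)
    (u : R -> 'rV[R]_n -> R)
    (hu : degenerate_solution T Omega f uc u0 E u) :
  [/\ obstacle_solution T Omega f uc u0 E u,
      forall (F : set R) (w : R -> 'rV[R]_n -> R), full_times T F ->
        obstacle_solution T Omega f uc u0 F w ->
        forall t : R, t \in `[0, T] -> ae_in Omega (fun x => u t x = w t x),
      complementarity_solution T Omega f uc u0 E u
    & forall (F : set R) (w : R -> 'rV[R]_n -> R), full_times T F ->
        complementarity_solution T Omega f uc u0 F w ->
        forall t : R, t \in `[0, T] -> ae_in Omega (fun x => u t x = w t x)].
Proof.
have [oO _ _ bO _] := hOmega.
have Luc : L2 Omega uc by case: huc => -[].
have cu := degenerate_complementarity hT oO bO hE huc hu0uc hLuc hu.
have ou := complementarity_obstacle oO bO hE hf Luc hu0 hu0uc cu.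
split => //.
  by move=> F w hF; exact: (obstacle_unique hT oO bO hE hF hf ou).
(* A solution of the complementarity system solves the variational inequality, so uniqueness for the
   latter covers both. *)
move=> F w hF cw; apply: (obstacle_unique hT oO bO hE hF hf ou).
exact: (complementarity_obstacle oO bO hF hf Luc hu0 hu0uc cw).
Qed.
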